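(* Let $L>0$, let $P\in H^2(0,L)$ be real-valued with $P(x)\ge P^0>0$ on $[0,L]$, and let $\theta_1,\dots,\theta_4\in\mathbb R$. Suppose there are constants $a,b>0$ with $(a+b-1)^2<4ab$ such that $\theta_1=\theta_3/b-a$, $\theta_2=\theta_4/b$, and suppose $\theta_1,\theta_3<0$, $\theta_2,\theta_4>0$. Let $\mathcal H=\{(w,v,\xi,\psi): w\in H^2(0,L),\ v\in H^1(0,L),\ \xi=v(L),\ \psi=v(0)\}$ with the norm $\|\cdot\|$ of $H^2\times H^1\times\mathbb C\times\mathbb C$, $F[w,v]=\theta_1v(0)+\theta_2v'(0)+\theta_3w(0)+\theta_4w'(0)$, and $A(w,v,\xi,\psi)=(v,(Pw')',-w'(L),F[w,v])$ with domain $$D(A)=\{(w,v,\xi,\psi): w\in H^3(0,L),\ v\in H^2(0,L),\ \xi=v(L),\ \psi=v(0),\ (Pw')'(L)=-w'(L),\ (Pw')'(0)=F[w,v]\}.$$ Then the $C_0$-semigroup $\{T(t)\}_{t\ge0}$ generated by $A$ is exponentially stable: there exist constants $M\ge1$ and $\omega>0$ such that $\|T(t)\|\le Me^{-\omega t}$ for all $t\ge0$.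
   Context: Prime denotes $d/dx$; functions are complex-valued; $\|T(t)\|$ is the operator norm on $\mathcal H$. *)

(* Defs.v *)
From HB Require Import structures.
From mathcomp Require Import all_boot all_order all_algebra.
From mathcomp Require Import all_classical all_reals all_analysis.
From mathcomp Require Import complex.
Set Implicit Arguments. Unset Strict Implicit. Unset Printing Implicit Defensive.
Import Order.TTheory GRing.Theory Num.Theory.
Import numFieldNormedType.Exports.
Local Open Scope classical_set_scope.
Local Open Scope ring_scope.
Local Open Scope complex_scope.

Section Defs.
Variable R : realType.

Definition csq (z : R[i]) : R := complex.Re z ^+ 2 + complex.Im z ^+ 2.

Definition L2r (L : R) (h : R -> R) : Prop :=
  lebesgue_measure.-integrable `[0, L] (EFin \o h) /\
  lebesgue_measure.-integrable `[0, L] (EFin \o (fun x => h x ^+ 2)).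

Definition H1r (L : R) (f : R -> R) : Prop :=
  exists h, L2r L h /\
    forall x, 0 <= x <= L ->
      f x = f 0 + Rintegral lebesgue_measure `[0, x] h.

Definition dI (L : R) (f : R -> R) : R -> R := fun x =>
  if (0 < x) && (x < L) then derive1 f x
  else if x == 0 then lim (derive1 f y @[y --> 0^'+])
  else if x == L then lim (derive1 f y @[y --> L^'-])
  else 0.

Definition cdI (L : R) (f : R -> R[i]) : R -> R[i] := fun x =>
  Complex (dI L (fun y => complex.Re (f y)) x) (dI L (fun y => complex.Im (f y)) x).

(* complex H^k(0,L); elements are represented by their continuous
   representative on [0,L], extended by 0 outside [0,L] *)
Definition H1c (L : R) (f : R -> R[i]) : Prop :=
  (forall x, ~ (0 <= x <= L) -> f x = 0) /\
  H1r L (fun y => complex.Re (f y)) /\ H1r L (fun y => complex.Im (f y)).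
Definition H2c (L : R) (f : R -> R[i]) : Prop := H1c L f /\ H1c L (cdI L f).
Definition H3c (L : R) (f : R -> R[i]) : Prop := H1c L f /\ H2c L (cdI L f).

(* real H^2(0,L) (values outside [0,L] irrelevant) *)
Definition H2r (L : R) (f : R -> R) : Prop := H1r L f /\ H1r L (dI L f).

Definition l2sq (L : R) (f : R -> R[i]) : R :=
  Rintegral lebesgue_measure `[0, L] (fun x => csq (f x)).

Definition St := ((R -> R[i]) * (R -> R[i]) * R[i] * R[i])%type.

Definition addS (x y : St) : St :=
  let: (w1, v1, a1, b1) := x in let: (w2, v2, a2, b2) := y in
  ((fun s => w1 s + w2 s), (fun s => v1 s + v2 s), a1 + a2, b1 + b2).
Definition scaleS (c : R[i]) (x : St) : St :=
  let: (w, v, a, b) := x in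
  ((fun s => c * w s), (fun s => c * v s), c * a, c * b).
Definition subS (x y : St) : St := addS x (scaleS (-1) y).

Definition normS (L : R) (x : St) : R :=
  let: (w, v, a, b) := x in
  Num.sqrt (l2sq L w + l2sq L (cdI L w) + l2sq L (cdI L (cdI L w))
          + l2sq L v + l2sq L (cdI L v) + csq a + csq b).

Definition inH (L : R) (x : St) : Prop :=
  let: (w, v, a, b) := x in H2c L w /\ H1c L v /\ a = v L /\ b = v 0.

Definition flux (L : R) (P : R -> R) (w : R -> R[i]) : R -> R[i] :=
  fun y => (P y)%:C * cdI L w y.
Definition Fbd (L th1 th2 th3 th4 : R) (w v : R -> R[i]) : R[i] :=
  th1%:C * v 0 + th2%:C * cdI L v 0 + th3%:C * w 0 + th4%:C * cdI L w 0.

Definition opA (L : R) (P : R -> R) (th1 th2 th3 th4 : R) (x : St) : St :=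
  let: (w, v, a, b) := x in
  (v, cdI L (flux L P w), - cdI L w L, Fbd L th1 th2 th3 th4 w v).
Definition inDA (L : R) (P : R -> R) (th1 th2 th3 th4 : R) (x : St) : Prop :=
  let: (w, v, a, b) := x in
  H3c L w /\ H2c L v /\ a = v L /\ b = v 0 /\
  cdI L (flux L P w) L = - cdI L w L /\
  cdI L (flux L P w) 0 = Fbd L th1 th2 th3 th4 w v.

Definition diffq_to (L : R) (T : R -> St -> St) (x y : St) : Prop :=
  forall e : R, 0 < e -> exists d : R, 0 < d /\
    forall h : R, 0 < h < d ->
      normS L (subS (scaleS (h^-1)%:C (subS (T h x) x)) y) < e.

Definition C0_semigroup_generated_by (L : R) (P : R -> R)
    (th1 th2 th3 th4 : R) (T : R -> St -> St) : Prop :=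
  (forall t x, 0 <= t -> inH L x -> inH L (T t x)) /\
      (forall t x y (c : R[i]), 0 <= t -> inH L x -> inH L y ->
          T t (addS x (scaleS c y)) = addS (T t x) (scaleS c (T t y))) /\
      (forall t, 0 <= t -> exists C : R, forall x, inH L x ->
          normS L (T t x) <= C * normS L x) /\
      (forall x, inH L x -> T 0 x = x) /\
      (forall t s x, 0 <= t -> 0 <= s -> inH L x -> T (t + s) x = T t (T s x)) /\
      (forall x, inH L x -> forall e : R, 0 < e -> exists d : R, 0 < d /\
          forall t : R, 0 <= t < d -> normS L (subS (T t x) x) < e) /\
      (forall x, inH L x ->
          (inDA L P th1 th2 th3 th4 x ->
              diffq_to L T x (opA L P th1 th2 th3 th4 x)) /\
          (forall y, inH L y -> diffq_to L T x y -> inDA L P th1 th2 th3 th4 x)).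

End Defs.

(* Main.v *)
(* Along a classical solution put eta = w_t + b w, where v = w_t.  With theta_1 = theta_3/b - a and
   theta_2 = theta_4/b the feedback law becomes the boundary identity
     P(0) eta_x(0) = c_v (eta_t(0) - (b - a) v(0)) + c_eta eta(0),  c_v = P(0) b / theta_4,
     c_eta = - P(0) theta_3 / theta_4,
   and the weighted energy
     int P eta_x^2 + eta_t^2 + P(L) eta_t(L)^2 + c_eta eta(0)^2 + c_v v(0)^2
   has derivative -2 c_v (eta_t(0)^2 - (b - a + 1) v(0) eta_t(0) + b v(0)^2), which is negative definite
   in the two boundary values exactly when (a + b - 1)^2 < 4 a b.  Subtracting 2 int P k eta_t eta_x
   with a fast decaying weight k produces the missing distributed terms and the term in eta_t(L);
   adding a multiple of (P(L) eta_t(L) + int eta_t) eta(0), whose derivative contains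
   -(P eta_x)(0) eta(0), produces the missing eta(0)^2.  For a large factor of the energy the sum W is
   equivalent to the squared norm (the elliptic equation (P w')' - b^2 w = eta_t - b eta with its
   boundary condition at L recovers w), and W'(x; A x) <= -omega W x on D(A).  The decay passes from
   D(A) to the whole space by density.

   The operators T(t) are not assumed uniformly bounded near t = 0, so left lower semicontinuity of the
   orbits is obtained from Baire's theorem. *)
Require Import Defs.
From HB Require Import structures.
From mathcomp Require Import all_boot all_order all_algebra.
From mathcomp Require Import all_classical all_reals all_analysis.
From mathcomp Require Import measurable_realfun complex ring lra.
Set Implicit Arguments. Unset Strict Implicit. Unset Printing Implicit Defensive.
Import Order.TTheory GRing.Theory Num.Theory.
Import numFieldNormedType.Exports.
Local Open Scope classical_set_scope.
Local Open Scope ring_scope.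

(** * Square-integrable functions and absolute continuity *)

Section SquareIntegrable.
Variables (R : realType) (L : R).
Hypothesis L_gt0 : 0 < L.
Implicit Types (f g h : R -> R) (x y s c M : R).
Notation mu := (@lebesgue_measure R).

(** Why eta = w_t + b w: since w_tt = (P w_x)_x, it solves the same wave equation eta_tt = (P
    eta_x)_x, with eta_tt(L) = -eta_x(L), and the four feedback terms at 0 collapse into one
    relation between eta_x(0), eta_t(0), eta(0) and v(0). Its wave energy lies one derivative above
    that of w, which matches H^2 x H^1: eta_x contains v' and eta_t contains P w''. Multiplier
    arguments for eta therefore give estimates in the prescribed norm. All coefficients are real and
    the form is quadratic over the reals, so a complex state is split into real and imaginary parts,
    and each estimate is made for one real component with its derivatives as explicit data. The top
    derivatives w'' and v' of a state are fixed only up to null sets, whereas the boundary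
    conditions on D(A) are pointwise; both readings of a derivative have to be reconciled. The
    semigroup enters through its axioms alone. Orbits in D(A) are differentiable from the right, so
    the decay comes from a Dini-type comparison: the generator bounds the increments to the right,
    and to the left some earlier time with a nearby state is enough. *)

Definition integrable0L (f : R -> R) : Prop := mu.-integrable `[0, L] (EFin \o f).
Definition int0 (f : R -> R) : R := Rintegral mu `[0, L] f.

Lemma itvE x : (`[0, L]%classic x) = (0 <= x <= L) :> Prop.
Proof. by rewrite /= in_itv. Qed.

Lemma integrable0L_measurable f : integrable0L f -> measurable_fun `[0, L] f.
Proof. by case/integrableP => /measurable_EFinP. Qed.

Lemma integrable0L_le f g : measurable_fun `[0, L] f -> integrable0L g ->
  (forall x, 0 <= x <= L -> `|f x| <= g x) -> integrable0L f.
Proof.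
move=> mf ig fg; apply: le_integrable ig => //; first exact/measurable_EFinP.
move=> x; rewrite itvE => /fg; rewrite /= lee_fin => h.
by rewrite (le_trans h)// ler_norm.
Qed.

Lemma integrable0L_lin f g s : integrable0L f -> integrable0L g -> integrable0L (fun x => f x + s * g x).
Proof.
move=> hf hg; rewrite /integrable0L.
have -> : EFin \o (fun x => f x + s * g x) = ((EFin \o f) \+ (fun x => s%:E * (EFin \o g) x))%E.
  by apply/funext.
by apply: integrableD => //; exact: integrableZl.
Qed.

Lemma eq_integrable0L f g : integrable0L f -> (forall x, 0 <= x <= L -> f x = g x) -> integrable0L g.
Proof.
move=> hf fg; apply: eq_integrable hf => // x; rewrite inE itvE => /fg /= ->.
by [].
Qed.

Lemma int0_lin f g s : integrable0L f -> integrable0L g -> int0 (fun x => f x + s * g x) = int0 f + s * int0 g.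
Proof.
move=> hf hg; rewrite /int0 RintegralD//= ?RintegralZl//.
apply: (@eq_integrable0L (fun x => 0 + s * g x)) => [|x _]; last by rewrite add0r.
by apply: integrable0L_lin => //; exact: integrable0.
Qed.

Lemma eq_int0 f g : (forall x, 0 <= x <= L -> f x = g x) -> int0 f = int0 g.
Proof. by move=> fg; apply: eq_Rintegral => x; rewrite inE itvE => /fg. Qed.

Lemma le_int0 f g : integrable0L f -> integrable0L g -> (forall x, 0 <= x <= L -> f x <= g x) -> int0 f <= int0 g.
Proof. by move=> hf hg fg; apply: le_Rintegral => // x; rewrite itvE; exact: fg. Qed.

Lemma int0_ge0 f : (forall x, 0 <= x <= L -> 0 <= f x) -> 0 <= int0 f.
Proof. by move=> f0; apply: Rintegral_ge0 => x; rewrite itvE; exact: f0. Qed.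

Lemma integrable0L_cont f : {within `[0, L], continuous f} -> integrable0L f.
Proof.
by move=> cf; apply: continuous_compact_integrable => //; exact: segment_compact.
Qed.

Lemma integrable0L_cst c : integrable0L (fun=> c).
Proof. by apply: integrable0L_cont; apply: continuous_subspaceT => x; exact: cvg_cst. Qed.

Lemma int0_cst c : int0 (fun=> c) = c * L.
Proof.
rewrite /int0 Rintegral_cst//= lebesgue_measure_itv/= lte_fin L_gt0/=.
by rewrite oppr0 addr0.
Qed.

Lemma integrable0L_L2 f : L2r L f -> integrable0L f. Proof. by case. Qed.

Lemma L2_mul f g : L2r L f -> L2r L g -> integrable0L (fun x => f x * g x).
Proof.
move=> [hf hf2] [hg hg2]; apply: (@integrable0L_le _ (fun x => f x ^+ 2 + 1 * g x ^+ 2)).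
- by apply: measurable_funM; apply: integrable0L_measurable.
- exact: integrable0L_lin.
- move=> x _; rewrite ler_norml; apply/andP; split.
    have := sqr_ge0 (f x + g x); have := sqr_ge0 (f x); have := sqr_ge0 (g x); nra.
  have := sqr_ge0 (f x - g x); have := sqr_ge0 (f x); have := sqr_ge0 (g x); nra.
Qed.

Lemma L2_lin f g s : L2r L f -> L2r L g -> L2r L (fun x => f x + s * g x).
Proof.
move=> hf hg; split; first by apply: integrable0L_lin; apply: integrable0L_L2.
have := integrable0L_lin (2 * s) (L2_mul hf hf) (L2_mul hf hg).
move=> /(integrable0L_lin (s ^+ 2))/(_ (L2_mul hg hg)) /eq_integrable0L; apply => x _.
by ring.
Qed.

Lemma L2_eq f g : L2r L f -> (forall x, 0 <= x <= L -> f x = g x) -> L2r L g.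
Proof.
move=> [h1 h2] e; split; first exact: eq_integrable0L e.
by apply: (eq_integrable0L h2) => x /e ->.
Qed.

Lemma cont_bounded f : {within `[0, L], continuous f} ->
  exists2 M, 0 < M & forall x, 0 <= x <= L -> `|f x| <= M.
Proof.
move=> cf; have := continuous_compact cf (@segment_compact _ 0 L).
move=> /compact_bounded[M [_ hM]]; exists (`|M| + 1); first by rewrite ltr_wpDl.
move=> x xL; apply: (hM (`|M| + 1)); first by rewrite (le_lt_trans (ler_norm _))// ltrDl.
by exists x => //=; rewrite in_itv.
Qed.

Lemma L2_contM h f : {within `[0, L], continuous h} -> L2r L f ->
  L2r L (fun x => h x * f x).
Proof.
move=> ch hf; have [M M0 hM] := cont_bounded ch.
have mh : measurable_fun `[0, L] h by apply: integrable0L_measurable; exact: integrable0L_cont.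
have mf : measurable_fun `[0, L] f by apply: integrable0L_measurable; case: hf.
have habs : integrable0L (fun x => 0 + M * `|f x|).
  apply: integrable0L_lin; first exact: integrable0L_cst.
  by have := integrable_norm (integrable0L_L2 hf).
split.
  apply: (integrable0L_le _ habs); first exact: measurable_funM.
  by move=> x xL; rewrite add0r normrM ler_wpM2r// hM.
have h2 : integrable0L (fun x => 0 + M ^+ 2 * (f x ^+ 2)).
  by apply: integrable0L_lin; [exact: integrable0L_cst|case: hf].
apply: (integrable0L_le _ h2); first by apply: measurable_funX; exact: measurable_funM.
move=> x xL; rewrite add0r ger0_norm ?sqr_ge0// exprMn ler_wpM2r ?sqr_ge0//.
by rewrite -(real_normK (num_real (h x))) lerXn2r ?nnegrE ?hM// ltW.
Qed.

Lemma L2_cst c : L2r L (fun=> c).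
Proof. by split; [exact: integrable0L_cst|exact: (integrable0L_cst (c ^+ 2))]. Qed.

Lemma cont_L2 f : {within `[0, L], continuous f} -> L2r L f.
Proof.
move=> /L2_contM /(_ (L2_cst 1)) /L2_eq; apply => x _; exact: mulr1.
Qed.

End SquareIntegrable.

(** * Real induction and one-sided differential inequalities *)

Section RealInduction.
Variable R : realType.

(** By completeness: the supremum of the times up to which [Q] holds is again such a time by the
    hypothesis from the left, and the hypothesis from the right would move it further unless it is
    [T]. *)
Lemma real_induction (T : R) (Q : R -> Prop) : 0 <= T -> Q 0 ->
  (forall t, 0 <= t < T -> (forall s, 0 <= s <= t -> Q s) ->
    exists2 d, 0 < d & forall s, t < s < t + d -> s <= T -> Q s) ->
  (forall t, 0 < t <= T -> (forall s, 0 <= s < t -> Q s) -> Q t) ->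
  Q T.
Proof.
move=> T0 Q0 Qr Ql.
pose E := [set t | 0 <= t <= T /\ forall s, 0 <= s <= t -> Q s].
have E0 : E 0.
  split; first by rewrite lexx.
  by move=> s /andP[s0 s1]; have -> : s = 0 by apply/eqP; rewrite eq_le s0 s1.
have ubE : ubound E T by move=> t [/andP[]].
have hsE : has_sup E by split; [exists 0|exists T].
set c := sup E.
have cT : c <= T by apply: ge_sup => //; exists 0.
have c0 : 0 <= c by apply: ub_le_sup => //; exists T.
have below s : 0 <= s < c -> Q s.
  move=> /andP[s0 sc]; have [t Et st] := sup_adherent (ltac:(by rewrite subr_gt0; exact: sc) : 0 < c - s) hsE.
  case: Et => _; apply; rewrite s0/= ltW//.
  by move: st; rewrite -/c subKr.
have Qc : Q c.
  have [c00|cn0] := eqVneq c 0; first by rewrite c00.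
  by apply: Ql => //; rewrite lt_neqAle eq_sym cn0 c0.
have upto s : 0 <= s <= c -> Q s.
  move=> /andP[s0]; rewrite le_eqVlt => /predU1P[->//|sc].
  by apply: below; rewrite s0.
move: cT; rewrite le_eqVlt => /predU1P[<-//|cT].
have [d d0 hd] := Qr c (introT andP (conj c0 cT)) upto.
pose t := Num.min T (c + d / 2).
have ct : c < t by rewrite /t lt_min cT/= ltrDl divr_gt0.
suff Et : E t by have : t <= c := ub_le_sup (ex_intro _ T ubE) Et; rewrite leNgt ct.
split.
  by rewrite (le_trans c0 (ltW ct))/= /t ge_min lexx.
move=> s /andP[s0 st]; have [sc|cs] := leP s c; first by apply: upto; rewrite s0.
apply: hd; last by rewrite (le_trans st)// /t ge_min lexx.
rewrite cs/= (le_lt_trans st)// /t gt_min; apply/orP; right.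
by rewrite ltrD2l ltr_pdivrMr// ltr_pMr// ltr1n.
Qed.

(** The condition from the left is a weak substitute for continuity: one earlier point at which
    [phi] is almost as large. It may lie anywhere before [t], since [psi] is monotone and the bound
    at that point is inherited. This fits orbits that are controlled from the left only along some
    times. *)
Lemma dini_le (T e : R) (phi psi : R -> R) : 0 <= T -> 0 <= e ->
  (forall s t, 0 <= s <= t -> t <= T -> psi s <= psi t) ->
  (forall t, 0 <= t < T -> exists2 d, 0 < d & forall s, t < s < t + d -> s <= T ->
     phi s <= phi t + e * (psi s - psi t)) ->
  (forall t, 0 < t <= T -> forall r, 0 < r -> exists2 s, 0 <= s < t & phi t <= phi s + r) ->
  phi T <= phi 0 + e * (psi T - psi 0).
Proof.
move=> T0 e0 psim hr hl.
apply: (@real_induction T (fun t => phi t <= phi 0 + e * (psi t - psi 0))) => //.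
- by rewrite subrr mulr0 addr0.
- move=> t tT Qt; have [d d0 hd] := hr t tT; exists d => // s st sT.
  rewrite (le_trans (hd s st sT))//.
  have := Qt t; rewrite lexx; case/andP: tT => -> _ /(_ isT); lra.
- move=> t /andP[t0 tT] Qt; apply/ler_addgt0Pr => r r0.
  have [s st hs] := hl t (introT andP (conj t0 tT)) r r0.
  have := Qt s st; have := psim s t; case/andP: st => s0 st; rewrite s0 ltW// tT => /(_ isT isT) h.
  have := ler_wpM2l e0 h; lra.
Qed.
End RealInduction.

(** * Functions with a square-integrable weak derivative *)

Section H1.
Variables (R : realType) (L : R).
Hypothesis L_gt0 : 0 < L.
Notation mu := (@lebesgue_measure R).
Implicit Types (f g h F G : R -> R) (x y s t e d : R).

Lemma within_contP f : {within `[0, L], continuous f} <->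
  forall x, 0 <= x <= L -> forall e, 0 < e -> exists2 d, 0 < d &
    forall y, 0 <= y <= L -> `|y - x| < d -> `|f y - f x| < e.
Proof.
split=> [/subspace_continuousP cf x xL e e0|cf].
  have /cvgrPdist_lt /(_ e e0) := cf x (ltac:(by rewrite itvE)).
  rewrite /= near_withinE /prop_near1 /nbhs /= => -[d /= d0 hd]; exists d => // y yL yx.
  by rewrite distrC; apply: hd => /=; rewrite ?in_itv// distrC.
apply/subspace_continuousP => x; rewrite itvE => xL.
apply/cvgrPdist_lt => e e0; have [d d0 hd] := cf x xL e e0.
rewrite near_withinE; exists d => //= y yx; rewrite in_itv/= => yL.
by rewrite distrC; apply: hd => //; rewrite distrC.
Qed.

(** The weak derivative is carried as a datum, fixed up to null sets, so that sums and products come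
    with an explicit derivative and no choice is made. *)
Definition isH1 f F : Prop :=
  L2r L F /\ forall x, 0 <= x <= L -> f x = f 0 + int0 x F.

Lemma integrable0L_sub x F : x <= L -> integrable0L L F -> integrable0L x F.
Proof. by move=> xL; apply: integrableS => //; apply: subset_itvl; rewrite bnd_simp. Qed.

Lemma isH1_L2 f F : isH1 f F -> L2r L F. Proof. by case. Qed.

Lemma isH1_cont f F : isH1 f F -> {within `[0, L], continuous f}.
Proof.
move=> [[iF _] hf].
have := parameterized_integral_continuous (ltW L_gt0) iF.
move=> h; have : {within `[0, L], continuous (fun x => f 0 + int0 x F)}.
  by move=> x; apply: cvgD; [exact: cvg_cst|exact: h].
apply: subspace_eq_continuous => x; rewrite inE /= in_itv /= => xL.
exact: (esym (hf _ xL)).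
Qed.

Lemma isH1_L2f f F : isH1 f F -> L2r L f.
Proof. by move=> /isH1_cont; exact: cont_L2. Qed.

Lemma isH1_lin f F g G s : isH1 f F -> isH1 g G ->
  isH1 (fun x => f x + s * g x) (fun x => F x + s * G x).
Proof.
move=> [hF hf] [hG hg]; split; first exact: L2_lin.
move=> x xL; rewrite hf// hg//; case/andP: xL => x0 xL.
rewrite (int0_lin s (integrable0L_sub xL (integrable0L_L2 hF)) (integrable0L_sub xL (integrable0L_L2 hG))); ring.
Qed.

Lemma isH1_cst c : isH1 (fun=> c) (fun=> 0).
Proof.
split; first exact: L2_cst.
by move=> x _; rewrite /int0 /Rintegral integral0_eq// addr0.
Qed.

Lemma int0_diff F x y : integrable0L L F -> 0 <= x <= y -> y <= L ->
  int0 y F - int0 x F = Rintegral mu `]x, y] F.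
Proof.
move=> iF /andP[x0 xy] yL; rewrite /int0 Rintegral_itvB ?bnd_simp//.
exact: (integrable0L_sub yL).
Qed.

Lemma Rintegral_itvoc_lin F G s x y : integrable0L L F -> integrable0L L G -> 0 <= x -> y <= L ->
  Rintegral mu `]x, y] (fun t => F t + s * G t) = Rintegral mu `]x, y] F + s * Rintegral mu `]x, y] G.
Proof.
move=> iF iG x0 yL.
have sub H : integrable0L L H -> mu.-integrable `]x, y] (EFin \o H).
  apply: integrableS => //; apply: subset_itvScc; rewrite bnd_simp//.
have iG' : integrable0L L (fun t => s * G t).
  apply: (eq_integrable0L (integrable0L_lin s (integrable0L_cst L 0) iG)) => t _; exact: add0r.
by rewrite RintegralD ?RintegralZl//; exact: sub.
Qed.

(* A Dini-derivative argument: the defect [f g - int (f G + g F)] grows by at most [e] times the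
   increment of [int (|F| + |G|)], for every [e > 0]. *)
Lemma isH1_mul f F g G : isH1 f F -> isH1 g G ->
  isH1 (fun x => f x * g x) (fun x => f x * G x + g x * F x).
Proof.
move=> Hf Hg.
have L2fG : L2r L (fun x => f x * G x) := L2_contM (isH1_cont Hf) (isH1_L2 Hg).
have L2gF : L2r L (fun x => g x * F x) := L2_contM (isH1_cont Hg) (isH1_L2 Hf).
split.
  apply: (L2_eq (L2_lin 1 L2fG L2gF)) => x _; by rewrite mul1r.
(* One inequality suffices: applied to [- f] it gives the opposite one. *)
suff key f1 F1 : isH1 f1 F1 -> forall T, 0 <= T <= L ->
    f1 T * g T <= f1 0 * g 0 + int0 T (fun x => f1 x * G x + g x * F1 x).
  move=> x xL; apply/eqP; rewrite eq_le key//=.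
  have Hf' : isH1 (fun x => - f x) (fun x => - F x).
    have := isH1_lin (-1) (isH1_cst 0) Hf.
    by congr isH1; apply/funext => t; rewrite add0r mulN1r.
  have := key _ _ Hf' x xL.
  have -> : int0 x (fun y => - f y * G y + g y * - F y) = - int0 x (fun y => f y * G y + g y * F y).
    have iI : integrable0L x (fun y => f y * G y + g y * F y).
      case/andP: xL => _ xL; apply: (integrable0L_sub xL).
      apply: (eq_integrable0L (integrable0L_lin 1 (integrable0L_L2 L2fG) (integrable0L_L2 L2gF))) => t _; by rewrite mul1r.
    have := int0_lin (-1) (integrable0L_cst x 0) iI.
    rewrite mulN1r [int0 x (fun=> 0)](_ : _ = 0) ?add0r; last first.
      by rewrite /int0 /Rintegral integral0_eq.
    move=> <-; apply: eq_int0 => t _; ring.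
  rewrite !mulNr; lra.
move=> {Hf L2fG L2gF f F} Hf T /andP[T0 TL].
have cf := (within_contP _).1 (isH1_cont Hf).
have cg := (within_contP _).1 (isH1_cont Hg).
have iF := integrable0L_L2 (isH1_L2 Hf); have iG := integrable0L_L2 (isH1_L2 Hg).
have L2fG : L2r L (fun x => f1 x * G x) := L2_contM (isH1_cont Hf) (isH1_L2 Hg).
have L2gF : L2r L (fun x => g x * F1 x) := L2_contM (isH1_cont Hg) (isH1_L2 Hf).
set Z := fun x => f1 x * G x + g x * F1 x.
have iZ : integrable0L L Z.
  apply: (eq_integrable0L (integrable0L_lin 1 (integrable0L_L2 L2fG) (integrable0L_L2 L2gF))) => t _; by rewrite mul1r.
set A := fun x => `|F1 x| + `|G x|.
have iA : integrable0L L A.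
  apply: (eq_integrable0L (integrable0L_lin 1 (integrable_norm iF) (integrable_norm iG))) => t _; by rewrite /= mul1r.
have cZ : {within `[0, L], continuous (fun x => int0 x Z)} := parameterized_integral_continuous (ltW L_gt0) iZ.
have cphi : forall x, 0 <= x <= L -> forall e, 0 < e -> exists2 d, 0 < d &
    forall y, 0 <= y <= L -> `|y - x| < d -> `|(f1 y * g y - int0 y Z) - (f1 x * g x - int0 x Z)| < e.
  apply/within_contP => x; apply: cvgB; last exact: cZ.
  by apply: cvgM; [exact: (isH1_cont Hf)|exact: (isH1_cont Hg)].
suff main e : 0 < e -> f1 T * g T - int0 T Z <= f1 0 * g 0 - int0 0 Z + e * (int0 T A - int0 0 A).
  have I0 H : int0 0 H = 0 by rewrite /int0 set_itv1 Rintegral_set1.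
  rewrite -lerBlDr; apply/ler_addgt0Pr => r r0.
  have A0 : 0 <= int0 T A by apply: int0_ge0 => x _; rewrite addr_ge0.
  have := main (r / (int0 T A + 1)) (divr_gt0 r0 (ltr_wpDl A0 ltr01)); rewrite !I0 !subr0.
  move=> h; apply: (le_trans h); rewrite lerD2l mulrAC ler_pdivrMr ?ltr_wpDl//.
  by rewrite ler_wpM2l ?(ltW r0)// lerDl.
move=> e0.
apply: (@dini_le _ T e (fun x => f1 x * g x - int0 x Z) (fun x => int0 x A)) => //; first exact: ltW.
- move=> s t st tT; rewrite -subr_ge0 (int0_diff iA) ?(le_trans tT)//.
  by apply: Rintegral_ge0 => x _; rewrite addr_ge0.
- move=> t /andP[t0 tT].
  have tL : 0 <= t <= L by rewrite t0 ltW// (lt_le_trans tT).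
  have e20 : 0 < e / 2 by rewrite divr_gt0.
  (* The increment of [f1] enters the defect twice and that of [g] once, hence the tolerances
     [e / 2] and [e]. *)
  have [d1 d10 h1] := cf t tL (e / 2) e20.
  have [d2 d20 h2] := cg t tL e e0.
  exists (Num.min d1 d2); first by rewrite lt_min d10.
  move=> s /andP[ts sd] sT.
  have sL : s <= L by rewrite (le_trans sT).
  have ts' : 0 <= t <= s by rewrite t0 ltW.
  rewrite -lerBlDl.
  have -> : f1 s * g s - int0 s Z - (f1 t * g t - int0 t Z) = f1 s * (g s - g t) + g t * (f1 s - f1 t) - (int0 s Z - int0 t Z) by ring.
  have sb : 0 <= s <= L by rewrite sL (le_trans t0)// ltW.
  have -> : g s - g t = int0 s G - int0 t G by rewrite (Hg.2 s)// (Hg.2 t)//; ring.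
  have -> : f1 s - f1 t = int0 s F1 - int0 t F1 by rewrite (Hf.2 s)// (Hf.2 t)//; ring.
  rewrite !int0_diff//.
  have iE : integrable0L L (fun x => (f1 s * G x + g t * F1 x) + (-1) * Z x).
    apply: integrable0L_lin => //; apply: (eq_integrable0L (integrable0L_lin (f1 s) (integrable0L_lin (g t) (integrable0L_cst L 0) iF) iG)) => x _; ring.
  have -> : f1 s * Rintegral mu `]t, s] G + g t * Rintegral mu `]t, s] F1 - Rintegral mu `]t, s] Z
     = Rintegral mu `]t, s] (fun x => (f1 s * G x + g t * F1 x) + (-1) * Z x).
    have i0 : integrable0L L (fun x => f1 s * G x).
      by apply: (eq_integrable0L (integrable0L_lin (f1 s) (integrable0L_cst L 0) iG)) => x _; rewrite add0r.
    have i1 := integrable0L_lin (g t) i0 iF.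
    rewrite Rintegral_itvoc_lin// Rintegral_itvoc_lin// RintegralZl//; first by ring.
    by apply: integrableS iG => //; apply: subset_itvScc; rewrite bnd_simp.
  have -> : e * Rintegral mu `]t, s] A = Rintegral mu `]t, s] (fun x => e * A x).
    by rewrite RintegralZl//; apply: integrableS iA => //; apply: subset_itvScc; rewrite bnd_simp.
  apply: le_Rintegral => //.
  + by apply: integrableS iE => //; apply: subset_itvScc; rewrite bnd_simp.
  + have : integrable0L L (fun x => e * A x).
      by apply: (eq_integrable0L (integrable0L_lin e (integrable0L_cst L 0) iA)) => x _; rewrite add0r.
    by apply: integrableS => //; apply: subset_itvScc; rewrite bnd_simp.
  move=> x; rewrite /= in_itv/= => /andP[tx xs]; rewrite /Z /A.
  have xL : 0 <= x <= L by rewrite (le_trans t0 (ltW tx)) (le_trans xs).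
  have near y : t <= y <= s -> `|y - t| < Num.min d1 d2.
    by move=> /andP[ty ys]; rewrite ger0_norm ?subr_ge0// ltrBlDl (le_lt_trans ys).
  have hx := near x; have hs := near s; rewrite lexx (ltW tx) xs (ltW ts) in hx hs.
  have := hx isT; have := hs isT; rewrite !lt_min => /andP[s1 s2] /andP[x1 x2].
  have := h1 x xL x1; have := h1 s sb s1; have := h2 x xL x2.
  have -> : f1 s * G x + g t * F1 x + -1 * (f1 x * G x + g x * F1 x) =
     (f1 s - f1 t) * G x - (f1 x - f1 t) * G x - (g x - g t) * F1 x by ring.
  move=> b1 b2 b3.
  have k (u v c : R) : `|u| < c -> u * v <= c * `|v|.
    by move=> uc; rewrite (le_trans (ler_norm _))// normrM ler_wpM2r// ltW.
  have := k _ (G x) _ b2.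
  have := k (- (f1 x - f1 t)) (G x) (e / 2); rewrite normrN => /(_ b3).
  have := k (- (g x - g t)) (F1 x) e; rewrite normrN => /(_ b1).
  rewrite !mulNr; lra.
- move=> t /andP[t0 tT] r r0.
  have tL : 0 <= t <= L by rewrite ltW// (le_trans tT).
  have [d d0 hd] := cphi t tL r r0.
  exists (Num.max 0 (t - d / 2)).
    by rewrite le_max lexx/= gt_max t0 ltrBlDl ltrDr divr_gt0.
  set s := Num.max _ _.
  have st : s < t by rewrite gt_max t0 ltrBlDl ltrDr divr_gt0.
  have s0 : 0 <= s by rewrite le_max lexx.
  have sd : t - d / 2 <= s by rewrite le_max lexx orbT.
  have := hd s; rewrite s0 (ltW (lt_le_trans st _))//; last by case/andP: tL.
  rewrite ltr0_norm ?subr_lt0// => /(_ isT) h.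
  have : - (s - t) < d by lra.
  move=> /h; rewrite ltr_norml => /andP[]; lra.
Qed.

Lemma int0_deriv f F : isH1 f F -> int0 L F = f L - f 0.
Proof. by move=> [_ /(_ L)]; rewrite lexx (ltW L_gt0) => /(_ isT) ->; rewrite addrC addKr. Qed.

End H1.

(** * Integrals of almost everywhere equal functions *)

Section LowerIntegral.
Context d (T : measurableType d) (R : realType) (mu : {measure set T -> \bar R}).
Local Open Scope ereal_scope.
Import HBSimple HBNNSimple.

(* Mathcomp's integral of a nonnegative function is a lower integral, so the function [f] need not be measurable here. *)
Lemma ge0_ae_integral_eq (D : set T) (f g : T -> \bar R) :
  measurable D -> measurable_fun D g ->
  (forall x, 0 <= f x) -> (forall x, 0 <= g x) ->
  {ae mu, forall x, D x -> f x = g x} ->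
  \int[mu]_(x in D) f x = \int[mu]_(x in D) g x.
Proof.
move=> mD mg f0 g0 [N [mN N0 sN]].
have fgN x : ~ N x -> (f \_ D) x = (g \_ D) x.
  move=> Nx; rewrite !patchE; case: ifPn => // /set_mem Dx.
  by apply: contrapT => fg; apply: Nx; apply: sN => /= /(_ Dx).
have mgD : measurable_fun [set: T] (g \_ D).
  by apply/(measurable_restrictT _ mD).
have gD0 x : 0 <= (g \_ D) x by rewrite patchE; case: ifP.
have hN (h : {nnsfun T >-> R}) : sintegral mu h = \int[mu]_(x in ~` N) (h x)%:E.
  rewrite -integralT_nnsfun (@ge0_negligible_integral _ _ _ _ setT N)//.
  - by rewrite setTD.
  - exact/measurable_EFinP.
  - by move=> x _; rewrite lee_fin.
apply/eqP; rewrite eq_le; apply/andP; split.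
  rewrite ge0_integralE//; apply/ge_ereal_sup => _ [h /= hf <-].
  rewrite hN; apply: (@le_trans _ _ (\int[mu]_(x in ~` N) (g \_ D) x)).
    apply: ge0_le_integral => //.
    - exact: measurableC.
    - by move=> x _; rewrite lee_fin.
    - exact/measurable_funTS/measurable_EFinP.
    - exact: measurable_funTS.
    - by move=> x Nx; rewrite -fgN.
  rewrite [leRHS]integral_mkcond; apply: ge0_subset_integral => //.
  exact: measurableC.
rewrite ge0_integralE//; apply/ge_ereal_sup => _ [h /= hg <-].
rewrite [leRHS]ge0_integralE//.
(* Setting [h] to 0 on the null set [N] keeps its integral and puts it below [f]. *)
apply: ereal_sup_ubound; exists (proj_nnsfun h (measurableC mN)).
  move=> x /=; rewrite mindicE; have [xN|xN] := boolP (x \in ~` N).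
    by rewrite mulr1 fgN//; apply: set_mem.
  by rewrite mulr0 patchE; case: ifP.
rewrite !hN; apply: eq_integral => x xN /=.
by rewrite mindicE xN mulr1.
Qed.
End LowerIntegral.

(** * Pointwise derivatives and weak derivatives *)

Section DI.
Variables (R : realType) (L : R).
Hypothesis L_gt0 : 0 < L.
Notation mu := (@lebesgue_measure R).
Implicit Types (f g h F G : R -> R) (x y s t e : R).

Lemma int0_0 F : int0 0 F = 0.
Proof. by rewrite /int0 set_itv1 Rintegral_set1. Qed.

Lemma integrable0L_patch F : integrable0L L F -> mu.-integrable setT (EFin \o (F \_ `[0, L])).
Proof.
move=> iF; rewrite -restrict_EFin.
by apply/integrable_restrict => //; rewrite setTI.
Qed.

Lemma int0_patch F x : x <= L -> int0 x (F \_ `[0, L]) = int0 x F.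
Proof.
move=> xL; apply: eq_int0 => t /andP[t0 tx]; rewrite patchE mem_set//=.
by rewrite in_itv/= t0 (le_trans tx).
Qed.

(** The fundamental theorem is applied to [F] extended by zero, which is integrable on the whole
    line. Near an interior point its primitive differs from [f] by the constant [f 0], so the
    derivatives agree. *)
Lemma derive1_isH1 f F x : isH1 L f F -> 0 < x < L ->
  derive1 (fun y => int0 y (F \_ `[0, L])) x = derive1 f x.
Proof.
move=> Hf /andP[x0 xL]; rewrite !derive1E.
have -> : 'D_1 (fun y => int0 y (F \_ `[0, L])) x = 'D_1 (fun y => int0 y (F \_ `[0, L]) + f 0) x.
  rewrite /derive; pose G y := int0 y (F \_ `[0, L]).
  have E : (fun r : R => r^-1 *: (((fun y => G y + f 0) \o shift x) (r *: (1 : R)) - (G x + f 0)))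
      = (fun r : R => r^-1 *: ((G \o shift x) (r *: (1 : R)) - G x)).
    by apply/funext => r /=; rewrite opprD addrACA subrr addr0.
  exact: (congr1 (fun k => lim (k @ 0^')) (esym E)).
apply: near_eq_derive.
have : \forall y \near x, y \in `]0, L[ by apply: near_in_itvoo; rewrite in_itv/= x0.
apply: filterS => y; rewrite in_itv/= => /andP[y0 yL].
by rewrite int0_patch ?(ltW yL)// addrC -(Hf.2 y)// !ltW.
Qed.

(** Lebesgue differentiation; the end points, where [dI] is a limit of derivatives, are put into the
    null set. *)
Lemma dI_ae f F : isH1 L f F -> {ae mu, forall x, 0 <= x <= L -> dI L f x = F x}.
Proof.
move=> Hf; have iF := integrable0L_L2 (isH1_L2 Hf).
have iP := integrable0L_patch iF.
have := @FTC1 R (F \_ `[0, L]) (BLeft 0).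
move=> /(_ (fun y => ltac:(by apply: integrableS iP))).
move=> /(_ (integrable_locally (measurable_itv _) iF)) /= h1.
have h0 : mu.-negligible [set 0 : R] by apply/negligibleP => //; exact: lebesgue_measure_set1.
have hL : mu.-negligible [set L] by apply/negligibleP => //; exact: lebesgue_measure_set1.
have {h0 hL} := negligibleU (negligibleU h0 hL) h1.
apply: negligibleS => x /= hx; apply: contrapT => nx; apply: hx => /andP[x0 xL].
move: nx => /not_orP[/not_orP[nx0 nxL]] /contrapT.
have x0' : 0 < x by rewrite lt_neqAle x0 andbT eq_sym; apply/eqP.
have xL' : x < L by rewrite lt_neqAle xL andbT; apply/eqP.
rewrite lte_fin => /(_ x0')[_].
rewrite (@derive1_isH1 f F x Hf) ?x0'// /dI x0' xL'/= => ->.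
by rewrite patchE mem_set//= in_itv/= x0.
Qed.

(** The everywhere version is what the domain requires, because its boundary conditions evaluate
    derivatives at 0 and [L]. There the one-sided limits in [dI] are limits of the continuous
    [F]. *)
Lemma dI_cont f F : isH1 L f F -> {within `[0, L], continuous F} ->
  forall x, 0 <= x <= L -> dI L f x = F x.
Proof.
move=> Hf cF; have iF := integrable0L_L2 (isH1_L2 Hf).
have iP := integrable0L_patch iF.
have [cin c0 cL] := (continuous_within_itvP F L_gt0).1 cF.
have inn x : 0 < x < L -> derive1 f x = F x.
  move=> /andP[x0 xL]; rewrite -(derive1_isH1 Hf) ?x0//.
  have := @continuous_FTC1 R (F \_ `[0, L]) (BLeft 0) x (x + 1).
  rewrite ltrDl ltr01 => /(_ isT) [].
  - by apply: integrableS iP.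
  - by rewrite lte_fin.
  - have := cin x; rewrite in_itv/= x0 xL => /(_ isT) cx.
    rewrite /prop_for /continuous_at patchE mem_set/= ?in_itv/= ?(ltW x0) ?(ltW xL)//.
    apply: cvg_trans cx; apply: near_eq_cvg.
    have : \forall y \near x, y \in `]0, L[ by apply: near_in_itvoo; rewrite in_itv/= x0.
    apply: filterS => y; rewrite in_itv/= => /andP[y0 yL].
    by rewrite patchE mem_set//= in_itv/= !ltW.
  - by move=> _ ->; rewrite patchE mem_set//= in_itv/= !ltW.
move=> x /andP[x0 xL]; rewrite /dI.
have [xi|] := boolP ((0 < x) && (x < L)); first exact: inn.
rewrite negb_and -!leNgt => /orP hx; have [->|xn0] := eqVneq x 0.
  apply: cvg_lim => //; apply: cvg_trans c0; apply: near_eq_cvg.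
  near=> y; rewrite inn//; apply/andP; split; near: y; first exact: nbhs_right_gt.
  exact: nbhs_right_lt.
have [->|xnL] := eqVneq x L.
  apply: cvg_lim => //; apply: cvg_trans cL; apply: near_eq_cvg.
  near=> y; rewrite inn//; apply/andP; split; near: y; last exact: nbhs_left_lt.
  exact: nbhs_left_gt.
case: hx => hx.
  by case/eqP: xn0; apply/eqP; rewrite eq_le x0 hx.
by case/eqP: xnL; apply/eqP; rewrite eq_le xL hx.
Unshelve. all: by end_near. Qed.

Lemma isH1_C1 f F : (forall x, 0 <= x <= L -> is_derive x 1 f (F x)) ->
  continuous F -> isH1 L f F.
Proof.
move=> df cF; split; first by apply: cont_L2; exact: continuous_subspaceT.
move=> x /andP[]; rewrite le_eqVlt => /predU1P[<- _|x0 xL]; first by rewrite int0_0 addr0.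
have cf y : 0 <= y <= L -> {for y, continuous f}.
  by move=> /df[dy _]; apply: differentiable_continuous; apply/derivable1_diffP.
have inL y : y \in `]0, x[ -> 0 <= y <= L.
  by rewrite in_itv/= => /andP[y0 yx]; rewrite (ltW y0)/= (le_trans (ltW yx)).
rewrite /int0 /Rintegral (@continuous_FTC2 _ F f)//= ?subrKC//.
- exact: continuous_subspaceT.
- split => [y /inL /df[] //||].
  + by apply: cvg_at_right_filter; apply: cf; rewrite lexx ltW.
  + by apply: cvg_at_left_filter; apply: cf; rewrite (ltW x0).
- by move=> y /inL yL; rewrite derive1E; case: (df y yL).
Qed.

Lemma ae_eq_int0 f g : integrable0L L f -> integrable0L L g ->
  {ae mu, forall x, 0 <= x <= L -> f x = g x} -> int0 L f = int0 L g.
Proof.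
move=> iF iG fg; rewrite /int0 /Rintegral; congr fine; apply: ae_eq_integral => //.
- by apply/measurable_EFinP; exact: integrable0L_measurable.
- by apply/measurable_EFinP; exact: integrable0L_measurable.
- by apply: negligibleS fg => x; apply: contra_not => /= h; rewrite in_itv/= => /h ->.
Qed.

End DI.

(** * Inner products, integration by parts and traces *)

Section InnerProduct.
Variables (R : realType) (L : R).
Hypothesis L_gt0 : 0 < L.
Implicit Types (f g h k F G : R -> R) (x y s t c : R).

Definition ip f g : R := int0 L (fun x => f x * g x).

Lemma ip_sym f g : ip f g = ip g f.
Proof. by apply: eq_int0 => x _; rewrite mulrC. Qed.

Lemma ip_linl f g h s : L2r L f -> L2r L g -> L2r L h ->
  ip (fun x => f x + s * g x) h = ip f h + s * ip g h.
Proof.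
move=> hf hg hh; rewrite -(int0_lin s (L2_mul hf hh) (L2_mul hg hh)).
by apply: eq_int0 => x _; ring.
Qed.

Lemma ip_linr f g h s : L2r L f -> L2r L g -> L2r L h ->
  ip h (fun x => f x + s * g x) = ip h f + s * ip h g.
Proof. by move=> hf hg hh; rewrite ip_sym ip_linl// ![ip h _]ip_sym. Qed.

Lemma ip_ge0 f : 0 <= ip f f.
Proof. by apply: int0_ge0 => x _; rewrite -expr2 sqr_ge0. Qed.

Lemma ip_eq f g f' g' : (forall x, 0 <= x <= L -> f x * g x = f' x * g' x) -> ip f g = ip f' g'.
Proof. exact: eq_int0. Qed.

(** Transfers pointwise Young-type inequalities to inner products. Three terms on the right cover
    all later uses; spare ones get coefficient 0. *)
Lemma ip_le3 f1 g1 f2 g2 f3 g3 f4 g4 c1 c2 c3 :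
  L2r L f1 -> L2r L g1 -> L2r L f2 -> L2r L g2 -> L2r L f3 -> L2r L g3 -> L2r L f4 -> L2r L g4 ->
  (forall x, 0 <= x <= L -> f1 x * g1 x <= c1 * (f2 x * g2 x) + c2 * (f3 x * g3 x) + c3 * (f4 x * g4 x)) ->
  ip f1 g1 <= c1 * ip f2 g2 + c2 * ip f3 g3 + c3 * ip f4 g4.
Proof.
move=> h1 k1 h2 k2 h3 k3 h4 k4 hle.
have i2 := integrable0L_lin c1 (integrable0L_cst L 0) (L2_mul h2 k2).
have i23 := integrable0L_lin c2 i2 (L2_mul h3 k3).
have i234 := integrable0L_lin c3 i23 (L2_mul h4 k4).
have -> : c1 * ip f2 g2 + c2 * ip f3 g3 + c3 * ip f4 g4 =
   int0 L (fun x => (0 + c1 * (f2 x * g2 x)) + c2 * (f3 x * g3 x) + c3 * (f4 x * g4 x)).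
  rewrite (int0_lin c3 i23 (L2_mul h4 k4)) (int0_lin c2 i2 (L2_mul h3 k3)).
  rewrite (int0_lin c1 (integrable0L_cst L 0) (L2_mul h2 k2)) int0_cst// mul0r add0r //.
apply: le_int0 => //; first exact: L2_mul.
by move=> x xL; rewrite add0r; exact: hle.
Qed.

(** Cauchy-Schwarz against the constant 1, read off from the squared norm of [f] minus its mean
    [S / L]. *)
Lemma int0_sqr_le f : L2r L f -> int0 L f ^+ 2 <= L * ip f f.
Proof.
move=> hf; set S := int0 L f.
have h1 : L2r L (fun=> 1) by apply: L2_cst.
have hg := L2_lin (- (S / L)) hf h1.
have := ip_ge0 (fun x => f x + - (S / L) * 1).
rewrite ip_linl// !ip_linr//.
have -> : ip f (fun=> 1) = S by apply: eq_int0 => x _; rewrite mulr1.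
have -> : ip (fun=> 1) f = S by apply: eq_int0 => x _; rewrite mul1r.
have -> : ip (fun=> 1) (fun=> 1) = L by rewrite /ip int0_cst// !mul1r.
have L0 : L != 0 by rewrite gt_eqF.
move=> h; have := ler_wpM2l (ltW L_gt0) h.
have -> : L * (ip f f + - (S / L) * S + - (S / L) * (S + - (S / L) * L)) = L * ip f f - S ^+ 2 by field.
by rewrite mulr0 subr_ge0.
Qed.

Lemma ibp f F g G : isH1 L f F -> isH1 L g G ->
  ip f G + ip g F = f L * g L - f 0 * g 0.
Proof.
move=> Hf Hg; have := int0_deriv L_gt0 (isH1_mul L_gt0 Hf Hg) => <-.
have := int0_lin 1 (L2_mul (isH1_L2f L_gt0 Hf) (isH1_L2 Hg)) (L2_mul (isH1_L2f L_gt0 Hg) (isH1_L2 Hf)).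
by rewrite mul1r => <-; apply: eq_int0 => x _; rewrite mul1r.
Qed.

Lemma isH1_ext f F f' F' : isH1 L f F -> (forall x, 0 <= x <= L -> f x = f' x) ->
  (forall x, 0 <= x <= L -> F x = F' x) -> isH1 L f' F'.
Proof.
move=> [hF hf] ef eF; split; first exact: L2_eq eF.
move=> x xL; rewrite -ef// -ef ?lexx ?(ltW L_gt0)// hf//; congr (_ + _).
apply: eq_int0 => t /andP[t0 tx]; apply: eF; rewrite t0 (le_trans tx)//; by case/andP: xL.
Qed.

Lemma isH1_compl : isH1 L (fun x => L - x) (fun=> -1).
Proof.
split=> [|x /andP[]]; first exact: L2_cst.
rewrite le_eqVlt => /predU1P[<- _|x0 _]; first by rewrite int0_0 addr0.
by rewrite int0_cst// subr0 mulN1r.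
Qed.

(** Integration by parts of (L - x) f against f; the factor L - x removes the trace at [L]. Both the
    trace bound at 0 and the Poincare inequality follow from this identity. *)
Lemma sqr_weighted f F : isH1 L f F ->
  L * f 0 ^+ 2 = ip f f - 2 * ip (fun x => (L - x) * f x) F.
Proof.
move=> Hf; have H := isH1_mul L_gt0 isH1_compl Hf.
have := ibp H Hf; rewrite subrr subr0 mul0r mul0r sub0r.
have hf := isH1_L2f L_gt0 Hf; have hF := isH1_L2 Hf.
have hc : L2r L (fun x => (L - x) * F x) := L2_contM (isH1_cont L_gt0 isH1_compl) hF.
have -> : ip f (fun x => (L - x) * F x + f x * -1) = ip (fun x => (L - x) * f x) F - ip f f.
  have -> : ip (fun x => (L - x) * f x) F = ip f (fun x => (L - x) * F x).
    by apply: ip_eq => x _; ring.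
  rewrite -[- ip f f]mulN1r -ip_linr//; apply: ip_eq => x _; ring.
by move=> e; rewrite expr2 mulrA -[LHS]opprK -e; ring.
Qed.

Lemma trace0 f F : isH1 L f F -> f 0 ^+ 2 <= ((1 + L) / L) * (ip f f + ip F F).
Proof.
move=> Hf; have hf := isH1_L2f L_gt0 Hf; have hF := isH1_L2 Hf.
rewrite mulrAC ler_pdivlMr// mulrC (sqr_weighted Hf).
have hc : L2r L (fun x => (L - x) * f x) := L2_contM (isH1_cont L_gt0 isH1_compl) hf.
have hN : L2r L (fun x => - f x).
  by apply: (L2_eq (L2_lin (-1) (L2_cst L 0) hf)) => x _; rewrite add0r mulN1r.
have : ip (fun x => (-2) * ((L - x) * f x)) F <= L * ip f f + L * ip F F + 0 * ip F F.
  apply: ip_le3 => //.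
    by apply: (L2_eq (L2_lin (-2) (L2_cst L 0) hc)) => x _; rewrite add0r.
  move=> x /andP[x0 xL]; rewrite mul0r addr0.
  have h1 : (L - x) * (2 * - f x * F x) <= (L - x) * (f x ^+ 2 + F x ^+ 2).
    rewrite ler_wpM2l ?subr_ge0//; have := sqr_ge0 (f x + F x); nra.
  have h2 : (L - x) * (f x ^+ 2 + F x ^+ 2) <= L * (f x ^+ 2 + F x ^+ 2).
    by rewrite ler_wpM2r ?addr_ge0 ?sqr_ge0// gerBl.
  have := le_trans h1 h2; rewrite !expr2; lra.
have -> : ip (fun x => -2 * ((L - x) * f x)) F = -2 * ip (fun x => (L - x) * f x) F.
  rewrite -[RHS]add0r -[X in X + _](_ : ip (fun=> 0) F = 0); last first.
    by rewrite -[RHS](mul0r L) -(int0_cst L_gt0 0); apply: eq_int0 => x _; rewrite mul0r.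
  by rewrite -ip_linl//; [apply: ip_eq => x _; rewrite add0r|exact: L2_cst].
have := ip_ge0 F; lra.
Qed.

(** The additional 1 pays for f(L)^2 - f(0)^2, which is twice the inner product of [f] and [F]. *)
Lemma traceL f F : isH1 L f F -> f L ^+ 2 <= ((1 + L) / L + 1) * (ip f f + ip F F).
Proof.
move=> Hf; have := trace0 Hf; have := ibp Hf Hf.
have hf := isH1_L2f L_gt0 Hf; have hF := isH1_L2 Hf.
have : ip f F <= 2^-1 * ip f f + 2^-1 * ip F F + 0 * ip F F.
  apply: ip_le3 => // x _; have := sqr_ge0 (f x - F x); nra.
rewrite -!expr2; lra.
Qed.

(** Poincare inequality. As [f - f 0] has no trace at 0, [sqr_weighted] bounds its squared norm by
    twice a product with [F]; Young's inequality absorbs one half of the left side, and 2 L^2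
    becomes 4 L^2. *)
Lemma deviation_le f F : isH1 L f F ->
  ip (fun x => f x - f 0) (fun x => f x - f 0) <= 4 * L ^+ 2 * ip F F.
Proof.
move=> Hf; have H : isH1 L (fun x => f x - f 0) F.
  by apply: (isH1_ext (isH1_lin (- f 0) Hf (isH1_cst L 1))) => x _; rewrite ?mulr1 ?mulr0 ?addr0.
have := sqr_weighted H; rewrite subrr expr2 !mulr0.
have hf := isH1_L2f L_gt0 H; have hF := isH1_L2 Hf.
have hc : L2r L (fun x => (L - x) * (f x - f 0)) := L2_contM (isH1_cont L_gt0 isH1_compl) hf.
have : ip (fun x => (L - x) * (f x - f 0)) F <=
   4^-1 * ip (fun x => f x - f 0) (fun x => f x - f 0) + L ^+ 2 * ip F F + 0 * ip F F.
  apply: ip_le3 => // x /andP[x0 xL]; rewrite mul0r addr0.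
  set h := f x - f 0.
  have h2 : (L - x) ^+ 2 * F x ^+ 2 <= L ^+ 2 * F x ^+ 2.
    rewrite ler_wpM2r ?sqr_ge0// lerXn2r ?nnegrE ?subr_ge0// ?gerBl// ltW//.
  have := sqr_ge0 (2^-1 * h - (L - x) * F x); nra.
lra.
Qed.

End InnerProduct.

(** * The multiplier estimate *)

Section Dissipation.
Variable R : realType.
Implicit Types (x y t : R).

Lemma young t x y : 0 < t -> 2 * x * y <= t * x ^+ 2 + t^-1 * y ^+ 2.
Proof.
move=> t0; have : 0 <= t^-1 * (t * x - y) ^+ 2 by rewrite mulr_ge0 ?sqr_ge0// invr_ge0 ltW.
have -> : t^-1 * (t * x - y) ^+ 2 = t * x ^+ 2 + t^-1 * y ^+ 2 - 2 * x * y by field; rewrite gt_eqF.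
by rewrite subr_ge0.
Qed.

(** What remains of the multiplier estimate once integrals and traces are numbers: [X] and [Y] stand
    for the squared norms of eta_x and eta_t, [S] for the integral of eta_t, [gL] and [g0] for eta_t
    at the ends, [u0] for eta(0), [v0] for v(0) and [q0] for (P eta_x)(0). [K] is fixed before [N],
    since only terms in [g0] and [v0] can be repaid by a large [N]. *)
Lemma scalar_dissipation (L PL Pz kl m c c' e b d1 : R) :
  0 < L -> 0 < PL -> 0 <= Pz -> 0 < kl -> 0 < m -> 0 < c -> 0 < c' -> 0 < d1 ->
  exists K N0 dl, [/\ 0 < K, 0 < N0, 0 < dl &
  forall N X Y S gL g0 u0 v0 q0, N0 <= N -> 0 <= X -> 0 <= Y -> S ^+ 2 <= L * Y ->
    q0 = c' * (g0 - e * v0) + c * u0 ->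
    d1 * (g0 ^+ 2 + v0 ^+ 2) <= g0 ^+ 2 - (e + 1) * (v0 * g0) + b * v0 ^+ 2 ->
    - 2 * N * c' * (g0 ^+ 2 - (e + 1) * (v0 * g0) + b * v0 ^+ 2)
      - kl * Y - PL * kl * gL ^+ 2 + Pz * g0 ^+ 2 + q0 ^+ 2 - m * X
      + 2 * K * (- q0 * u0 + (PL * gL + S) * g0)
    <= - dl * (X + Y + gL ^+ 2 + u0 ^+ 2 + v0 ^+ 2)].
Proof.
move=> L0 PL0 Pz0 kl0 m0 c0 c'0 d10.
(* Against - 2 K c u0^2 stand 3 c^2 u0^2 from [q0 ^+ 2] and (K c / 2) u0^2 from Young's inequality.
   With K c = 3 c^2 + 1 at least one unit of u0^2 survives. *)
pose K := 3 * c + c^-1.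
have K0 : 0 < K by rewrite addr_gt0 ?mulr_gt0 ?invr_gt0.
(* The total spent on g0^2 + v0^2 by the estimates below; [N >= N0] repays it with one unit to
   spare. *)
pose C0 := Pz + 3 * c' ^+ 2 * (1 + e ^+ 2) + 4 * K * c^-1 * c' ^+ 2 * (1 + e ^+ 2)
   + 2 * K ^+ 2 * PL / kl + 2 * K ^+ 2 * L / kl.
have C00 : 0 <= C0.
  have e1 : 0 <= 1 + e ^+ 2 by rewrite addr_ge0 ?sqr_ge0.
  have kli : 0 <= kl^-1 by rewrite invr_ge0 ltW.
  rewrite /C0 !addr_ge0// ?mulr_ge0 ?invr_ge0 ?sqr_ge0// ltW//.
pose N0 := (C0 + 1) / (2 * c' * d1).
have N00 : 0 < N0 by rewrite divr_gt0 ?mulr_gt0// ltr_wpDl.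
(* Half of the coefficients of [Y] and [gL ^+ 2] is spent on the cross terms with [K], which
   explains the divisions by 2. *)
pose dl := Num.min (Num.min m (kl / 2)) (Num.min (PL * kl / 2) 1).
have dl0 : 0 < dl by rewrite !lt_min m0 !divr_gt0 ?mulr_gt0//= ltr01.
exists K, N0, dl; split => // N X Y S gL g0 u0 v0 q0 hN X0 Y0 hS hq hd.
set T := g0 ^+ 2 + v0 ^+ 2 in hd *; set B := g0 ^+ 2 - _ + _ in hd *.
have T0 : 0 <= T by rewrite addr_ge0 ?sqr_ge0.
have s1 : - 2 * N * c' * B <= - (C0 + 1) * T.
  have h1 : N0 * (c' * (d1 * T)) <= N * (c' * B).
    apply: ler_pM => //; first exact: ltW.
      by rewrite !mulr_ge0// ltW.
    by rewrite ler_wpM2l// ltW.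
  have h2 : N0 * (c' * (d1 * T)) = (C0 + 1) * T / 2.
    by rewrite /N0; field; rewrite !gt_eqF.
  rewrite h2 in h1; lra.
have s2 : q0 ^+ 2 <= 3 * c' ^+ 2 * (1 + e ^+ 2) * T + 3 * c ^+ 2 * u0 ^+ 2.
  rewrite hq /T.
  have := sqr_ge0 (c' * g0 + c' * e * v0); have := sqr_ge0 (c' * g0 - c * u0).
  have := sqr_ge0 (c' * e * v0 + c * u0).
  have := sqr_ge0 (c' * e * g0); have := sqr_ge0 (c' * v0); lra.
set z := c' * (g0 - e * v0) in hq.
have s3 : - 2 * K * (z * u0) <= K * (c / 2) * u0 ^+ 2 + 4 * K * c^-1 * c' ^+ 2 * (1 + e ^+ 2) * T.
  have := @young (c / 2) u0 (- z); rewrite divr_gt0// => /(_ isT) h.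
  have hz : z ^+ 2 <= 2 * c' ^+ 2 * (1 + e ^+ 2) * T.
    rewrite /z /T.
    have := sqr_ge0 (c' * g0 + c' * e * v0).
    have := sqr_ge0 (c' * e * g0); have := sqr_ge0 (c' * v0); lra.
  have -> : - 2 * K * (z * u0) = K * (2 * u0 * - z) by ring.
  have -> : K * (c / 2) * u0 ^+ 2 + 4 * K * c^-1 * c' ^+ 2 * (1 + e ^+ 2) * T =
     K * (c / 2 * u0 ^+ 2 + (c / 2)^-1 * (2 * c' ^+ 2 * (1 + e ^+ 2) * T)).
    by field; rewrite gt_eqF.
  rewrite ler_wpM2l ?(ltW K0)//; apply: (le_trans h); rewrite sqrrN lerD2l ler_wpM2l//.
  by rewrite invr_ge0 divr_ge0// ltW.
have s4 : 2 * K * (PL * gL * g0) <= PL * kl / 2 * gL ^+ 2 + 2 * K ^+ 2 * PL / kl * g0 ^+ 2.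
  have := @young (kl / 2) gL (K * g0); rewrite divr_gt0// => /(_ isT) h.
  have := ler_wpM2l (ltW PL0) h.
  have -> : PL * (2 * gL * (K * g0)) = 2 * K * (PL * gL * g0) by ring.
  move=> /le_trans; apply; rewrite le_eqVlt; apply/orP; left; apply/eqP.
  by field; rewrite gt_eqF.
have s5 : 2 * K * (S * g0) <= kl / 2 * Y + 2 * K ^+ 2 * L / kl * g0 ^+ 2.
  have := @young (kl / (2 * L)) S (K * g0); rewrite divr_gt0 ?mulr_gt0// => /(_ isT) h.
  have -> : 2 * K * (S * g0) = 2 * S * (K * g0) by ring.
  apply: (le_trans h).
  have -> : kl / 2 * Y + 2 * K ^+ 2 * L / kl * g0 ^+ 2 = kl / (2 * L) * (L * Y) + (kl / (2 * L))^-1 * (K * g0) ^+ 2.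
    by field; rewrite !gt_eqF.
  by rewrite lerD2r ler_wpM2l// divr_ge0 ?mulr_ge0// ltW.
have g0T : g0 ^+ 2 <= T by rewrite lerDl sqr_ge0.
have s6 : Pz * g0 ^+ 2 <= Pz * T by rewrite ler_wpM2l.
have kli : 0 <= kl^-1 by rewrite invr_ge0 ltW.
have s7 : 2 * K ^+ 2 * PL / kl * g0 ^+ 2 <= 2 * K ^+ 2 * PL / kl * T.
  by rewrite ler_wpM2l// !mulr_ge0 ?sqr_ge0// ltW.
have s8 : 2 * K ^+ 2 * L / kl * g0 ^+ 2 <= 2 * K ^+ 2 * L / kl * T.
  by rewrite ler_wpM2l// !mulr_ge0 ?sqr_ge0// ltW.
have s9 : 3 * c ^+ 2 * u0 ^+ 2 - 2 * K * c * u0 ^+ 2 + K * (c / 2) * u0 ^+ 2 <= - u0 ^+ 2.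
  have Kc : K * c = 3 * c ^+ 2 + 1 by rewrite /K; field; rewrite gt_eqF.
  have -> : 3 * c ^+ 2 * u0 ^+ 2 - 2 * K * c * u0 ^+ 2 + K * (c / 2) * u0 ^+ 2 =
    (3 * c ^+ 2 - 3 / 2 * (K * c)) * u0 ^+ 2 by field.
  rewrite Kc; have := mulr_ge0 (sqr_ge0 c) (sqr_ge0 u0); have := sqr_ge0 u0; lra.
have dm : dl <= m by rewrite !ge_min lexx.
have dk : dl <= kl / 2 by rewrite !ge_min lexx !orbT.
have dp : dl <= PL * kl / 2 by rewrite !ge_min lexx !orbT.
have d1' : dl <= 1 by rewrite !ge_min lexx !orbT.
have t1 := ler_wpM2r X0 dm; have t2 := ler_wpM2r Y0 dk.
have t3 := ler_wpM2r (sqr_ge0 gL) dp; have t4 := ler_wpM2r (sqr_ge0 u0) d1'.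
have t5 := ler_wpM2r (sqr_ge0 v0) d1'.
have v0T : v0 ^+ 2 <= T by rewrite lerDr sqr_ge0.
have eq1 : 2 * K * (- q0 * u0 + (PL * gL + S) * g0) = - 2 * K * (z * u0) - 2 * K * c * u0 ^+ 2
   + 2 * K * (PL * gL * g0) + 2 * K * (S * g0) by rewrite hq; ring.
rewrite eq1.
have CT : C0 * T = Pz * T + 3 * c' ^+ 2 * (1 + e ^+ 2) * T + 4 * K * c^-1 * c' ^+ 2 * (1 + e ^+ 2) * T
   + 2 * K ^+ 2 * PL / kl * T + 2 * K ^+ 2 * L / kl * T by rewrite /C0; ring.
clearbody C0 N0 dl K T B z; lra.
Qed.

(** The discriminants agree: (b - a + 1)^2 - 4 b = (a + b - 1)^2 - 4 a b. The constant [d1] is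
    determinant over trace of the form, hence below its smaller eigenvalue. *)
Lemma boundary_form_pos (a b : R) : 0 < b -> (a + b - 1) ^+ 2 < 4 * a * b ->
  exists2 d1, 0 < d1 & forall g0 v0 : R,
    d1 * (g0 ^+ 2 + v0 ^+ 2) <= g0 ^+ 2 - ((b - a) + 1) * (v0 * g0) + b * v0 ^+ 2.
Proof.
move=> b0 hab; set s := (b - a) + 1.
have hs : s ^+ 2 < 4 * b by rewrite /s; move: hab; rewrite !expr2; lra.
pose d1 := (4 * b - s ^+ 2) / (4 * (1 + b)).
have b10 : 0 < 1 + b by rewrite addr_gt0.
have d10 : 0 < d1 by rewrite divr_gt0 ?subr_gt0// mulr_gt0.
have e1 : 4 * (1 + b) * d1 = 4 * b - s ^+ 2 by rewrite /d1; field; rewrite gt_eqF.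
exists d1 => // g0 v0.
have d1lt : 0 < 1 - d1.
  rewrite -(pmulr_rgt0 _ (mulr_gt0 (ltr0n R 4) b10)) mulrBr e1; have := sqr_ge0 s; lra.
rewrite -subr_ge0 -(pmulr_rge0 _ d1lt).
have -> : (1 - d1) * (g0 ^+ 2 - s * (v0 * g0) + b * v0 ^+ 2 - d1 * (g0 ^+ 2 + v0 ^+ 2)) =
  ((1 - d1) * g0 - s / 2 * v0) ^+ 2 + ((1 - d1) * (b - d1) - s ^+ 2 / 4) * v0 ^+ 2 by field.
rewrite addr_ge0 ?sqr_ge0// mulr_ge0 ?sqr_ge0//.
have -> : (1 - d1) * (b - d1) - s ^+ 2 / 4 = (4 * b - s ^+ 2 - 4 * (1 + b) * d1) / 4 + d1 ^+ 2 by field.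
by rewrite e1 subrr mul0r add0r sqr_ge0.
Qed.

End Dissipation.

(** * Multiplier identities for the wave equation of eta *)

Section Multiplier.
Variables (R : realType) (L : R) (P P1 P2 : R -> R) (P0 PM a b th3 th4 : R).
Implicit Types (f g h u F G U : R -> R) (x y t : R).
Hypotheses (L_gt0 : 0 < L) (HP : isH1 L P P1) (HP1 : isH1 L P1 P2) (P0_gt0 : 0 < P0)
  (P_ge : forall x, 0 <= x <= L -> P0 <= P x) (P_le : forall x, 0 <= x <= L -> P x <= PM)
  (P1_le : forall x, 0 <= x <= L -> `|P1 x| <= PM)
  (b_gt0 : 0 < b) (hab : (a + b - 1) ^+ 2 < 4 * a * b) (th3_lt0 : th3 < 0) (th4_gt0 : 0 < th4).

(* This rate gives [(P * weight)' <= - weight]. *)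
Definition rate := (PM + 1) / P0.
Definition weight x := expR (- (rate * x)).
Definition eta_coef := P 0 * - th3 / th4.
Definition vel_coef := P 0 * b / th4.

Let r0L : 0 <= (0 : R) <= L. Proof. by rewrite lexx ltW. Qed.
Let rLL : 0 <= L <= L. Proof. by rewrite lexx ltW. Qed.

Lemma PM_gt0 : 0 < PM.
Proof. exact: lt_le_trans P0_gt0 (le_trans (P_ge r0L) (P_le r0L)). Qed.

Lemma rate_gt0 : 0 < rate.
Proof. by rewrite divr_gt0// addr_gt0// PM_gt0. Qed.

Lemma P_gt0 x : 0 <= x <= L -> 0 < P x.
Proof. by move=> /P_ge; exact: lt_le_trans. Qed.

Lemma eta_coef_gt0 : 0 < eta_coef. Proof. by rewrite divr_gt0// mulr_gt0 ?P_gt0// oppr_gt0. Qed.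
Lemma vel_coef_gt0 : 0 < vel_coef. Proof. by rewrite divr_gt0// mulr_gt0 ?P_gt0. Qed.

Lemma isH1_weight : isH1 L weight (fun x => - rate * weight x).
Proof.
have d x : is_derive x 1 weight (- rate * weight x).
  rewrite /weight; have -> : (fun x => expR (- (rate * x))) = expR \o (fun x => - rate * x).
    by apply/funext => y /=; rewrite mulNr.
  have h1 : is_derive x 1 (fun x => - rate * x) (- rate *: 1) by exact: is_deriveZ.
  have := is_derive1_comp (is_derive_expR (- rate * x)) h1.
  suff -> : - rate * expR (- (rate * x)) = expR (- rate * x) * (- rate *: 1) by [].
  by rewrite /GRing.scale /= mulr1 mulrC mulNr.
apply: isH1_C1 => // x; apply: cvgM; first exact: cvg_cst.
by apply: differentiable_continuous; apply/derivable1_diffP; case: (d x).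
Qed.

Lemma weight_bound x : 0 <= x <= L -> weight L <= weight x <= 1.
Proof.
move=> /andP[x0 xL]; rewrite /weight ler_expR lerN2 ler_pM2l ?rate_gt0// xL/=.
by rewrite -expR0 ler_expR oppr_le0 mulr_ge0// ltW// rate_gt0.
Qed.

Lemma weight_gt0 x : 0 < weight x. Proof. exact: expR_gt0. Qed.

(** Here [u], [g], [Q] are eta_x, eta_t, eta_tt, while [U], [G] are the space derivatives of [u],
    [g], and [u0], [v0], [F0] are eta(0), v(0), v_t(0). The left side is the derivative of the
    Lyapunov form along the flow, in which eta_tt(L) has been replaced by - u(L). *)
Lemma multiplier_dissipation : exists K N0 dl : R, [/\ 0 < K, 0 < N0, 0 < dl &
  forall (N : R) u U g G (Q : R -> R) (u0 v0 F0 : R), N0 <= N -> isH1 L u U -> isH1 L g G ->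
  g 0 = F0 + b * v0 -> F0 = (th3 / b - a) * v0 + th3 * ((u0 - v0) / b) + th4 / b * u 0 ->
  (forall x, 0 <= x <= L -> Q x = P x * U x + u x * P1 x) ->
  N * (2 * ip L (fun x => P x * u x) G + 2 * ip L g Q - 2 * (P L * g L * u L) + 2 * eta_coef * (u0 * g 0) + 2 * vel_coef * (v0 * F0))
  - 2 * (ip L (fun x => P x * weight x * g x) G + ip L (fun x => P x * weight x * u x) Q)
  + 2 * K * ((- P L * u L + int0 L Q) * u0 + (P L * g L + int0 L g) * g 0)
  <= - dl * (ip L u u + ip L g g + g L ^+ 2 + u0 ^+ 2 + v0 ^+ 2)].
Proof.
have [d1 d10 hd1] := boundary_form_pos b_gt0 hab.
have m0 : 0 < rate * weight L * P0 ^+ 2 by apply: mulr_gt0; [exact: mulr_gt0 rate_gt0 (weight_gt0 L)|exact: exprn_gt0].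
have [K [N0 [dl [K0 N00 dl0 H]]]] := @scalar_dissipation R L (P L) (P 0) (weight L)
  (rate * weight L * P0 ^+ 2) eta_coef vel_coef (b - a) b d1 L_gt0 (P_gt0 rLL) (ltW (P_gt0 r0L)) (weight_gt0 L) m0
  eta_coef_gt0 vel_coef_gt0 d10.
exists K, N0, dl; split => // N u U g G Q u0 v0 F0 hN Hu Hg hg0 hF QE.
have Hq : isH1 L (fun x => P x * u x) Q by apply: (isH1_ext L_gt0 (isH1_mul L_gt0 HP Hu)) => // x xL; rewrite QE.
set q := fun x => P x * u x in Hq *.
have hq := isH1_L2f L_gt0 Hq; have hQ := isH1_L2 Hq.
have hg := isH1_L2f L_gt0 Hg; have hG := isH1_L2 Hg.
have hu := isH1_L2f L_gt0 Hu.
have ck := isH1_cont L_gt0 isH1_weight; have cP := isH1_cont L_gt0 HP; have cP1 := isH1_cont L_gt0 HP1.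
(* [b1] reduces the energy part to boundary terms; [b2] and [b3] are the weighted identities whose
   interior terms give the squared norms of [u] and [g]. *)
have b1 := ibp L_gt0 Hq Hg.
have b2 := ibp L_gt0 (isH1_mul L_gt0 isH1_weight Hq) Hq.
have b3 := ibp L_gt0 (isH1_mul L_gt0 (isH1_mul L_gt0 HP isH1_weight) Hg) Hg.
have hkQ : L2r L (fun x => weight x * Q x) := L2_contM ck hQ.
have hkq : L2r L (fun x => weight x * q x) := L2_contM ck hq.
have e2 : ip L q (fun x => weight x * Q x + q x * (- rate * weight x)) =
    ip L (fun x => P x * weight x * u x) Q - rate * ip L (fun x => weight x * q x) q.
  have -> : ip L (fun x => P x * weight x * u x) Q = ip L (fun x => weight x * Q x) q.
    by apply: ip_eq => x _; rewrite /q; ring.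
  have := ip_linl (- rate) hkQ hkq hq; rewrite mulNr => <-; apply: ip_eq => x _; ring.
have e2' : ip L (fun x => weight x * q x) Q = ip L (fun x => P x * weight x * u x) Q.
  by apply: ip_eq => x _; rewrite /q; ring.
have hkg : L2r L (fun x => weight x * g x) := L2_contM ck hg.
have hPkg : L2r L (fun x => P x * (weight x * g x)) := L2_contM cP hkg.
have hPkG : L2r L (fun x => P x * (weight x * G x)) := L2_contM cP (L2_contM ck hG).
have hP1kg : L2r L (fun x => P1 x * (weight x * g x)) := L2_contM cP1 hkg.
have e3 : ip L g (fun x => P x * weight x * G x + g x * (P x * (- rate * weight x) + weight x * P1 x)) =
    ip L (fun x => P x * weight x * g x) G + ip L (fun x => P1 x * (weight x * g x) + - rate * (P x * (weight x * g x))) g.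
  have -> : ip L (fun x => P x * weight x * g x) G = ip L (fun x => P x * (weight x * G x)) g.
    by apply: ip_eq => x _; ring.
  have h := L2_lin (- rate) hP1kg hPkg.
  have := ip_linl 1 hPkG h hg; rewrite mul1r => <-; apply: ip_eq => x _; ring.
rewrite e2 e2' in b2; rewrite e3 in b3.
have k0 : weight 0 = 1 by rewrite /weight mulr0 oppr0 expR0.
have l1 : ip L (fun x => P1 x * (weight x * g x) + - rate * (P x * (weight x * g x))) g <= - weight L * ip L g g + 0 * ip L g g + 0 * ip L g g.
  apply: ip_le3 => //; first exact: (L2_lin (- rate) hP1kg hPkg).
  move=> x xL; rewrite !mul0r !addr0.
  have rP : PM + 1 <= rate * P x.
    have -> : PM + 1 = rate * P0 by rewrite /rate divfK// gt_eqF.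
    by rewrite ler_pM2l ?rate_gt0// P_ge.
  have hP1x : P1 x <= PM by rewrite (le_trans (ler_norm _))// P1_le.
  have -> : (P1 x * (weight x * g x) + - rate * (P x * (weight x * g x))) * g x = (P1 x - rate * P x) * (weight x * (g x * g x)) by ring.
  have /andP[kL k1] := weight_bound xL.
  have gg : 0 <= g x * g x by rewrite -expr2 sqr_ge0.
  apply: (@le_trans _ _ (-1 * (weight x * (g x * g x)))).
    rewrite ler_wpM2r//; first by rewrite mulr_ge0// ltW// weight_gt0.
    lra.
  by rewrite mulN1r mulNr lerN2 ler_wpM2r.
have l2 : weight L * P0 ^+ 2 * ip L u u <= ip L (fun x => weight x * q x) q.
  have : ip L u u <= (weight L * P0 ^+ 2)^-1 * ip L (fun x => weight x * q x) q + 0 * ip L g g + 0 * ip L g g.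
    apply: ip_le3 => // x xL; rewrite !mul0r !addr0 [leRHS]mulrC ler_pdivlMr ?mulr_gt0 ?exprn_gt0 ?weight_gt0//.
    have /andP[kL k1] := weight_bound xL.
    have Px : P0 ^+ 2 <= P x ^+ 2 by rewrite lerXn2r ?nnegrE ?P_ge// ltW// P_gt0.
    have -> : weight x * q x * q x = weight x * P x ^+ 2 * (u x * u x) by rewrite /q; ring.
    rewrite mulrC ler_wpM2r//; first by rewrite -expr2 sqr_ge0.
    by rewrite ler_pM// ?sqr_ge0// ltW// weight_gt0.
  by rewrite !mul0r !addr0 mulrC ler_pdivlMr ?mulr_gt0 ?exprn_gt0 ?weight_gt0// mulrC.
have l2' := ler_wpM2l (ltW rate_gt0) l2.
have IQ := int0_deriv L_gt0 Hq.
have bn0 : b != 0 by rewrite gt_eqF.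
have tn0 : th4 != 0 by rewrite gt_eqF.
have hq0 : q 0 = vel_coef * (g 0 - (b - a) * v0) + eta_coef * u0.
  rewrite hg0 hF /q /eta_coef /vel_coef; field; by rewrite bn0 tn0.
have := H N (ip L u u) (ip L g g) (int0 L g) (g L) (g 0) u0 v0 (q 0) hN (ip_ge0 _ _) (ip_ge0 _ _) (int0_sqr_le L_gt0 hg) hq0 (hd1 _ _).
apply: le_trans.
have hN0 : N * (2 * ip L q G + 2 * ip L g Q - 2 * (P L * g L * u L) + 2 * eta_coef * (u0 * g 0) + 2 * vel_coef * (v0 * F0))
   = - 2 * N * vel_coef * (g 0 ^+ 2 - (b - a + 1) * (v0 * g 0) + b * v0 ^+ 2).
  have -> : 2 * ip L q G + 2 * ip L g Q = 2 * (q L * g L - q 0 * g 0) by rewrite -b1; ring.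
  have -> : F0 = g 0 - b * v0 by rewrite hg0; ring.
  rewrite hq0 /q; ring.
rewrite hN0 IQ.
have hA : ip L (fun x => P x * weight x * u x) Q * 2 = weight L * q L ^+ 2 - q 0 ^+ 2 + rate * ip L (fun x => weight x * q x) q.
  have : weight L * q L * q L - weight 0 * q 0 * q 0 = ip L (fun x => P x * weight x * u x) Q * 2 - rate * ip L (fun x => weight x * q x) q by rewrite -b2; ring.
  rewrite k0 => h; apply/eqP; rewrite -subr_eq -h; apply/eqP; ring.
have hB : 2 * ip L (fun x => P x * weight x * g x) G = P L * weight L * g L ^+ 2 - P 0 * g 0 ^+ 2
   - ip L (fun x => P1 x * (weight x * g x) + - rate * (P x * (weight x * g x))) g.
  have : P L * weight L * g L * g L - P 0 * weight 0 * g 0 * g 0 = 2 * ip L (fun x => P x * weight x * g x) G + ip L (fun x => P1 x * (weight x * g x) + - rate * (P x * (weight x * g x))) g by rewrite -b3; ring.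
  rewrite k0 => h; apply/eqP; rewrite eq_sym subr_eq -h; apply/eqP; ring.
have qL0 : 0 <= weight L * q L ^+ 2 by rewrite mulr_ge0 ?sqr_ge0// ltW// weight_gt0.
have -> : 2 * (ip L (fun x => P x * weight x * g x) G + ip L (fun x => P x * weight x * u x) Q) =
  2 * ip L (fun x => P x * weight x * g x) G + ip L (fun x => P x * weight x * u x) Q * 2 by ring.
rewrite hA hB.
(* The flux at [L] cancels, which is the reason for combining [P L * g L] with the integral of
   [g]. *)
have -> : (- P L * u L + (q L - q 0)) * u0 = - q 0 * u0 by rewrite /q; ring.
lra.
Qed.

End Multiplier.

(** * The Lyapunov form *)

(* Real part or imaginary part of a state with its derivatives: [w, w', w'', v, v']. *)
Record jet (R : Type) := Jet {pw : R -> R; pw1 : R -> R; pw2 : R -> R; pv : R -> R; pv1 : R -> R}.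

Lemma le_sum5 (R : realType) (x1 x2 x3 x4 x5 : R) (S := x1 + x2 + x3 + x4 + x5) :
  0 <= x1 -> 0 <= x2 -> 0 <= x3 -> 0 <= x4 -> 0 <= x5 ->
  [/\ x1 <= S, x2 <= S, x3 <= S, x4 <= S & x5 <= S] /\ x1 + x2 <= S /\ x1 + x3 <= S.
Proof. by rewrite /S => *; do !split; lra. Qed.

Section LyapunovForm.
Variables (R : realType) (L : R) (P P1 P2 : R -> R) (P0 PM b th3 th4 : R).
Implicit Types (f g h F G : R -> R) (x y t s c C : R) (p q : jet R).
Hypotheses (L_gt0 : 0 < L) (HP : isH1 L P P1) (HP1 : isH1 L P1 P2) (P0_gt0 : 0 < P0)
  (P_ge : forall x, 0 <= x <= L -> P0 <= P x) (P_le : forall x, 0 <= x <= L -> P x <= PM)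
  (P1_le : forall x, 0 <= x <= L -> `|P1 x| <= PM)
  (b_gt0 : 0 < b) (th3_lt0 : th3 < 0) (th4_gt0 : 0 < th4).

Definition admissible p := [/\ isH1 L (pw p) (pw1 p), isH1 L (pw1 p) (pw2 p) & isH1 L (pv p) (pv1 p)].

Definition jet_lin s p q := Jet (fun x => pw p x + s * pw q x) (fun x => pw1 p x + s * pw1 q x)
  (fun x => pw2 p x + s * pw2 q x) (fun x => pv p x + s * pv q x) (fun x => pv1 p x + s * pv1 q x).

Lemma admissible_lin s p q : admissible p -> admissible q -> admissible (jet_lin s p q).
Proof. by move=> [p1 p2 p3] [q1 q2 q3]; split; exact: isH1_lin. Qed.

(* For [eta = v + b w]: its derivative in [x], its derivative along the flow, the value of the latter at
   [L] (where [(P w')'(L) = - w'(L)]), the value of [eta] at 0 and that of [v] at 0. *)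
Definition eta_x p x := pv1 p x + b * pw1 p x.
Definition eta_t p x := P x * pw2 p x + P1 x * pw1 p x + b * pv p x.
Definition eta_tL p := - pw1 p L + b * pv p L.
Definition eta_0 p := pv p 0 + b * pw p 0.
Definition vel_0 p := pv p 0.

Lemma eta_x_lin s p q : eta_x (jet_lin s p q) = fun x => eta_x p x + s * eta_x q x.
Proof. by apply/funext => x; rewrite /eta_x /=; ring. Qed.
Lemma eta_t_lin s p q : eta_t (jet_lin s p q) = fun x => eta_t p x + s * eta_t q x.
Proof. by apply/funext => x; rewrite /eta_t /=; ring. Qed.

Lemma eta_x_L2 p : admissible p -> L2r L (eta_x p).
Proof. by move=> [h1 h2 h3]; apply: L2_lin; [exact: isH1_L2 h3|exact: isH1_L2 h1]. Qed.

Lemma eta_t_L2 p : admissible p -> L2r L (eta_t p).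
Proof.
move=> [h1 h2 h3]; apply: L2_lin; last exact: isH1_L2f h3.
have := L2_lin 1 (L2_contM (isH1_cont L_gt0 HP) (isH1_L2 h2)) (L2_contM (isH1_cont L_gt0 HP1) (isH1_L2 h1)).
by move=> /L2_eq; apply => x _; rewrite mul1r.
Qed.

(** An unweighted sum of squares, the yardstick to which both [lyap] and [norm2] are compared. *)
Definition energy p := ip L (eta_x p) (eta_x p) + ip L (eta_t p) (eta_t p) + eta_tL p ^+ 2 + eta_0 p ^+ 2 + vel_0 p ^+ 2.
Definition norm2 p := ip L (pw p) (pw p) + ip L (pw1 p) (pw1 p) + ip L (pw2 p) (pw2 p)
  + ip L (pv p) (pv p) + ip L (pv1 p) (pv1 p) + pv p L ^+ 2 + pv p 0 ^+ 2.
Definition norm2_polar p q := 2 * (ip L (pw p) (pw q) + ip L (pw1 p) (pw1 q) + ip L (pw2 p) (pw2 q)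
  + ip L (pv p) (pv q) + ip L (pv1 p) (pv1 q) + pv p L * pv q L + pv p 0 * pv q 0).

Notation k := (weight P0 PM).
Notation c1 := (eta_coef P th3 th4).
Notation c2 := (vel_coef P b th4).

Definition lyap (N K : R) p :=
  N * (ip L (fun x => P x * eta_x p x) (eta_x p) + ip L (eta_t p) (eta_t p) + P L * eta_tL p ^+ 2
    + c1 * eta_0 p ^+ 2 + c2 * vel_0 p ^+ 2)
  - 2 * ip L (fun x => P x * k x * eta_t p x) (eta_x p)
  + 2 * K * ((P L * eta_tL p + int0 L (eta_t p)) * eta_0 p).
(** The first-order coefficient of [lyap] along a line; with [q] the image of [p] under the
    generator it is the derivative of [lyap] along the flow. *)
Definition lyap_polar (N K : R) p q :=
  N * (2 * ip L (fun x => P x * eta_x p x) (eta_x q) + 2 * ip L (eta_t p) (eta_t q) + 2 * (P L * eta_tL p * eta_tL q)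
    + 2 * c1 * (eta_0 p * eta_0 q) + 2 * c2 * (vel_0 p * vel_0 q))
  - 2 * (ip L (fun x => P x * k x * eta_t p x) (eta_x q) + ip L (fun x => P x * k x * eta_x p x) (eta_t q))
  + 2 * K * ((P L * eta_tL q + int0 L (eta_t q)) * eta_0 p + (P L * eta_tL p + int0 L (eta_t p)) * eta_0 q).

Lemma norm2_ge0 p : 0 <= norm2 p.
Proof. by rewrite /norm2 !addr_ge0 ?ip_ge0 ?sqr_ge0. Qed.

Lemma energy_ge0 p : 0 <= energy p.
Proof. by rewrite /energy !addr_ge0 ?ip_ge0 ?sqr_ge0. Qed.

Lemma ip_quad s f g : L2r L f -> L2r L g ->
  ip L (fun x => f x + s * g x) (fun x => f x + s * g x) = ip L f f + s * (2 * ip L f g) + s ^+ 2 * ip L g g.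
Proof.
move=> hf hg; have h := L2_lin s hf hg.
rewrite (ip_linl s hf hg h) !ip_linr// (ip_sym _ g f); ring.
Qed.

Lemma norm2_lin s p q : admissible p -> admissible q -> norm2 (jet_lin s p q) = norm2 p + s * norm2_polar p q + s ^+ 2 * norm2 q.
Proof.
move=> [p1 p2 p3] [q1 q2 q3]; rewrite /norm2 /norm2_polar /=.
rewrite !ip_quad ?(isH1_L2 p1) ?(isH1_L2 q1) ?(isH1_L2 p2) ?(isH1_L2 q2) ?(isH1_L2 p3) ?(isH1_L2 q3)
  ?(isH1_L2f L_gt0 p1) ?(isH1_L2f L_gt0 q1) ?(isH1_L2f L_gt0 p3) ?(isH1_L2f L_gt0 q3)//; try exact: isH1_L2f; try exact: isH1_L2.
all: try (by apply: isH1_L2; eassumption); try (by apply: isH1_L2f; eassumption).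
ring.
Qed.

Lemma lyap_lin N K s p q : admissible p -> admissible q ->
  lyap N K (jet_lin s p q) = lyap N K p + s * lyap_polar N K p q + s ^+ 2 * lyap N K q.
Proof.
move=> gp gq; have up := eta_x_L2 gp; have uq := eta_x_L2 gq; have hp := eta_t_L2 gp; have hq := eta_t_L2 gq.
have cP := isH1_cont L_gt0 HP.
have ck : {within `[0, L], continuous k} by apply: (isH1_cont L_gt0); exact: isH1_weight.
have Pup : L2r L (fun x => P x * eta_x p x) := L2_contM cP up.
have Puq : L2r L (fun x => P x * eta_x q x) := L2_contM cP uq.
have kM f : L2r L f -> L2r L (fun x => P x * k x * f x).
  by move=> hf; apply: (L2_eq (L2_contM cP (L2_contM ck hf))) => x _; rewrite mulrA.
have e1 : ip L (fun x => P x * eta_x (jet_lin s p q) x) (eta_x (jet_lin s p q)) =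
  ip L (fun x => P x * eta_x p x) (eta_x p) + s * (2 * ip L (fun x => P x * eta_x p x) (eta_x q))
  + s ^+ 2 * ip L (fun x => P x * eta_x q x) (eta_x q).
  rewrite eta_x_lin.
  have -> : ip L (fun x => P x * (eta_x p x + s * eta_x q x)) (fun x => eta_x p x + s * eta_x q x) =
     ip L (fun x => P x * eta_x p x + s * (P x * eta_x q x)) (fun x => eta_x p x + s * eta_x q x).
    by apply: ip_eq => x _; ring.
  rewrite (ip_linl s Pup Puq (L2_lin s up uq)) (ip_linr s up uq Pup) (ip_linr s up uq Puq).
  have -> : ip L (fun x => P x * eta_x q x) (eta_x p) = ip L (fun x => P x * eta_x p x) (eta_x q).
    by apply: ip_eq => x _; ring.
  ring.
have e2 : ip L (fun x => P x * k x * eta_t (jet_lin s p q) x) (eta_x (jet_lin s p q)) =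
  ip L (fun x => P x * k x * eta_t p x) (eta_x p) + s * (ip L (fun x => P x * k x * eta_t p x) (eta_x q)
    + ip L (fun x => P x * k x * eta_x p x) (eta_t q))
  + s ^+ 2 * ip L (fun x => P x * k x * eta_t q x) (eta_x q).
  rewrite eta_x_lin eta_t_lin.
  have -> : ip L (fun x => P x * k x * (eta_t p x + s * eta_t q x)) (fun x => eta_x p x + s * eta_x q x) =
     ip L (fun x => P x * k x * eta_t p x + s * (P x * k x * eta_t q x)) (fun x => eta_x p x + s * eta_x q x).
    by apply: ip_eq => x _; ring.
  rewrite (ip_linl s (kM _ hp) (kM _ hq) (L2_lin s up uq)) (ip_linr s up uq (kM _ hp)) (ip_linr s up uq (kM _ hq)).
  have -> : ip L (fun x => P x * k x * eta_t q x) (eta_x p) = ip L (fun x => P x * k x * eta_x p x) (eta_t q).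
    by apply: ip_eq => x _; ring.
  ring.
rewrite /lyap /lyap_polar e1 e2 eta_t_lin (ip_quad s hp hq) (int0_lin s (integrable0L_L2 hp) (integrable0L_L2 hq)).
rewrite /eta_tL /eta_0 /vel_0 /=; ring.
Qed.

Let r0L : 0 <= (0 : R) <= L. Proof. by rewrite lexx ltW. Qed.
Let rLL : 0 <= L <= L. Proof. by rewrite lexx ltW. Qed.

(** Only the first bracket carries [N], with coefficients at least [m0]; the other two terms cost at
    most [C0 * energy p]. So [N >= (C0 + 1) / m0] leaves one full energy. *)
Lemma lyap_bounds K : 0 < K -> exists2 N1, 0 < N1 & forall N, N1 <= N ->
  exists2 C, 0 < C & forall p, admissible p -> energy p <= lyap N K p <= C * energy p.
Proof.
move=> K0.
have c10 : 0 < c1 := eta_coef_gt0 L_gt0 P0_gt0 P_ge th3_lt0 th4_gt0.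
have c20 : 0 < c2 := vel_coef_gt0 L_gt0 P0_gt0 P_ge b_gt0 th4_gt0.
have PM0 : 0 < PM := PM_gt0 L_gt0 P0_gt0 P_ge P_le.
pose m0 := Num.min (Num.min P0 1) (Num.min c1 c2).
have m00 : 0 < m0 by rewrite !lt_min P0_gt0 ltr01 c10 c20.
pose C0 := PM + K * PM + K * L + K * (PM + 1).
have C00 : 0 < C0 by rewrite /C0 !addr_gt0 ?mulr_gt0 ?addr_gt0.
exists ((C0 + 1) / m0); first by rewrite divr_gt0// addr_gt0.
move=> N hN.
have N0 : 0 < N by apply: lt_le_trans hN; rewrite divr_gt0// addr_gt0.
exists (N * (PM + 1 + c1 + c2) + C0).
  by rewrite addr_gt0// mulr_gt0// !addr_gt0.
move=> p gp; have hu := eta_x_L2 gp; have hg := eta_t_L2 gp.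
have cP := isH1_cont L_gt0 HP.
have ck : {within `[0, L], continuous k} by apply: (isH1_cont L_gt0); exact: isH1_weight.
have Pu : L2r L (fun x => P x * eta_x p x) := L2_contM cP hu.
have kM f : L2r L f -> L2r L (fun x => P x * k x * f x).
  by move=> hf; apply: (L2_eq (L2_contM cP (L2_contM ck hf))) => x _; rewrite mulrA.
set X := ip L (eta_x p) (eta_x p); set Y := ip L (eta_t p) (eta_t p).
have X0 : 0 <= X := ip_ge0 _ _; have Y0 : 0 <= Y := ip_ge0 _ _.
set S := int0 L (eta_t p); have hS : S ^+ 2 <= L * Y := int0_sqr_le L_gt0 hg.
have z0 := sqr_ge0 (eta_tL p); have z1 := sqr_ge0 (eta_0 p); have z2 := sqr_ge0 (vel_0 p).
have l1 : ip L (fun x => P x * eta_x p x) (eta_x p) <= PM * X + 0 * X + 0 * X.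
  apply: ip_le3 => // x xL; rewrite !mul0r !addr0 -mulrA ler_wpM2r ?P_le//.
  by rewrite -expr2 sqr_ge0.
have l2 : X <= P0^-1 * ip L (fun x => P x * eta_x p x) (eta_x p) + 0 * X + 0 * X.
  apply: ip_le3 => // x xL; rewrite !mul0r !addr0 [leRHS]mulrC ler_pdivlMr// -mulrA mulrC ler_wpM2r ?P_ge//.
  by rewrite -expr2 sqr_ge0.
have {}l2 : P0 * X <= ip L (fun x => P x * eta_x p x) (eta_x p).
  by move: l2; rewrite !mul0r !addr0 [X in _ <= X]mulrC ler_pdivlMr// mulrC.
have kb x : 0 <= x <= L -> forall r e : R, 2 * (P x * k x * r * e) <= PM * (r * r) + PM * (e * e).
  move=> xL r e.
  have /andP[_ k1] := weight_bound L_gt0 P0_gt0 P_ge P_le xL.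
  have kp : 0 <= P x * k x by rewrite mulr_ge0 ?(ltW (weight_gt0 _ _ _))// ltW// (P_gt0 P0_gt0 P_ge).
  have kP : P x * k x <= PM * 1.
    by apply: ler_pM; rewrite ?P_le ?(ltW (weight_gt0 _ _ _))// ltW// (P_gt0 P0_gt0 P_ge).
  have q0 : 0 <= r * r + e * e by rewrite addr_ge0// -expr2 sqr_ge0.
  have := ler_wpM2r q0 kP.
  have q1 : 2 * (r * e) <= r * r + e * e by have := sqr_ge0 (r - e); rewrite expr2; lra.
  have := ler_wpM2l kp q1; lra.
have l3 : ip L (fun x => P x * k x * eta_t p x) (eta_x p) <= PM / 2 * Y + PM / 2 * X + 0 * X.
  apply: ip_le3 => //; first exact: kM.
  move=> x xL; have := kb x xL (eta_t p x) (eta_x p x); lra.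
have l4 : ip L (fun x => P x * k x * eta_t p x) (fun x => - eta_x p x) <= PM / 2 * Y + PM / 2 * X + 0 * X.
  apply: ip_le3 => //; first exact: kM.
    by apply: (L2_eq (L2_lin (-1) (L2_cst L 0) hu)) => x _; rewrite add0r mulN1r.
  move=> x xL; have := kb x xL (eta_t p x) (- eta_x p x); rewrite mulrNN; lra.
have l5 : ip L (fun x => P x * k x * eta_t p x) (fun x => - eta_x p x) = - ip L (fun x => P x * k x * eta_t p x) (eta_x p).
  have := ip_linr (-1) (L2_cst L 0) hu (kM _ hg).
  have -> : ip L (fun x => P x * k x * eta_t p x) (fun=> 0) = 0.
    by rewrite -[RHS](mul0r L) -(int0_cst L_gt0 0); apply: eq_int0 => x _; rewrite mulr0.
  by rewrite add0r mulN1r => <-; apply: ip_eq => x _; rewrite add0r mulN1r.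
rewrite l5 in l4.
have PL0 : 0 < P L := P_gt0 P0_gt0 P_ge rLL.
have PLM : P L <= PM := P_le rLL.
have PLm : P0 <= P L := P_ge rLL.
set z := (P L * eta_tL p + S) * eta_0 p.
have hz (e : R) : e = 1 \/ e = -1 -> 2 * (e * z) <= PM * eta_tL p ^+ 2 + L * Y + (PM + 1) * eta_0 p ^+ 2.
  move=> he; have e2 : e * e = 1 by case: he => ->; ring.
  have h1 : 2 * (e * (eta_tL p * eta_0 p)) <= eta_tL p ^+ 2 + eta_0 p ^+ 2.
    have := sqr_ge0 (e * eta_tL p - eta_0 p).
    have -> : (e * eta_tL p - eta_0 p) ^+ 2 = e * e * eta_tL p ^+ 2 - 2 * (e * (eta_tL p * eta_0 p)) + eta_0 p ^+ 2 by ring.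
    rewrite e2; lra.
  have h2 : 2 * (e * (S * eta_0 p)) <= S ^+ 2 + eta_0 p ^+ 2.
    have := sqr_ge0 (e * S - eta_0 p).
    have -> : (e * S - eta_0 p) ^+ 2 = e * e * S ^+ 2 - 2 * (e * (S * eta_0 p)) + eta_0 p ^+ 2 by ring.
    rewrite e2; lra.
  have := ler_wpM2l (ltW PL0) h1.
  have := ler_wpM2r (addr_ge0 z0 z1) PLM; rewrite /z; lra.
have hz1 := hz 1 (or_introl erefl); have hz2 := hz (-1) (or_intror erefl).
have {}hz1 := ler_wpM2l (ltW K0) hz1; have {}hz2 := ler_wpM2l (ltW K0) hz2.
have m1 : m0 <= P0 by rewrite !ge_min lexx.
have m2 : m0 <= 1 by rewrite !ge_min lexx !orbT.
have m3 : m0 <= c1 by rewrite !ge_min lexx !orbT.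
have m4 : m0 <= c2 by rewrite !ge_min lexx !orbT.
pose U := ip L (fun x => P x * eta_x p x) (eta_x p) + Y + P L * eta_tL p ^+ 2 + c1 * eta_0 p ^+ 2 + c2 * vel_0 p ^+ 2.
have energyE : energy p = X + Y + eta_tL p ^+ 2 + eta_0 p ^+ 2 + vel_0 p ^+ 2 by [].
have U1 : m0 * energy p <= U.
  have t1 := ler_wpM2r X0 m1; have t2 := ler_wpM2r Y0 m2.
  have t3 := ler_wpM2r z0 (le_trans m1 PLm); have t4 := ler_wpM2r z1 m3; have t5 := ler_wpM2r z2 m4.
  rewrite energyE /U; lra.
have E0 := energy_ge0 p.
have U2 : (C0 + 1) * energy p <= N * U.
  apply: (@le_trans _ _ (N * (m0 * energy p))); last by rewrite ler_pM2l.
  by rewrite mulrA ler_wpM2r// -ler_pdivrMr.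
have y1 := mulr_ge0 (ltW c10) z1; have y2 := mulr_ge0 (ltW c20) z2.
have S5 := le_sum5 X0 Y0 z0 z1 z2; rewrite -energyE in S5.
have CE (c : R) : 0 <= c -> [/\ c * X <= c * energy p, c * Y <= c * energy p, c * eta_tL p ^+ 2 <= c * energy p,
   c * eta_0 p ^+ 2 <= c * energy p & c * vel_0 p ^+ 2 <= c * energy p].
  by move=> cc; case: S5 => -[? ? ? ? ?] _; split; exact: ler_wpM2l.
have [a1 a2 a3 a4 a5] := CE PM (ltW PM0).
have [b1 b2 b3 b4 b5] := CE 1 ler01.
have [d1 d2 d3 d4 d5] := CE c1 (ltW c10).
have [g1 g2 g3 g4 g5] := CE c2 (ltW c20).
have KL0 : 0 <= K * L by rewrite mulr_ge0// ltW.
have K10 : 0 <= K * (PM + 1) by rewrite mulr_ge0 ?addr_ge0// ltW.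
have [i1 i2 i3 i4 i5] := CE (K * L) KL0.
have [j1 j2 j3 j4 j5] := CE (K * (PM + 1)) K10.
have KP0 : 0 <= K * PM by rewrite mulr_ge0// ltW.
have [n1 n2 n3 n4 n5] := CE (K * PM) KP0.
have XY : PM * X + PM * Y <= PM * energy p.
  by rewrite -mulrDr ler_wpM2l ?(ltW PM0)//; case: S5 => _ [].
have U3 : U <= (PM + 1 + c1 + c2) * energy p.
  have t3 := ler_wpM2r z0 PLM.
  have : PM * X + PM * eta_tL p ^+ 2 <= PM * energy p.
    by rewrite -mulrDr ler_wpM2l ?(ltW PM0)//; case: S5 => _ [].
  rewrite /U; lra.
have U4 := ler_wpM2l (ltW N0) U3.
have C0E : C0 * energy p = PM * energy p + K * PM * energy p + K * L * energy p + K * (PM + 1) * energy p by rewrite /C0; ring.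
have -> : lyap N K p = N * U - 2 * ip L (fun x => P x * k x * eta_t p x) (eta_x p) + 2 * K * z by [].
have -> : 2 * K * z = K * (2 * (1 * z)) by ring.
have hzN : K * (2 * (-1 * z)) = - (K * (2 * (1 * z))) by ring.
rewrite hzN in hz2.
clearbody X Y U S z C0; apply/andP; split; lra.
Qed.

End LyapunovForm.

(** * Equivalence of the energy with the norm *)

Section NormEquivalence.
Variables (R : realType) (L : R) (P P1 P2 : R -> R) (P0 PM b : R).
Implicit Types (f g h F G : R -> R) (x y t s c C : R) (p q : jet R).
Hypotheses (L_gt0 : 0 < L) (HP : isH1 L P P1) (HP1 : isH1 L P1 P2) (P0_gt0 : 0 < P0)
  (P_ge : forall x, 0 <= x <= L -> P0 <= P x) (P_le : forall x, 0 <= x <= L -> P x <= PM)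
  (P1_le : forall x, 0 <= x <= L -> `|P1 x| <= PM) (b_gt0 : 0 < b).

(** Hiding the constant lets long chains of estimates be composed without tracking explicit
    bounds. *)
Definition dominated (phi psi : jet R -> R) : Prop :=
  exists2 C, 0 <= C & forall p, admissible L p -> phi p <= C * psi p.

(** Three slots suffice throughout; in the proofs below the zero functional [dz] fills those left
    over. *)
Lemma dominated3 (phi phi1 phi2 phi3 psi : jet R -> R) c1 c2 c3 :
  0 <= c1 -> 0 <= c2 -> 0 <= c3 ->
  dominated phi1 psi -> dominated phi2 psi -> dominated phi3 psi ->
  (forall p, admissible L p -> phi p <= c1 * phi1 p + c2 * phi2 p + c3 * phi3 p) ->
  dominated phi psi.
Proof.
move=> c10 c20 c30 [C1 C10 h1] [C2 C20 h2] [C3 C30 h3] h.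
exists (c1 * C1 + c2 * C2 + c3 * C3); first by rewrite !addr_ge0// mulr_ge0.
move=> p gp; apply: (le_trans (h p gp)); rewrite !mulrDl -!mulrA.
by rewrite !lerD// ler_wpM2l// ?h1 ?h2 ?h3.
Qed.

Let r0L : 0 <= (0 : R) <= L. Proof. by rewrite lexx ltW. Qed.
Let rLL : 0 <= L <= L. Proof. by rewrite lexx ltW. Qed.

Notation energy := (energy L P P1 b).
Notation norm2 := (@norm2 R L).
Notation eta_x := (@eta_x R b).
Notation eta_t := (eta_t P P1 b).
Notation eta_tL := (eta_tL L b).
Notation eta_0 := (@eta_0 R b).

Lemma sqr3 (x y z : R) : (x + y + z) ^+ 2 <= 3 * x ^+ 2 + 3 * y ^+ 2 + 3 * z ^+ 2.
Proof.
by have := sqr_ge0 (x - y); have := sqr_ge0 (x - z); have := sqr_ge0 (y - z); lra.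
Qed.

Lemma norm2_parts p : [/\ ip L (pw p) (pw p) <= 1 * norm2 p, ip L (pw1 p) (pw1 p) <= 1 * norm2 p,
  ip L (pw2 p) (pw2 p) <= 1 * norm2 p, ip L (pv p) (pv p) <= 1 * norm2 p & ip L (pv1 p) (pv1 p) <= 1 * norm2 p]
  /\ pv p L ^+ 2 <= 1 * norm2 p /\ pv p 0 ^+ 2 <= 1 * norm2 p.
Proof.
rewrite mul1r /norm2; have := ip_ge0 L (pw p); have := ip_ge0 L (pw1 p); have := ip_ge0 L (pw2 p).
have := ip_ge0 L (pv p); have := ip_ge0 L (pv1 p); have := sqr_ge0 (pv p L); have := sqr_ge0 (pv p 0).
by move=> *; do !split; lra.
Qed.

Lemma energy_parts p : [/\ ip L (eta_x p) (eta_x p) <= 1 * energy p, ip L (eta_t p) (eta_t p) <= 1 * energy p,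
  eta_tL p ^+ 2 <= 1 * energy p, eta_0 p ^+ 2 <= 1 * energy p & vel_0 p ^+ 2 <= 1 * energy p].
Proof.
rewrite mul1r /energy; have := ip_ge0 L (eta_x p); have := ip_ge0 L (eta_t p).
have := sqr_ge0 (eta_tL p); have := sqr_ge0 (eta_0 p); have := sqr_ge0 (vel_0 p).
by move=> *; split; lra.
Qed.

Lemma P1sqr x : 0 <= x <= L -> forall r : R, (P1 x * r) ^+ 2 <= PM ^+ 2 * (r * r).
Proof.
move=> xL r; rewrite exprMn -[r * r]expr2 ler_wpM2r ?sqr_ge0//.
rewrite -(real_normK (num_real (P1 x))) lerXn2r ?nnegrE ?P1_le//.
by rewrite ltW// (PM_gt0 L_gt0 P0_gt0 P_ge P_le).
Qed.

Lemma Psqr x : 0 <= x <= L -> forall r : R, (P x * r) ^+ 2 <= PM ^+ 2 * (r * r).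
Proof.
move=> xL r; rewrite exprMn -[r * r]expr2 ler_wpM2r ?sqr_ge0//.
rewrite lerXn2r ?nnegrE ?P_le//; first by rewrite ltW// (P_gt0 P0_gt0 P_ge).
by rewrite ltW// (PM_gt0 L_gt0 P0_gt0 P_ge P_le).
Qed.

(** Besides triangle inequalities this takes the traces of w at 0 and of w' at [L]; the traces of v
    are part of the norm. *)
Lemma energy_dominated : dominated energy norm2.
Proof.
have dz : dominated (fun=> 0) norm2 by exists 0 => // p _; rewrite mul0r.
have dw : dominated (fun p => ip L (pw p) (pw p)) norm2 by exists 1 => // p _; have [[]] := norm2_parts p.
have dw1 : dominated (fun p => ip L (pw1 p) (pw1 p)) norm2 by exists 1 => // p _; have [[]] := norm2_parts p.
have dw2 : dominated (fun p => ip L (pw2 p) (pw2 p)) norm2 by exists 1 => // p _; have [[]] := norm2_parts p.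
have dv : dominated (fun p => ip L (pv p) (pv p)) norm2 by exists 1 => // p _; have [[]] := norm2_parts p.
have dv1 : dominated (fun p => ip L (pv1 p) (pv1 p)) norm2 by exists 1 => // p _; have [[]] := norm2_parts p.
have dvL : dominated (fun p => pv p L ^+ 2) norm2 by exists 1 => // p _; have [_ []] := norm2_parts p.
have dv0 : dominated (fun p => pv p 0 ^+ 2) norm2 by exists 1 => // p _; have [_ []] := norm2_parts p.
have Ct0 : 0 <= (1 + L) / L by rewrite divr_ge0 ?addr_ge0// ltW.
have dw0 : dominated (fun p => pw p 0 ^+ 2) norm2.
  apply: (dominated3 Ct0 Ct0 (lexx 0) dw dw1 dz) => p [h1 _ _].
  by rewrite mulr0 addr0 -mulrDr; exact: trace0.
have dw1L : dominated (fun p => pw1 p L ^+ 2) norm2.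
  have CtL : 0 <= (1 + L) / L + 1 by rewrite addr_ge0.
  apply: (dominated3 CtL CtL (lexx 0) dw1 dw2 dz) => p [_ h2 _].
  by rewrite mulr0 addr0 -mulrDr; exact: traceL.
have b2 : 0 <= 2 * b ^+ 2 by rewrite mulr_ge0 ?sqr_ge0.
have du : dominated (fun p => ip L (eta_x p) (eta_x p)) norm2.
  apply: (@dominated3 _ _ _ _ _ 2 (2 * b ^+ 2) 0 _ _ _ dv1 dw1 dz) => // p gp.
  have [h1 h2 h3] := gp; have hu := eta_x_L2 b gp.
  rewrite mulr0.
  apply: (le_trans (y := 2 * ip L (pv1 p) (pv1 p) + 2 * b ^+ 2 * ip L (pw1 p) (pw1 p) + 0 * ip L (pv1 p) (pv1 p))).
    apply: ip_le3 => //; try by [apply: isH1_L2; eassumption].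
    move=> x _; rewrite /eta_x; have := sqr_ge0 (pv1 p x - b * pw1 p x); lra.
  by rewrite mul0r.
have PM2 : 0 <= 3 * PM ^+ 2 by rewrite mulr_ge0 ?sqr_ge0.
have b3 : 0 <= 3 * b ^+ 2 by rewrite mulr_ge0 ?sqr_ge0.
have dg : dominated (fun p => ip L (eta_t p) (eta_t p)) norm2.
  apply: (@dominated3 _ _ _ _ _ (3 * PM ^+ 2) (3 * PM ^+ 2) (3 * b ^+ 2) _ _ _ dw2 dw1 dv) => // p gp.
  have [h1 h2 h3] := gp; have hg := eta_t_L2 b L_gt0 HP HP1 gp.
  apply: ip_le3 => //; try by [apply: isH1_L2; eassumption|apply: isH1_L2f; eassumption].
  move=> x xL; rewrite -expr2 /eta_t.
  apply: (le_trans (sqr3 _ _ _)); have := P1sqr xL (pw1 p x); have := Psqr xL (pw2 p x).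
  by rewrite ![_ ^+ 2]expr2; lra.
have dgl : dominated (fun p => eta_tL p ^+ 2) norm2.
  apply: (@dominated3 _ _ _ _ _ 2 (2 * b ^+ 2) 0 _ _ _ dw1L dvL dz) => // p _.
  rewrite mulr0 addr0 /eta_tL; have := sqr_ge0 (pw1 p L + b * pv p L); lra.
have du0 : dominated (fun p => eta_0 p ^+ 2) norm2.
  apply: (@dominated3 _ _ _ _ _ 2 (2 * b ^+ 2) 0 _ _ _ dv0 dw0 dz) => // p _.
  rewrite mulr0 addr0 /eta_0; have := sqr_ge0 (pv p 0 - b * pw p 0); lra.
have d1 : dominated (fun p => ip L (eta_x p) (eta_x p) + ip L (eta_t p) (eta_t p) + eta_tL p ^+ 2) norm2.
  by apply: (@dominated3 _ _ _ _ _ 1 1 1 _ _ _ du dg dgl) => // p _; rewrite !mul1r.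
by apply: (@dominated3 _ _ _ _ _ 1 1 1 _ _ _ d1 du0 dv0) => // p _; rewrite !mul1r.
Qed.

(* With [tt = w - w(0)], [(P w')' - b^2 tt] is the function [fr] and [w'(L) + b^2 tt(L) = er], both
   controlled by the energy; testing this equation with [tt] is the estimate [key]. *)
Lemma norm2_dominated : dominated norm2 energy.
Proof.
have dz : dominated (fun=> 0) energy by exists 0 => // p _; rewrite mul0r.
have du : dominated (fun p => ip L (eta_x p) (eta_x p)) energy by exists 1 => // p _; have [] := energy_parts p.
have dg : dominated (fun p => ip L (eta_t p) (eta_t p)) energy by exists 1 => // p _; have [] := energy_parts p.
have dgl : dominated (fun p => eta_tL p ^+ 2) energy by exists 1 => // p _; have [] := energy_parts p.
have du0 : dominated (fun p => eta_0 p ^+ 2) energy by exists 1 => // p _; have [] := energy_parts p.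
have dv0 : dominated (fun p => pv p 0 ^+ 2) energy by exists 1 => // p _; have [] := energy_parts p.
have L0 := ltW L_gt0; have bn0 : b != 0 by rewrite gt_eqF.
have b0 := ltW b_gt0; have P00 := ltW P0_gt0.
have PM0 : 0 < PM := PM_gt0 L_gt0 P0_gt0 P_ge P_le.
have dw0 : dominated (fun p => pw p 0 ^+ 2) energy.
  have c0 : 0 <= 2 / b ^+ 2 by rewrite divr_ge0// sqr_ge0.
  apply: (dominated3 c0 c0 (lexx 0) du0 dv0 dz) => p _.
  rewrite mulr0 addr0 /eta_0 -mulrDr mulrAC ler_pdivlMr ?exprn_gt0//.
  have := sqr_ge0 (2 * pv p 0 + b * pw p 0); lra.
pose eta p x := pv p x + b * pw p x.
have Heta p : admissible L p -> isH1 L (eta p) (eta_x p).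
  by move=> [h1 _ h3]; exact: isH1_lin.
pose ddev p := ip L (fun x => eta p x - eta p 0) (fun x => eta p x - eta p 0).
have dde : dominated ddev energy.
  have c0 : 0 <= 4 * L ^+ 2 by rewrite mulr_ge0 ?sqr_ge0.
  apply: (dominated3 c0 (lexx 0) (lexx 0) du dz dz) => p gp.
  by rewrite !mulr0 !addr0; exact: deviation_le (Heta p gp).
have dIu : dominated (fun p => (eta p L - eta p 0) ^+ 2) energy.
  apply: (dominated3 L0 (lexx 0) (lexx 0) du dz dz) => p gp.
  rewrite !mulr0 !addr0 -(int0_deriv L_gt0 (Heta p gp)); apply: int0_sqr_le => //; exact: eta_x_L2.
pose fr p x := eta_t p x - b * (eta p x - eta p 0) - b * pv p 0.
have hconst c : L2r L (fun=> c) by exact: L2_cst.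
have hL2eta p : admissible L p -> L2r L (fun x => eta p x - eta p 0).
  move=> gp; have := L2_lin (- eta p 0) (isH1_L2f L_gt0 (Heta p gp)) (hconst 1).
  by move=> /L2_eq; apply => x _; rewrite mulr1.
have hL2f p : admissible L p -> L2r L (fr p).
  move=> gp; have := L2_lin (- (b * pv p 0)) (L2_lin (- b) (eta_t_L2 b L_gt0 HP HP1 gp) (hL2eta p gp)) (hconst 1).
  by move=> /L2_eq; apply => x _; rewrite mulr1 mulNr.
have df : dominated (fun p => ip L (fr p) (fr p)) energy.
  have c1 : 0 <= 3 * b ^+ 2 by rewrite mulr_ge0 ?sqr_ge0.
  have c2 : 0 <= 3 * b ^+ 2 * L by rewrite mulr_ge0.
  apply: (dominated3 (ler0n _ 3) c1 c2 dg dde dv0) => p gp.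
  have -> : 3 * b ^+ 2 * L * pv p 0 ^+ 2 = 3 * b ^+ 2 * pv p 0 ^+ 2 * ip L (fun=> 1) (fun=> 1).
    by rewrite /ip int0_cst//; ring.
  apply: ip_le3 => //; [exact: hL2f|exact: hL2f|exact: (eta_t_L2 b L_gt0 HP HP1 gp)|exact: (eta_t_L2 b L_gt0 HP HP1 gp)|exact: hL2eta|exact: hL2eta|].
  move=> x xL; rewrite -expr2 /fr; have := sqr3 (eta_t p x) (- (b * (eta p x - eta p 0))) (- (b * pv p 0)); lra.
pose er p := - eta_tL p + b * (eta p L - eta p 0) + b * pv p 0.
have de : dominated (fun p => er p ^+ 2) energy.
  have c1 : 0 <= 3 * b ^+ 2 by rewrite mulr_ge0 ?sqr_ge0.
  apply: (dominated3 (ler0n _ 3) c1 c1 dgl dIu dv0) => p gp.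
  have := sqr3 (- eta_tL p) (b * (eta p L - eta p 0)) (b * pv p 0); rewrite /er; lra.
(* Vanishing at 0, the test function removes the flux at 0, over which there is no control at this
   stage. *)
pose tt p x := pw p x - pw p 0.
have Htt p : admissible L p -> isH1 L (tt p) (pw1 p).
  move=> [h1 _ _]; apply: (isH1_ext L_gt0 (isH1_lin (- pw p 0) h1 (isH1_cst L 1))) => x _; by rewrite ?mulr1 ?mulr0 ?addr0.
have key p : admissible L p -> P0 * ip L (pw1 p) (pw1 p) + b ^+ 2 / 2 * ip L (tt p) (tt p) <=
    (2 * b ^+ 2)^-1 * ip L (fr p) (fr p) + PM / (4 * b ^+ 2) * er p ^+ 2.
  move=> gp; have [h1 h2 h3] := gp.
  have Ht := Htt p gp.
  have Hq := isH1_mul L_gt0 HP h2.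
  have ht := isH1_L2f L_gt0 Ht; have hf := hL2f p gp.
  have := ibp L_gt0 Hq Ht; rewrite [tt p 0]/tt subrr mulr0 subr0.
  have -> : ip L (tt p) (fun x => P x * pw2 p x + pw1 p x * P1 x) =
     ip L (tt p) (fr p) + b ^+ 2 * ip L (tt p) (tt p).
    rewrite -ip_linr//; apply: ip_eq => x _; congr (_ * _).
    by rewrite /fr /eta_t /eta /tt; ring.
  have hPw : L2r L (fun x => P x * pw1 p x) := L2_contM (isH1_cont L_gt0 HP) (isH1_L2 h1).
  have l1 : P0 * ip L (pw1 p) (pw1 p) <= ip L (fun x => P x * pw1 p x) (pw1 p).
    have : ip L (pw1 p) (pw1 p) <= P0^-1 * ip L (fun x => P x * pw1 p x) (pw1 p) + 0 * ip L (pw1 p) (pw1 p) + 0 * ip L (pw1 p) (pw1 p).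
      apply: (ip_le3 L_gt0); try (by apply: isH1_L2; eassumption); try exact: hPw.
      move=> x xL; rewrite !mul0r !addr0 [leRHS]mulrC ler_pdivlMr// -mulrA mulrC ler_wpM2r ?P_ge//.
      by rewrite -expr2 sqr_ge0.
    by rewrite !mul0r !addr0 [X in _ <= X -> _]mulrC ler_pdivlMr// [X in X <= _ -> _]mulrC.
  have hf' : L2r L (fun x => - fr p x).
    by apply: (L2_eq (L2_lin (-1) (hconst 0) hf)) => x _; rewrite add0r mulN1r.
  have l2 : ip L (tt p) (fun x => - fr p x) <= b ^+ 2 / 2 * ip L (tt p) (tt p) + (2 * b ^+ 2)^-1 * ip L (fr p) (fr p) + 0 * ip L (tt p) (tt p).
    apply: ip_le3 => // x _; rewrite mul0r addr0.
    have := @young R (b ^+ 2) (tt p x) (- fr p x); rewrite exprn_gt0// => /(_ isT) h.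
    rewrite -(ler_pM2l (ltr0n R 2)); apply: le_trans (le_trans h _); first by rewrite mulrA.
    by rewrite sqrrN le_eqVlt; apply/orP; left; apply/eqP; field.
  have l3 : ip L (tt p) (fun x => - fr p x) = - ip L (tt p) (fr p).
    have := ip_linr (-1) (hconst 0) hf ht.
    have -> : ip L (tt p) (fun=> 0) = 0.
      by rewrite -[RHS](mul0r L) -(int0_cst L_gt0 0); apply: eq_int0 => x _; rewrite mulr0.
    by rewrite add0r mulN1r => <-; apply: ip_eq => x _; rewrite add0r mulN1r.
  have w1L : pw1 p L = er p - b ^+ 2 * tt p L by rewrite /er /eta_tL /eta /tt; ring.
  rewrite w1L => e.
  (* The boundary condition at [L] has the good sign: - b^2 tt(L)^2 absorbs the cross term with
     [er p]. *)
  have l4 : P L * (er p - b ^+ 2 * tt p L) * tt p L <= PM / (4 * b ^+ 2) * er p ^+ 2.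
    have a1 : (er p - b ^+ 2 * tt p L) * tt p L <= (4 * b ^+ 2)^-1 * er p ^+ 2.
      rewrite -subr_ge0.
      have -> : (4 * b ^+ 2)^-1 * er p ^+ 2 - (er p - b ^+ 2 * tt p L) * tt p L = ((2 * b)^-1 * er p - b * tt p L) ^+ 2 by field.
      exact: sqr_ge0.
    have PLM := P_le rLL; have PL0 := ltW (P_gt0 P0_gt0 P_ge rLL).
    have a0 : 0 <= (4 * b ^+ 2)^-1 * er p ^+ 2.
      by apply: mulr_ge0; [rewrite invr_ge0 mulr_ge0 ?sqr_ge0|exact: sqr_ge0].
    have := ler_wpM2l PL0 a1; have := ler_wpM2r a0 PLM; rewrite !mulrA => i1 i2; exact: le_trans i2 i1.
  rewrite l3 in l2; lra.
have c1 : 0 <= (2 * b ^+ 2)^-1 by rewrite invr_ge0 mulr_ge0 ?sqr_ge0.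
have c2 : 0 <= PM / (4 * b ^+ 2) by rewrite divr_ge0 ?mulr_ge0 ?sqr_ge0// ltW.
have dkey : dominated (fun p => P0 * ip L (pw1 p) (pw1 p) + b ^+ 2 / 2 * ip L (tt p) (tt p)) energy.
  by apply: (dominated3 c1 c2 (lexx 0) df de dz) => p gp; rewrite mulr0 addr0; exact: key.
have dw1 : dominated (fun p => ip L (pw1 p) (pw1 p)) energy.
  have c : 0 <= P0^-1 by rewrite invr_ge0.
  apply: (dominated3 c (lexx 0) (lexx 0) dkey dz dz) => p gp; rewrite !mulr0 !addr0.
  by rewrite mulrDr mulKf ?gt_eqF// lerDl !mulr_ge0 ?ip_ge0 ?sqr_ge0// invr_ge0.
have dt : dominated (fun p => ip L (tt p) (tt p)) energy.
  have c : 0 <= (b ^+ 2 / 2)^-1 by rewrite invr_ge0 divr_ge0 ?sqr_ge0.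
  apply: (dominated3 c (lexx 0) (lexx 0) dkey dz dz) => p gp; rewrite !mulr0 !addr0.
  rewrite mulrDr mulKf ?gt_eqF ?divr_gt0 ?exprn_gt0// lerDr !mulr_ge0 ?ip_ge0//.
have dw : dominated (fun p => ip L (pw p) (pw p)) energy.
  have c : 0 <= 2 * L by rewrite mulr_ge0.
  apply: (dominated3 (ler0n _ 2) c (lexx 0) dt dw0 dz) => p gp; rewrite mulr0 addr0.
  have -> : 2 * L * pw p 0 ^+ 2 = 2 * pw p 0 ^+ 2 * ip L (fun=> 1) (fun=> 1) + 0 * ip L (fun=> 1) (fun=> 1).
    by rewrite /ip int0_cst//; ring.
  have [h1 h2 h3] := gp; rewrite addrA.
  have ht := isH1_L2f L_gt0 (Htt p gp); have hw := isH1_L2f L_gt0 h1.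
  apply: ip_le3 => // x _; rewrite /tt; have := sqr_ge0 (pw p x - 2 * pw p 0); lra.
have dv1 : dominated (fun p => ip L (pv1 p) (pv1 p)) energy.
  have c : 0 <= 2 * b ^+ 2 by rewrite mulr_ge0 ?sqr_ge0.
  apply: (dominated3 (ler0n _ 2) c (lexx 0) du dw1 dz) => p gp; rewrite mulr0.
  have [h1 h2 h3] := gp; have hu := eta_x_L2 b gp.
  apply: (le_trans (y := 2 * ip L (eta_x p) (eta_x p) + 2 * b ^+ 2 * ip L (pw1 p) (pw1 p) + 0 * ip L (pw1 p) (pw1 p))).
    apply: (ip_le3 L_gt0); try exact: hu; try (by apply: isH1_L2; eassumption).
    move=> x _; rewrite /eta_x; have := sqr_ge0 (pv1 p x + 2 * (b * pw1 p x)); lra.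
  by rewrite mul0r.
have dvL : dominated (fun p => pv p L ^+ 2) energy.
  have c : 0 <= 2 * L by rewrite mulr_ge0.
  apply: (dominated3 (ler0n _ 2) c (lexx 0) dv0 dv1 dz) => p gp; rewrite mulr0 addr0.
  have [h1 h2 h3] := gp.
  have := int0_sqr_le L_gt0 (isH1_L2 h3); rewrite (int0_deriv L_gt0 h3).
  have := sqr_ge0 (pv p L - 2 * pv p 0); lra.
have dv : dominated (fun p => ip L (pv p) (pv p)) energy.
  have c : 0 <= 2 * L by rewrite mulr_ge0.
  have c' : 0 <= 8 * L ^+ 2 by rewrite mulr_ge0 ?sqr_ge0.
  apply: (dominated3 c' c (lexx 0) dv1 dv0 dz) => p gp; rewrite mulr0 addr0.
  have [h1 h2 h3] := gp; have := deviation_le L_gt0 h3.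
  have h : L2r L (fun x => pv p x - pv p 0).
    have := L2_lin (- pv p 0) (isH1_L2f L_gt0 h3) (hconst 1).
    by move=> /L2_eq; apply => x _; rewrite mulr1.
  have : ip L (pv p) (pv p) <= 2 * ip L (fun x => pv p x - pv p 0) (fun x => pv p x - pv p 0)
     + 2 * pv p 0 ^+ 2 * ip L (fun=> 1) (fun=> 1) + 0 * ip L (fun=> 1) (fun=> 1).
    have hv := isH1_L2f L_gt0 h3.
    apply: ip_le3 => // x _; have := sqr_ge0 (pv p x - 2 * pv p 0); lra.
  rewrite {2 3 4 5}/ip !(int0_cst L_gt0); lra.
(* The second derivative comes last, from P w'' = eta_t - b v - P' w' and the lower bound of [P]. *)
have dw2 : dominated (fun p => ip L (pw2 p) (pw2 p)) energy.
  have a1 : 0 <= 3 / P0 ^+ 2 by rewrite divr_ge0 ?sqr_ge0.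
  have a2 : 0 <= 3 / P0 ^+ 2 * b ^+ 2 by rewrite mulr_ge0 ?sqr_ge0.
  have a3 : 0 <= 3 / P0 ^+ 2 * PM ^+ 2 by rewrite mulr_ge0 ?sqr_ge0.
  apply: (dominated3 a1 a2 a3 dg dv dw1) => p gp.
  have [h1 h2 h3] := gp; have hg := eta_t_L2 b L_gt0 HP HP1 gp.
  apply: (ip_le3 L_gt0); try exact: hg; try (by apply: isH1_L2; eassumption); try (by apply: isH1_L2f; eassumption).
  move=> x xL.
  have i1 : P0 ^+ 2 * (pw2 p x * pw2 p x) <= (P x * pw2 p x) ^+ 2.
    rewrite exprMn -[pw2 p x * _]expr2 ler_wpM2r ?sqr_ge0// lerXn2r ?nnegrE ?P_ge//.
    by rewrite ltW// (P_gt0 P0_gt0 P_ge).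
  have i2 := P1sqr xL (pw1 p x).
  have i3 := sqr3 (eta_t p x) (- (b * pv p x)) (- (P1 x * pw1 p x)).
  have i4 : eta_t p x + - (b * pv p x) + - (P1 x * pw1 p x) = P x * pw2 p x by rewrite /eta_t; ring.
  rewrite i4 in i3.
  have -> : 3 / P0 ^+ 2 * (eta_t p x * eta_t p x) + 3 / P0 ^+ 2 * b ^+ 2 * (pv p x * pv p x) +
     3 / P0 ^+ 2 * PM ^+ 2 * (pw1 p x * pw1 p x) = (3 * (eta_t p x * eta_t p x) + 3 * (b ^+ 2 * (pv p x * pv p x)) + 3 * (PM ^+ 2 * (pw1 p x * pw1 p x))) / P0 ^+ 2.
    by field; rewrite gt_eqF.
  rewrite ler_pdivlMr ?exprn_gt0//; lra.
have d1 : dominated (fun p => ip L (pw p) (pw p) + ip L (pw1 p) (pw1 p) + ip L (pw2 p) (pw2 p)) energy.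
  by apply: (@dominated3 _ _ _ _ _ 1 1 1 _ _ _ dw dw1 dw2) => // p _; rewrite !mul1r.
have d2 : dominated (fun p => ip L (pv p) (pv p) + ip L (pv1 p) (pv1 p) + pv p L ^+ 2) energy.
  by apply: (@dominated3 _ _ _ _ _ 1 1 1 _ _ _ dv dv1 dvL) => // p _; rewrite !mul1r.
by apply: (@dominated3 _ _ _ _ _ 1 1 1 _ _ _ d1 d2 dv0) => // p _; rewrite !mul1r /norm2; lra.
Qed.

End NormEquivalence.

(** * Density of the domain *)

Section L2Density.
Variables (R : realType) (L : R).
Hypothesis L_gt0 : 0 < L.
Notation mu := (@lebesgue_measure R).
Implicit Types (f g h F G B : R -> R) (x y t e M : R).

Lemma int0_dominated_cvg (phi : nat -> R -> R) B : integrable0L L B ->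
  (forall n, measurable_fun `[0, L] (phi n)) ->
  (forall n x, 0 <= x <= L -> 0 <= phi n x <= B x) ->
  (forall x, 0 <= x <= L -> phi n x @[n --> \oo] --> 0) ->
  forall e, 0 < e -> exists n, int0 L (phi n) < e.
Proof.
move=> iB mphi hphi cphi e e0.
have [] := @dominated_convergence _ _ _ mu `[0, L] (measurable_itv _)
  (fun n => EFin \o phi n) (cst 0%E) (EFin \o B) _ _ _ iB _.
- by move=> n; apply/measurable_EFinP; exact: mphi.
- exact: measurable_cst.
- apply: aeW => x /=; rewrite in_itv/= => xL.
  by apply/fine_cvgP; split; [exact: nearW|exact: cphi].
- by apply: aeW => x n /=; rewrite in_itv/= => /(hphi n) /andP[p0 pB]; rewrite lee_fin ger0_norm.
move=> _ _; rewrite integral0 => /fine_cvgP[_ /cvgrPdist_lt /(_ e e0)].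
move=> [n _ hn]; exists n; have := hn n (leqnn n).
rewrite /= sub0r normrN; apply: le_lt_trans; exact: ler_norm.
Qed.

(** Truncation at height [M]. Being 1-Lipschitz, it turns L1-approximants of a bounded function into
    L2-approximants; it also reduces L2 functions to bounded ones. *)
Definition clamp M x : R := Num.max (- M) (Num.min M x).

Lemma clamp_bound M x : 0 <= M -> `|clamp M x| <= M.
Proof.
move=> M0; rewrite /clamp ler_norml le_max lexx/= ge_max ge_min lexx/=; lra.
Qed.

Lemma clamp_id M x : `|x| <= M -> clamp M x = x.
Proof. by rewrite ler_norml => /andP[h1 h2]; rewrite /clamp (min_idPr h2) (max_idPr h1). Qed.

Lemma clampP M x : 0 <= M ->
  [\/ x < - M /\ clamp M x = - M, - M <= x <= M /\ clamp M x = x | M < x /\ clamp M x = M].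
Proof.
move=> M0; have [h1|h1] := leP x M; last first.
  apply: Or33; split => //; rewrite /clamp (min_idPl (ltW h1)); apply: max_r; lra.
have [h2|h2] := leP (- M) x.
  by apply: Or32; split => //; rewrite /clamp (min_idPr h1); exact: max_r.
by apply: Or31; split => //; rewrite /clamp (min_idPr h1); apply: max_l; exact: ltW.
Qed.

Lemma clamp_lip M x y : 0 <= M -> `|clamp M x - clamp M y| <= `|x - y|.
Proof.
move=> M0; have n1 := ler_norm (x - y); have n2 := ler_norm (- (x - y)); rewrite normrN in n2.
case: (clampP x M0) => -[hx ->]; case: (clampP y M0) => -[hy ->];
  rewrite ler_norml; apply/andP; split; move: hx hy => *; lra.
Qed.

Lemma clamp_cont M : 0 <= M -> continuous (clamp M).
Proof.
move=> M0 x; apply/cvgrPdist_lt => e e0; near=> y.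
apply: (le_lt_trans (clamp_lip _ _ M0)); near: y; exact: cvgr_dist_lt.
Unshelve. all: by end_near. Qed.

Definition approx h : Prop := forall e, 0 < e ->
  exists f F, isH1 L f F /\ ip L (fun x => h x - f x) (fun x => h x - f x) < e.

Lemma L2_sub f g : L2r L f -> L2r L g -> L2r L (fun x => f x - g x).
Proof. by move=> hf hg; apply: (L2_eq (L2_lin (-1) hf hg)) => x _; rewrite mulN1r. Qed.

Lemma approx_trans h : L2r L h ->
  (forall e, 0 < e -> exists g, [/\ L2r L g, approx g & ip L (fun x => h x - g x) (fun x => h x - g x) < e]) ->
  approx h.
Proof.
move=> hh hap e e0; have e4 : 0 < e / 4 by rewrite divr_gt0.
have [g [hg ag hhg]] := hap _ e4.
have [f [F [Hf hgf]]] := ag _ e4; exists f, F; split => //.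
have hf := isH1_L2f L_gt0 Hf.
have := @ip_le3 R L L_gt0 (fun x => h x - f x) (fun x => h x - f x) (fun x => h x - g x) (fun x => h x - g x)
  (fun x => g x - f x) (fun x => g x - f x) (fun x => g x - f x) (fun x => g x - f x) 2 2 0.
do 8 (move=> /(_ (ltac:(exact: L2_sub)))).
move=> /(_ _)/wrap[x _|].
  have := sqr_ge0 ((h x - g x) - (g x - f x)); lra.
lra.
Qed.

(** Steklov averages: the mean of [g] over [[x, x + 1/(n+1)]] is C^1 in x and, by the mean value
    theorem, a value of [g] near x. Boundedness of [g] allows dominated convergence. *)
Lemma approx_cont g M : continuous g -> (forall x, `|g x| <= M) -> approx g.
Proof.
move=> cg gM e e0.
have ig x : mu.-integrable `[-1, x] (EFin \o g).
  apply: continuous_compact_integrable; first exact: segment_compact.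
  exact: continuous_subspaceT.
(* Starting the primitive at -1 makes 0 an interior point for differentiation. *)
pose G x := \int[mu]_(t in `[-1, x]) g t.
have dG x : 0 <= x -> is_derive x 1 G (g x).
  move=> x0; have xm : -1 < x by apply: lt_le_trans x0; rewrite ltrN10.
  have [d1 d2] := @continuous_FTC1_closed R g (-1) x (x + 1) (ltac:(by rewrite ltrDl)) (ig _) xm (cg x).
  by rewrite -d2 derive1E; apply: DeriveDef.
have cG x : 0 <= x -> {for x, continuous G}.
  by move=> /dG[dy _]; apply: differentiable_continuous; apply/derivable1_diffP.
pose k (n : nat) : R := n.+1%:R.
have k0 n : 0 < k n by [].
pose f (n : nat) x := k n * (G (x + (k n)^-1) - G x).
pose F (n : nat) x := k n * (g (x + (k n)^-1) - g x).
have mean n x : 0 <= x -> exists2 c, x < c < x + (k n)^-1 & f n x = g c.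
  move=> x0; have xk : x < x + (k n)^-1 by rewrite ltrDl invr_gt0.
  have := @MVT R G g x (x + (k n)^-1) xk.
  case=> [y|y yx|c].
  - by rewrite in_itv/= => /andP[xy _]; apply: dG; rewrite (le_trans x0)// ltW.
  - apply: continuous_in_subspaceT => z; rewrite inE/= in_itv/= => /andP[xz _].
    by apply: cG; rewrite (le_trans x0).
  rewrite in_itv/= => cx E; exists c => //.
  by rewrite /f E addrAC subrr add0r mulrCA divff ?mulr1// gt_eqF.
have Hf n : isH1 L (f n) (F n).
  apply: isH1_C1 => //.
    move=> x /andP[x0 _]; rewrite /f /F.
    have h1 : is_derive (x + (k n)^-1) 1 G (g (x + (k n)^-1)).
      by apply: dG; rewrite addr_ge0// invr_ge0.
    have h2 : is_derive x 1 (G \o shift (k n)^-1) (g (x + (k n)^-1) * 1).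
      exact: (@is_derive1_comp R G (shift (k n)^-1) x _ 1 h1 (is_derive_shift x 1 _)).
    have h3 := is_deriveZ (k n) (is_deriveB h2 (dG x x0)).
    by rewrite mulr1 in h3.
  move=> x; apply: cvgM; first exact: cvg_cst.
  apply: cvgB; last exact: cg.
  apply: continuous_comp; last exact: cg.
  by apply: cvgD; [exact: cvg_id|exact: cvg_cst].
have M0 : 0 <= M by apply: le_trans (gM 0).
have cW : {within `[0, L], continuous g} := continuous_subspaceT cg.
have hg := cont_L2 cW.
have hd n := L2_sub hg (isH1_L2f L_gt0 (Hf n)).
have [|n x xL|x /andP[x0 xL]|n hn] := @int0_dominated_cvg (fun n x => (g x - f n x) * (g x - f n x)) (fun=> (2 * M) ^+ 2) (integrable0L_cst L _) _ _ _ e e0.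
- by move=> n; apply: integrable0L_measurable; exact: L2_mul (hd n) (hd n).
- rewrite -expr2 sqr_ge0/= -real_normK ?num_real// lerXn2r ?nnegrE ?mulr_ge0//.
  have [c _ ->] := mean n x (ltac:(by case/andP: xL)).
  by rewrite (le_trans (ler_normB _ _))// mulr_natl mulr2n lerD.
- rewrite -[X in _ --> X](mulr0 0); have h : g x - f n x @[n --> \oo] --> 0.
    rewrite -[X in _ --> X](subrr (g x)); apply: cvgB; first exact: cvg_cst.
    apply/cvgrPdist_lt => r r0.
    have /cvgrPdist_lt /(_ r r0) /nbhs_ballP[d /= d0 hd'] := cg x.
    have := @cvg_harmonic R; move=> /cvgrPdist_lt /(_ d d0) [n0 _ hn0].
    exists n0 => // n /= n0n; have [c /andP[xc cx] ->] := mean n x x0.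
    apply: hd'; rewrite /ball/= ltr0_norm ?subr_lt0// opprB ltrBlDl (lt_le_trans cx)// lerD2l.
    have := hn0 n n0n; rewrite /harmonic/= sub0r normrN gtr0_norm ?invr_gt0//.
    by move=> /ltW; rewrite /k.
  exact: cvgM.
by exists (f n), (F n); split.
Qed.

(** Continuous functions are dense in L1. After clamping, the squared error is at most 2 M times the
    L1 integrand, so closeness in L1 is enough. *)
Lemma approx_bounded h M : 0 < M -> measurable_fun `[0, L] h -> (forall x, 0 <= x <= L -> `|h x| <= M) -> approx h.
Proof.
move=> M0 mh hM; have M0' := ltW M0.
have ih : integrable0L L h by apply: (integrable0L_le mh (integrable0L_cst L M)).
have h2 : L2r L h.
  split => //; apply: (integrable0L_le _ (integrable0L_cst L (M ^+ 2))); first exact: measurable_funX.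
  by move=> x xL; rewrite ger0_norm ?sqr_ge0// -real_normK ?num_real// lerXn2r ?nnegrE ?hM.
apply: approx_trans => // e e0.
have muL : (mu `[0%R, L]%classic < +oo)%E.
  by rewrite lebesgue_measure_itv/= lte_fin L_gt0 -EFinB ltry.
have [g_ [cg ig /fine_cvgP[_ /cvgrPdist_lt cvg]]] := approximation_continuous_integrable (measurable_itv `[0, L]) muL ih.
have q0 : 0 < e / (2 * M + 1) by rewrite divr_gt0// ltr_wpDl// mulr_ge0.
have [n _ hn] := cvg _ q0; have := hn n (leqnn n); rewrite /= sub0r normrN => hlt.
have {}hlt : int0 L (fun x => `|h x - g_ n x|) < e / (2 * M + 1).
  by apply: le_lt_trans hlt; exact: ler_norm.
pose g x := clamp M (g_ n x).
have cgc : continuous g.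
  by move=> x; apply: (@continuous_comp R R R (g_ n) (clamp M) x); [exact: (cg n x)|exact: clamp_cont].
have gb x : `|g x| <= M by exact: clamp_bound.
have hg : L2r L g := cont_L2 (continuous_subspaceT cgc).
exists g; split => //; first exact: approx_cont cgc gb.
have ia : integrable0L L (fun x => `|h x - g_ n x|).
  have := integrable_norm (integrable0L_lin (-1) ih (ig n)).
  by move=> /eq_integrable0L; apply => x _; rewrite /= mulN1r.
have ia2 : integrable0L L (fun x => 0 + 2 * M * `|h x - g_ n x|) := integrable0L_lin (2 * M) (integrable0L_cst L 0) ia.
have : ip L (fun x => h x - g x) (fun x => h x - g x) <= int0 L (fun x => 0 + 2 * M * `|h x - g_ n x|).
  apply: le_int0 => //; first by apply: L2_mul; exact: L2_sub.
  move=> x xL; rewrite add0r -expr2 -real_normK ?num_real// expr2.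
  have l1 : `|h x - g x| <= 2 * M.
    by rewrite (le_trans (ler_normB _ _))// mulr_natl mulr2n lerD ?hM.
  have l2 : `|h x - g x| <= `|h x - g_ n x|.
    by rewrite -[in leLHS](clamp_id (hM x xL)); exact: clamp_lip.
  exact: ler_pM.
rewrite (int0_lin (2 * M) (integrable0L_cst L 0) ia) int0_cst// mul0r add0r => /le_lt_trans; apply.
have MM : 0 <= 2 * M by rewrite mulr_ge0.
have Ia : 0 <= int0 L (fun x => `|h x - g_ n x|) by apply: int0_ge0.
move: hlt; rewrite ltr_pdivlMr ?ltr_wpDl// => hlt; lra.
Qed.

Lemma approx_L2 h : L2r L h -> approx h.
Proof.
move=> hh; apply: approx_trans => // e e0.
have mh := integrable0L_measurable (integrable0L_L2 hh).
have mc M : 0 <= M -> measurable_fun `[0, L] (fun x => clamp M (h x)).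
  by move=> M0; apply: measurableT_comp => //; apply: continuous_measurable_fun; exact: clamp_cont.
have ac M x : 0 <= M -> `|clamp M x| <= `|x|.
  move=> M0; have := clamp_lip x 0 M0.
  by rewrite (@clamp_id M 0) ?normr0// !subr0.
have hc M : 0 <= M -> L2r L (fun x => clamp M (h x)).
  move=> M0; split.
    by apply: (integrable0L_le (mc M M0) (integrable_norm (integrable0L_L2 hh))) => x _; exact: ac.
  apply: (integrable0L_le _ hh.2); first by apply: measurable_funX; exact: mc.
  move=> x _; rewrite ger0_norm ?sqr_ge0// -(real_normK (num_real (h x))) -(real_normK (num_real (clamp M _))).
  by rewrite lerXn2r ?nnegrE// ac.
pose k (n : nat) : R := n.+1%:R.
have k0 n : 0 <= k n by [].
have hd n := L2_sub hh (hc (k n) (k0 n)).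
have i4 := integrable0L_lin 4 (integrable0L_cst L 0) hh.2.
have [|n x xL|x xL|n hn] := @int0_dominated_cvg (fun n x => (h x - clamp (k n) (h x)) * (h x - clamp (k n) (h x))) _ i4 _ _ _ e e0.
- by move=> n; apply: integrable0L_measurable; exact: L2_mul (hd n) (hd n).
- rewrite -expr2 sqr_ge0/= add0r -real_normK ?num_real//.
  have l : `|h x - clamp (k n) (h x)| <= 2 * `|h x|.
    by rewrite (le_trans (ler_normB _ _))// mulr_natl mulr2n lerD// ac.
  have := ler_pM (normr_ge0 _) (normr_ge0 _) l l.
  rewrite -(real_normK (num_real (h x))) !expr2; lra.
- apply/cvgrPdist_lt => r r0; near=> n.
  rewrite clamp_id ?subrr ?mulr0 ?subrr ?normr0//.
  apply: (@le_trans _ _ n%:R); last by rewrite /k ler_nat.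
  near: n; exists (Num.bound `|h x|) => // n /= hn.
  by apply: le_trans (ltW (archi_boundP (normr_ge0 _))) _; rewrite ler_nat.
exists (fun x => clamp (k n) (h x)); split => //; first exact: hc.
apply: (@approx_bounded _ (k n)) => //; first exact: mc.
by move=> x _; exact: clamp_bound.
Unshelve. all: by end_near. Qed.

End L2Density.

(** * Small mean-zero functions with prescribed end values *)

Section Bumps.
Variables (R : realType) (L : R).
Hypothesis L_gt0 : 0 < L.
Implicit Types (f g h F G s : R -> R) (x y t e c : R).

Lemma isH1_pow s c n : isH1 L s (fun=> c) ->
  isH1 L (fun x => s x ^+ n.+1) (fun x => n.+1%:R * c * s x ^+ n).
Proof.
move=> Hs; elim: n => [|n IH].
  by apply: (isH1_ext L_gt0 Hs) => x _; rewrite ?expr1// expr0 mulr1 mul1r.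
apply: (isH1_ext L_gt0 (isH1_mul L_gt0 Hs IH)) => x _; first by rewrite -exprS.
by rewrite -[n.+2]addn1 natrD exprS; ring.
Qed.

Lemma pow_L2 s c n : isH1 L s (fun=> c) -> L2r L (fun x => s x ^+ n).
Proof.
move=> Hs; case: n => [|n]; first by apply: (L2_eq (L2_cst L 1)) => x _; rewrite expr0.
have H := isH1_pow n Hs; exact: (isH1_L2f L_gt0 H).
Qed.

(* For [s] affine onto [0, 1], [(n + 2) s^(n + 1) - (n + 1) s^n] is 0 and 1 at the end points, has
   mean 0 and squared norm of order [1/n]. *)
Lemma bump s c : isH1 L s (fun=> c) -> c != 0 ->
  (forall n, s L ^+ n.+1 - s 0 ^+ n.+1 = c * L) ->
  forall e, 0 < e -> exists f F, [/\ isH1 L f F, int0 L f = 0, ip L f f < e,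
    (forall x, s x = 1 -> f x = 1) & (forall x, s x = 0 -> f x = 0)].
Proof.
move=> Hs c0 hs e e0.
have hp n := pow_L2 n Hs.
have Ip n : int0 L (fun x => s x ^+ n) = L / n.+1%:R.
  have := int0_deriv L_gt0 (isH1_pow n Hs); rewrite hs.
  have <- : n.+1%:R * c * int0 L (fun x => s x ^+ n) = int0 L (fun x => n.+1%:R * c * s x ^+ n).
    have := int0_lin (n.+1%:R * c) (integrable0L_cst L 0) (integrable0L_L2 (hp n)).
    rewrite int0_cst// mul0r add0r => <-; by apply: eq_int0 => x _; rewrite add0r.
  have n0 : n.+1%:R != 0 :> R by rewrite pnatr_eq0.
  move=> /(congr1 (fun z => z / (n.+1%:R * c))); rewrite mulrAC divff ?mulf_neq0// mul1r => ->.
  by move: (n.+1%:R) n0 => k k0; field; rewrite ?c0 ?k0.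
have ipp m n : ip L (fun x => s x ^+ m) (fun x => s x ^+ n) = L / (m + n).+1%:R.
  by rewrite -Ip; apply: eq_int0 => x _; rewrite exprD.
(* The successor makes s^n vanish wherever s does, and n > L / e brings the squared norm, which is
   at most L / n, below [e]. *)
pose m := Num.bound (L / e); pose n := m.+1.
pose N : R := n%:R.
pose f x := (n.+2%:R) * s x ^+ n.+1 + (- n.+1%:R) * s x ^+ n.
have Hf0 := isH1_lin (n.+2%:R) (isH1_cst L 0) (isH1_pow n Hs).
have Hf := isH1_lin (- n.+1%:R) Hf0 (isH1_pow m Hs).
exists f, (fun x => n.+2%:R * (n.+1%:R * c * s x ^+ n) + - n.+1%:R * (m.+1%:R * c * s x ^+ m)).
have a1 : L2r L (fun x => n.+2%:R * s x ^+ n.+1).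
  by apply: (L2_eq (L2_lin (n.+2%:R) (L2_cst L 0) (hp n.+1))) => x _; rewrite add0r.
have N0 : 0 <= N by rewrite ler0n.
have n1 : n.+1%:R = N + 1 :> R by rewrite -addn1 natrD.
have n2 : n.+2%:R = N + 2 :> R by rewrite -addn2 natrD.
have d1 : (n.+1 + n.+1).+1%:R = 2 * N + 3 :> R by rewrite -[(_ + _).+1]addn1 !natrD n1; ring.
have d2 : (n.+1 + n).+1%:R = 2 * N + 2 :> R by rewrite -[(_ + _).+1]addn1 !natrD n1 -/N; ring.
have d3 : (n + n).+1%:R = 2 * N + 1 :> R by rewrite -[(_ + _).+1]addn1 !natrD -/N; ring.
split => //.
- by apply: (isH1_ext L_gt0 Hf) => x _; rewrite ?add0r.
- rewrite (int0_lin (- n.+1%:R) (integrable0L_L2 a1) (integrable0L_L2 (hp n))).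
  have -> : int0 L (fun x => n.+2%:R * s x ^+ n.+1) = n.+2%:R * int0 L (fun x => s x ^+ n.+1).
    have := int0_lin n.+2%:R (integrable0L_cst L 0) (integrable0L_L2 (hp n.+1)).
    rewrite int0_cst// mul0r add0r => <-; by apply: eq_int0 => x _; rewrite add0r.
  rewrite !Ip n1 n2; field; rewrite !gt_eqF//; lra.
- have -> : ip L f f = (N + 2) ^+ 2 * (L / (2 * N + 3)) - (N + 1) * (2 * ((N + 2) * (L / (2 * N + 2)))) + (N + 1) ^+ 2 * (L / (2 * N + 1)).
    rewrite (ip_quad _ a1 (hp n)).
    have q1 : ip L (fun x => n.+2%:R * s x ^+ n.+1) (fun x => s x ^+ n) = n.+2%:R * ip L (fun x => s x ^+ n.+1) (fun x => s x ^+ n).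
      have := ip_linl n.+2%:R (L2_cst L 0) (hp n.+1) (hp n).
      have -> : ip L (fun=> 0) (fun x => s x ^+ n) = 0.
        by rewrite -[RHS](mul0r L) -(int0_cst L_gt0 0); apply: eq_int0 => x _; rewrite mul0r.
      by rewrite add0r => <-; apply: ip_eq => x _; rewrite add0r.
    have q2 : ip L (fun x => n.+2%:R * s x ^+ n.+1) (fun x => n.+2%:R * s x ^+ n.+1) = n.+2%:R ^+ 2 * ip L (fun x => s x ^+ n.+1) (fun x => s x ^+ n.+1).
      have := ip_quad n.+2%:R (L2_cst L 0) (hp n.+1).
      have -> : ip L (fun=> 0) (fun=> 0) = 0 by rewrite /ip int0_cst// mul0r mul0r.
      have -> : ip L (fun=> 0) (fun x => s x ^+ n.+1) = 0.
        by rewrite -[RHS](mul0r L) -(int0_cst L_gt0 0); apply: eq_int0 => x _; rewrite mul0r.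
      by rewrite !mulr0 !add0r => <-; apply: ip_eq => x _; rewrite !add0r.
    rewrite q1 q2 !ipp d1 d2 d3 n1 n2; ring.
  have -> : (N + 2) ^+ 2 * (L / (2 * N + 3)) - (N + 1) * (2 * ((N + 2) * (L / (2 * N + 2)))) + (N + 1) ^+ 2 * (L / (2 * N + 1))
    = L / 4 * ((2 * N + 3)^-1 + (2 * N + 1)^-1) by field; rewrite !gt_eqF//; lra.
  have b1 : L / e < N.
    apply: (lt_le_trans (archi_boundP _)); first by rewrite divr_ge0 ?ltW.
    by rewrite /N /n ler_nat.
  have Np : 0 < N by apply: le_lt_trans b1; rewrite divr_ge0 ?ltW.
  have i1 : (2 * N + 3)^-1 <= N^-1 by rewrite lef_pV2 ?posrE; lra.
  have i2 : (2 * N + 1)^-1 <= N^-1 by rewrite lef_pV2 ?posrE; lra.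
  apply: (@le_lt_trans _ _ (L / N)).
    have := ler_wpM2l (ltW L_gt0) i1; have := ler_wpM2l (ltW L_gt0) i2.
    have : 0 <= L / N by rewrite divr_ge0 ?ltW.
    lra.
  by rewrite ltr_pdivrMr// -ltr_pdivrMl// mulrC.
- by move=> x sx; rewrite /f sx !expr1n n1 n2; ring.
- by move=> x sx; rewrite /f sx !expr0n /= !mulr0 addr0.
Qed.

Lemma bumpL e : 0 < e -> exists f F,
  [/\ isH1 L f F, int0 L f = 0, ip L f f < e, f L = 1 & f 0 = 0].
Proof.
move=> e0; have L0 : L != 0 by rewrite gt_eqF.
have Hs : isH1 L (fun x => x / L) (fun=> L^-1).
  have := isH1_lin (- L^-1) (isH1_cst L 1) (isH1_compl L).
  by move=> /(isH1_ext L_gt0); apply => x _; field.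
have [|n|f [F [h1 h2 h3 h4 h5]]] := bump Hs _ _ e0.
- by rewrite invr_neq0.
- by rewrite divff// mul0r expr1n expr0n subr0 mulVf.
by exists f, F; split => //; [apply: h4; rewrite divff|apply: h5; rewrite mul0r].
Qed.

Lemma bump0 e : 0 < e -> exists f F,
  [/\ isH1 L f F, int0 L f = 0, ip L f f < e, f 0 = 1 & f L = 0].
Proof.
move=> e0; have L0 : L != 0 by rewrite gt_eqF.
have Hs : isH1 L (fun x => (L - x) / L) (fun=> - L^-1).
  have := isH1_lin L^-1 (isH1_cst L 0) (isH1_compl L).
  by move=> /(isH1_ext L_gt0); apply => x _; field.
have [|n|f [F [h1 h2 h3 h4 h5]]] := bump Hs _ _ e0.
- by rewrite oppr_eq0 invr_neq0.
- by rewrite subrr mul0r subr0 divff// expr1n expr0n sub0r mulNr mulVf.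
by exists f, F; split => //; [apply: h4; rewrite subr0 divff|apply: h5; rewrite subrr mul0r].
Qed.

End Bumps.

(** This inequality and the next two are the arithmetic of [compatible_dense], stated over plain
    reals in place of integrals. *)
Lemma sqr_sub3_le (R : realType) (z f a x c y : R) :
  (z + -1 * (f + a * x + c * y)) * (z + -1 * (f + a * x + c * y)) <=
  3 * ((z - f) * (z - f)) + 3 * a ^+ 2 * (x * x) + 3 * c ^+ 2 * (y * y).
Proof. by have := sqr3 (z - f) (- (a * x)) (- (c * y)); lra. Qed.

Lemma le_bump_error (R : realType) (Y A i j s t r : R) : 0 <= i -> 0 <= j -> 0 <= s -> 0 <= t ->
  i * (s + t + 1) < r -> j * (s + t + 1) < r -> A < r ->
  Y <= 3 * A + 3 * s * i + 3 * t * j -> Y <= 9 * r.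
Proof.
move=> i0 j0 s0 t0 hi hj hA hY; have := mulr_ge0 i0 t0; have := mulr_ge0 j0 s0; lra.
Qed.

Lemma lt_density_sum (R : realType) (l c X Y r t1 t2 t3 t4 : R) :
  t1 <= l * (l * Y) -> t2 <= l * Y -> t3 <= l * X -> t4 <= c * X ->
  (1 + l + l * l) * Y <= (1 + l + l * l) * (9 * r) -> (1 + l + c) * X < (1 + l + c) * r ->
  t1 + t2 + Y + t3 + X + t4 < (9 * (1 + l + l * l) + (1 + l + c)) * r.
Proof. by move=> *; lra. Qed.

(** * Approximation by smooth jets satisfying the boundary conditions *)

Section RealDensity.
Variables (R : realType) (L : R) (P P1 : R -> R) (th1 th2 th3 th4 : R).
Hypotheses (L_gt0 : 0 < L) (PL_neq0 : P L != 0) (P0_neq0 : P 0 != 0).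
Implicit Types (f g h F G : R -> R) (x y t s e : R) (p q : jet R).

Definition smooth p : Prop := admissible L p /\ (exists w3, isH1 L (pw2 p) w3) /\ (exists v2, isH1 L (pv1 p) v2).
Definition compatible p : Prop :=
  P L * pw2 p L + P1 L * pw1 p L = - pw1 p L /\
  P 0 * pw2 p 0 + P1 0 * pw1 p 0 = th1 * pv p 0 + th2 * pv1 p 0 + th3 * pw p 0 + th4 * pw1 p 0.

Lemma isH1_prim c F : L2r L F -> isH1 L (fun x => c + int0 x F) F.
Proof. by move=> hF; split => // x _; rewrite int0_0 addr0. Qed.

(* The second derivative is corrected by mean-zero bumps, so that [w'(L)] is not affected and the two
   boundary conditions decouple. *)
Lemma compatible_dense p e : admissible L p -> 0 < e ->
  exists q, [/\ smooth q, compatible q & norm2 L (jet_lin (-1) p q) < e].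
Proof.
move=> gp e0; have [p1 p2 p3] := gp.
(* With l = 4 L^2 the Poincare constant, each integration multiplies a squared error by l. An error
   9 r in w'' thus costs 9 (1 + l + l^2) r for w'', w', w, and an error r in v' costs (1 + l + L) r
   for v', v, v(L). *)
pose C := 9 * (1 + 4 * L ^+ 2 + 4 * L ^+ 2 * (4 * L ^+ 2)) + (1 + 4 * L ^+ 2 + L).
have C0 : 0 < C.
  have h2 : 0 <= L ^+ 2 := sqr_ge0 L.
  have l4 : 0 <= 4 * L ^+ 2 by rewrite mulr_ge0.
  have h4 := mulr_ge0 l4 l4.
  rewrite /C addr_gt0//; last by apply: ltr_wpDl => //; rewrite addr_ge0.
  by rewrite mulr_gt0//; apply: ltr_wpDr => //; apply: ltr_wpDr.
have eC : 0 < e / C by rewrite divr_gt0.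
have [fv [Fv [Hfv ev]]] := approx_L2 L_gt0 (isH1_L2 p3) eC.
have [fw [Fw [Hfw ew]]] := approx_L2 L_gt0 (isH1_L2 p2) eC.
(* The values of w'' demanded at 0 and [L], less those of [fw]. They are known before the bumps are
   chosen, so the bumps can be made small relative to these amplitudes. *)
pose a0 := (th1 * pv p 0 + th2 * fv 0 + th3 * pw p 0 + th4 * pw1 p 0 - P1 0 * pw1 p 0) / P 0 - fw 0.
pose B := pw1 p 0 + int0 L fw.
pose aL := (- B - P1 L * B) / P L - fw L.
have q0 : 0 < e / C / (a0 ^+ 2 + aL ^+ 2 + 1).
  by rewrite divr_gt0// ltr_wpDl// addr_ge0 ?sqr_ge0.
have [f0 [F0 [H0 I0 e00 f00 f0L]]] := bump0 L_gt0 q0.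
have [fL [FL [HL IL eL fLL fL0]]] := bumpL L_gt0 q0.
pose w2 x := fw x + a0 * f0 x + aL * fL x.
have Hw2a := isH1_lin a0 Hfw H0.
have Hw2 : isH1 L w2 _ := isH1_lin aL Hw2a HL.
have hfw := isH1_L2f L_gt0 Hfw; have hf0 := isH1_L2f L_gt0 H0; have hfL := isH1_L2f L_gt0 HL.
have hw2 := isH1_L2f L_gt0 Hw2.
pose w1 x := pw1 p 0 + int0 x w2; have Hw1 : isH1 L w1 w2 := isH1_prim _ hw2.
pose w x := pw p 0 + int0 x w1; have Hw : isH1 L w w1 := isH1_prim _ (isH1_L2f L_gt0 Hw1).
pose v x := pv p 0 + int0 x fv; have Hv : isH1 L v fv := isH1_prim _ (isH1_L2f L_gt0 Hfv).
have w1L : w1 L = B.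
  rewrite /w1 /w2 (int0_lin aL (integrable0L_L2 (isH1_L2f L_gt0 Hw2a)) (integrable0L_L2 hfL)).
  by rewrite (int0_lin a0 (integrable0L_L2 hfw) (integrable0L_L2 hf0)) I0 IL !mulr0 !addr0.
have w10 : w1 0 = pw1 p 0 by rewrite /w1 int0_0 addr0.
have w0 : w 0 = pw p 0 by rewrite /w int0_0 addr0.
have v0 : v 0 = pv p 0 by rewrite /v int0_0 addr0.
pose q := Jet w w1 w2 v fv.
exists q; split.
- split; first by split.
  by split; [exists (fun x => Fw x + a0 * F0 x + aL * FL x)|exists Fv].
- split => /=; last first.
    rewrite w10 w0 v0 /w2 f00 fL0 mulr0 addr0 mulr1 /a0; field.
    exact: P0_neq0.
  rewrite w1L /w2 f0L fLL mulr0 addr0 mulr1 /aL; field.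
  exact: PL_neq0.
(* The approximants keep the values of w, w' and v at 0, so every difference vanishes there and is
   controlled by its derivative. *)
have dH f F g G : isH1 L f F -> isH1 L g G -> f 0 = g 0 ->
   let d x := f x + (-1) * g x in let d' x := F x + (-1) * G x in
   ip L d d <= 4 * L ^+ 2 * ip L d' d' /\ d L ^+ 2 <= L * ip L d' d'.
  move=> hf hg fg d d'; have Hd : isH1 L d d' := isH1_lin (-1) hf hg.
  have d0 : d 0 = 0 by rewrite /d fg; ring.
  split.
    have := deviation_le L_gt0 Hd.
    rewrite (@ip_eq _ L (fun x => d x - d 0) (fun x => d x - d 0) d d)// => x _.
    by rewrite d0 subr0.
  have := int0_sqr_le L_gt0 (isH1_L2 Hd); by rewrite (int0_deriv L_gt0 Hd) d0 subr0.
have [b1 _] := dH _ _ _ _ p1 Hw (esym w0).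
have [b2 _] := dH _ _ _ _ p2 Hw1 (esym w10).
have [b3 b4] := dH _ _ _ _ p3 Hv (esym v0).
have z0 : pv p 0 + -1 * v 0 = 0 by rewrite v0; ring.
rewrite /norm2 /= z0 expr0n addr0.
set X := ip L (fun x => pv1 p x + -1 * fv x) _ in b3 b4 *.
set Y := ip L (fun x => pw2 p x + -1 * w2 x) _ in b2 *.
have eX : X < e / C.
  move: ev; rewrite (@ip_eq _ L _ _ (fun x => pv1 p x + -1 * fv x) (fun x => pv1 p x + -1 * fv x))// => x _.
  by rewrite mulN1r.
have eY : Y <= 9 * (e / C).
  have hsub : L2r L (fun x => pw2 p x - fw x) := L2_sub (isH1_L2 p2) hfw.
  have hd : L2r L (fun x => pw2 p x + -1 * w2 x) := L2_lin (-1) (isH1_L2 p2) hw2.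
  have : Y <= 3 * ip L (fun x => pw2 p x - fw x) (fun x => pw2 p x - fw x) + 3 * a0 ^+ 2 * ip L f0 f0 + 3 * aL ^+ 2 * ip L fL fL.
    by apply: ip_le3 => // x _; exact: sqr_sub3_le.
  have D0 : 0 < a0 ^+ 2 + aL ^+ 2 + 1 by rewrite ltr_wpDl// addr_ge0 ?sqr_ge0.
  rewrite ltr_pdivlMr// in e00; rewrite ltr_pdivlMr// in eL.
  exact: le_bump_error (ip_ge0 _ _) (ip_ge0 _ _) (sqr_ge0 _) (sqr_ge0 _) e00 eL ew.
set r := e / C in eX eY.
have rC : C * r = e by rewrite /r mulrC divfK// gt_eqF.
have L2 := sqr_ge0 L.
have X0 : 0 <= X := ip_ge0 _ _; have Y0 : 0 <= Y := ip_ge0 _ _.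
have l2 : 0 <= 4 * L ^+ 2 by rewrite mulr_ge0.
have b2' : ip L (fun x => pw1 p x + -1 * w1 x) (fun x => pw1 p x + -1 * w1 x) <= 4 * L ^+ 2 * Y := b2.
have b1' : ip L (fun x => pw p x + -1 * w x) (fun x => pw p x + -1 * w x) <= 4 * L ^+ 2 * (4 * L ^+ 2 * Y).
  by apply: (le_trans b1); rewrite ler_wpM2l.
have b3' : ip L (fun x => pv p x + -1 * v x) (fun x => pv p x + -1 * v x) <= 4 * L ^+ 2 * X := b3.
have b4' : (pv p L + -1 * v L) ^+ 2 <= L * X := b4.
have k1 : (1 + 4 * L ^+ 2 + 4 * L ^+ 2 * (4 * L ^+ 2)) * Y <= (1 + 4 * L ^+ 2 + 4 * L ^+ 2 * (4 * L ^+ 2)) * (9 * r).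
  by rewrite ler_wpM2l// !addr_ge0// mulr_ge0.
have k2 : (1 + 4 * L ^+ 2 + L) * X < (1 + 4 * L ^+ 2 + L) * r.
  by rewrite ltr_pM2l//; rewrite addr_gt0// ltr_wpDr.
by rewrite -rC /C; exact: lt_density_sum b1' b2' b3' b4' k1 k2.
Qed.

End RealDensity.

(** * Decay of a semigroup with a dissipative quadratic form *)

Section QuadraticForms.
Variables (R : realType) (V : lmodType R) (H : V -> Prop).
Hypothesis H_lin : forall s x y, H x -> H y -> H (x + s *: y).
Implicit Types (x y z : V) (s t : R) (Q : V -> R).

Definition polar Q x y : R := Q (x + y) - Q x - Q y.
(** The expansion is asked on the subspace [H] only, since [Q] carries no information about states
    outside it. *)
Definition quadratic Q : Prop := forall s x y, H x -> H y ->
  Q (x + s *: y) = Q x + s * polar Q x y + s ^+ 2 * Q y.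

(** Cauchy-Schwarz by minimising the expansion over [s]. If [Q y = 0] the expansion is affine in
    [s], and staying nonnegative forces the polar term to vanish. *)
Lemma polar_sqr_le Q x y : quadratic Q -> (forall z, H z -> 0 <= Q z) -> H x -> H y ->
  polar Q x y ^+ 2 <= 4 * (Q x * Q y).
Proof.
move=> qQ Q0 hx hy; set B := polar Q x y.
have pos s : 0 <= Q x + s * B + s ^+ 2 * Q y by rewrite -qQ//; apply/Q0/H_lin.
have [y0|yn0] := eqVneq (Q y) 0.
  have [->|Bn0] := eqVneq B 0; first by rewrite y0 expr0n !mulr0.
  have := pos (- (Q x + 1) / B); rewrite y0 mulr0 addr0 divfK//; lra.
have yp : 0 < Q y by rewrite lt_neqAle eq_sym yn0 Q0.
have := pos (- B / (2 * Q y)).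
have -> : Q x + - B / (2 * Q y) * B + (- B / (2 * Q y)) ^+ 2 * Q y = (4 * (Q x * Q y) - B ^+ 2) / (4 * Q y) by field.
by rewrite pmulr_lge0 ?invr_gt0 ?mulr_gt0// subr_ge0.
Qed.

Lemma polar_le Q x y : quadratic Q -> (forall z, H z -> 0 <= Q z) -> H x -> H y ->
  `|polar Q x y| <= 2 * (Num.sqrt (Q x) * Num.sqrt (Q y)).
Proof.
move=> qQ Q0 hx hy; rewrite -sqrtrM ?Q0// -sqrtr_sqr.
have -> : 2 * Num.sqrt (Q x * Q y) = Num.sqrt (4 * (Q x * Q y)).
  have <- : Num.sqrt (2 ^+ 2 * (Q x * Q y)) = 2 * Num.sqrt (Q x * Q y).
    by rewrite sqrtrM ?sqr_ge0// sqrtr_sqr ger0_norm.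
  by congr Num.sqrt; ring.
by rewrite ler_wsqrtr// polar_sqr_le.
Qed.

Lemma quadratic0 Q : H 0 -> quadratic Q -> Q 0 = 0.
Proof.
move=> h0 qQ; have := qQ 2 0 0 h0 h0; rewrite /polar scaler0 addr0; lra.
Qed.

Lemma quadraticZ Q s x : H 0 -> quadratic Q -> H x -> Q (s *: x) = s ^+ 2 * Q x.
Proof.
move=> h0 qQ hx; have := qQ s 0 x h0 hx; rewrite /polar !add0r (quadratic0 h0 qQ); lra.
Qed.

Lemma sqrt_triangle Q x y : quadratic Q -> (forall z, H z -> 0 <= Q z) -> H x -> H y ->
  Num.sqrt (Q (x + y)) <= Num.sqrt (Q x) + Num.sqrt (Q y).
Proof.
move=> qQ Q0 hx hy.
have s0 : 0 <= Num.sqrt (Q x) + Num.sqrt (Q y) by rewrite addr_ge0 ?sqrtr_ge0.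
rewrite -[leRHS](ger0_norm s0) -sqrtr_sqr ler_wsqrtr//.
rewrite sqrrD !sqr_sqrtr ?Q0//.
have := polar_le qQ Q0 hx hy; have := ler_norm (polar Q x y); rewrite /polar.
move: (Num.sqrt _ * _) => r; rewrite -mulr_natl; lra.
Qed.

End QuadraticForms.

(** * A category argument for the operator bounds *)

Section LeftAccumulation.
Variable R : realType.

(* Baire: otherwise every sublevel set of [C] would be nowhere dense in [0, t]. *)
Lemma left_accumulation (t : R) (C : R -> R) : 0 < t ->
  exists n p, 0 < p <= t /\ forall d : R, 0 < d -> exists2 u, 0 < u & p - d < u < p /\ C u <= n.
Proof.
move=> t0; apply: contrapT => hn.
pose S (n : nat) := [set u : R | 0 < u < t /\ C u <= n%:R].
pose F (n : nat) : set R^o := (~` S n)°.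
have noacc n p : 0 < p <= t -> exists2 d, 0 < d & forall u, p - d < u < p -> ~ S n u.
  move=> pt; apply: contrapT => hd; apply: hn; exists n%:R, p; split => // d d0.
  apply: contrapT => hu; apply: hd; exists d => // u ud [/andP[u0 ut] Cu].
  by apply: hu; exists u.
have oF n : open (F n) /\ dense (F n).
  split; first exact: open_interior.
  move=> U [p Up] oU.
  (* If [U] misses []0, t]] it misses [S n] altogether; otherwise a point slightly to the left of
     [q] has a neighbourhood free of [S n]. *)
  have [pt|pt] := pselect (exists2 q, U q & 0 < q <= t); last first.
    exists p; split => //; apply: (@filterS _ _ _ U); last exact: open_nbhs_nbhs.
    move=> q Uq [/andP[q0 qt] _]; apply: pt; exists q => //.
    by rewrite q0 ltW.
  have [q Uq qt] := pt; have [d d0 hd] := noacc n q qt.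
  have /nbhs_ballP[e /= e0 he] : nbhs q U by apply: open_nbhs_nbhs.
  pose m := Num.min d e.
  have m0 : 0 < m by rewrite lt_min d0.
  have md : m <= d by rewrite ge_min lexx.
  have me : m <= e by rewrite ge_min lexx orbT.
  pose v := q - m / 2.
  exists v; split.
    apply: he; rewrite /ball/= /v opprB addrCA subrr addr0 ger0_norm ?divr_ge0 ?ltW//.
    by lra.
  apply/nbhs_ballP; exists (m / 2) => /=; first by rewrite divr_gt0.
  move=> u; rewrite /ball/= /v ltr_norml => /andP[u1 u2]; apply: hd.
  apply/andP; split; lra.
have [u [/= ut Fu]] : (`]0, t[ `&` \bigcap_n (F n)) !=set0.
  apply: (Baire oF); last exact: interval_open.
  by exists (t / 2) => /=; rewrite in_itv/= divr_gt0//= ltr_pdivrMr// ltr_pMr// ltr1n.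
rewrite in_itv/= in ut.
have := Fu (Num.bound `|C u|) Logic.I => /interior_subset; apply; split => //.
by apply: (le_trans (ler_norm _)); apply/ltW/archi_boundP.
Qed.

End LeftAccumulation.

(** * From infinitesimal dissipation to exponential decay *)

Section SemigroupDecay.
Variables (R : realType) (V : lmodType R) (H D : V -> Prop) (A : V -> V) (T : R -> V -> V)
  (N W : V -> R) (C1 C2 om : R).
Implicit Types (x y z : V) (s t h e d : R).
Local Notation nrm x := (Num.sqrt (N x)).
Hypotheses (H0 : H 0) (H_lin : forall s x y, H x -> H y -> H (x + s *: y)).
Hypotheses (N_quad : quadratic H N) (N_ge0 : forall x, H x -> 0 <= N x)
  (W_quad : quadratic H W) (C1_gt0 : 0 < C1) (C2_gt0 : 0 < C2)
  (N_le : forall x, H x -> N x <= C1 * W x) (W_le : forall x, H x -> W x <= C2 * N x).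
Hypotheses (T_H : forall t x, 0 <= t -> H x -> H (T t x))
  (T_lin : forall t s x y, 0 <= t -> H x -> H y -> T t (x + s *: y) = T t x + s *: T t y)
  (T_bound : forall t, 0 <= t -> exists C, forall x, H x -> nrm (T t x) <= C * nrm x)
  (T_id : forall x, H x -> T 0 x = x)
  (T_add : forall t s x, 0 <= t -> 0 <= s -> H x -> T (t + s) x = T t (T s x))
  (T_cont : forall x, H x -> forall e, 0 < e -> exists2 d, 0 < d &
     forall t, 0 <= t < d -> nrm (T t x - x) < e).
Definition right_derivative x y : Prop := forall e, 0 < e -> exists2 d, 0 < d &
  forall h, 0 < h < d -> nrm (h^-1 *: (T h x - x) - y) < e.
Hypotheses (D_H : forall x, D x -> H x) (A_H : forall x, D x -> H (A x))
  (D_diff : forall x, D x -> right_derivative x (A x))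
  (diff_D : forall x y, H x -> H y -> right_derivative x y -> D x)
  (om_gt0 : 0 < om)
  (dissipative : forall x, D x -> polar W x (A x) <= - om * W x)
  (D_dense : forall x, H x -> forall e, 0 < e -> exists2 y, D y & nrm (x - y) < e).

Lemma H_sub x y : H x -> H y -> H (x - y).
Proof. by move=> hx hy; rewrite -scaleN1r; apply: H_lin. Qed.

Lemma H_scale s x : H x -> H (s *: x).
Proof. by move=> hx; rewrite -[s *: x]add0r; apply: H_lin. Qed.

Lemma W_ge0 x : H x -> 0 <= W x.
Proof. by move=> hx; rewrite -(pmulr_rge0 _ C1_gt0); apply: le_trans (N_le hx); exact: N_ge0. Qed.

Lemma T_sub t x y : 0 <= t -> H x -> H y -> T t (x - y) = T t x - T t y.
Proof. by move=> t0 hx hy; rewrite -scaleN1r T_lin// scaleN1r. Qed.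

Lemma T_scale t s x : 0 <= t -> H x -> T t (s *: x) = s *: T t x.
Proof.
move=> t0 hx; have T0 : T t 0 = 0 by rewrite -{1}(subrr x) T_sub// subrr.
by rewrite -[s *: x]add0r T_lin// T0 add0r.
Qed.

Lemma nrm_triangle x y : H x -> H y -> nrm (x + y) <= nrm x + nrm y.
Proof. exact: sqrt_triangle. Qed.

Lemma N_subC x y : H x -> H y -> N (x - y) = N (y - x).
Proof.
move=> hx hy; have -> : x - y = -1 *: (y - x) by rewrite scaleN1r opprB.
rewrite (quadraticZ _ H0 N_quad (H_sub hy hx)).
by rewrite sqrrN expr1n mul1r.
Qed.

(* Writes [T t x - T s x] as [T r (T u (T (p - u) x - x))] with [r = t - p] fixed and [u] in a
   sequence along which the operator norms stay bounded. *)
Lemma orbit_left t x e : 0 < t -> H x -> 0 < e ->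
  exists2 s, 0 <= s < t & t - s < e /\ nrm (T t x - T s x) < e.
Proof.
move=> t0 hx e0.
have [C hC] : exists C : R -> R, forall r, 0 <= r -> forall y, H y -> nrm (T r y) <= C r * nrm y.
  have /choice[C hC] : forall r, exists C, 0 <= r -> forall y, H y -> nrm (T r y) <= C * nrm y.
    move=> r; have [r0|_] := boolP (0 <= r); last by exists 0.
    by have [c hc] := T_bound r0; exists c.
  by exists C.
have [n [p [/andP[p0 pt] hp]]] := left_accumulation C t0.
pose r := t - p; have r0 : 0 <= r by rewrite subr_ge0.
pose M := `|C r| * `|n| + 1.
have M0 : 0 < M by rewrite ltr_wpDl// mulr_ge0.
have [d d0 hd] := T_cont hx (divr_gt0 e0 M0).
have [u u0 [/andP[pu up] Cu]] := hp (Num.min d e) (ltac:(by rewrite lt_min d0)).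
have pud : p - u < d by move: pu; rewrite ltrBlDr -ltrBlDl => /lt_le_trans; apply; rewrite ge_min lexx.
have pue : p - u < e by move: pu; rewrite ltrBlDr -ltrBlDl => /lt_le_trans; apply; rewrite ge_min lexx orbT.
have pu0 : 0 <= p - u by rewrite subr_ge0 ltW.
exists (r + u); first by rewrite addr_ge0 ?(ltW u0)//= /r; lra.
split; first by rewrite /r; lra.
have -> : T t x = T r (T u (T (p - u) x)).
  have up0 : 0 <= u + (p - u) by rewrite subrKC ltW.
  rewrite -(T_add (ltW u0) pu0 hx) -(T_add r0 up0 hx).
  by congr (T _ _); rewrite /r; ring.
have hpu : H (T (p - u) x) by exact: T_H.
rewrite (T_add r0 (ltW u0) hx) -(T_sub r0 (T_H (ltW u0) hpu) (T_H (ltW u0) hx)).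
rewrite -(T_sub (ltW u0) hpu hx).
have hs : H (T (p - u) x - x) by exact: H_sub.
set y := T (p - u) x - x in hs *.
have h1 := hC r r0 _ (T_H (ltW u0) hs).
have h2 := hC u (ltW u0) _ hs.
have y0 : 0 <= nrm y := sqrtr_ge0 _.
have h3 : nrm (T u y) <= `|n| * nrm y.
  by apply: (le_trans h2); rewrite ler_wpM2r// (le_trans Cu)// ler_norm.
apply: (le_lt_trans h1); apply: (@le_lt_trans _ _ (`|C r| * (`|n| * nrm y))).
  apply: (@le_trans _ _ (`|C r| * nrm (T u y))); last by rewrite ler_wpM2l.
  by rewrite ler_wpM2r ?sqrtr_ge0// ler_norm.
have := hd (p - u); rewrite pu0 pud => /(_ isT); rewrite -/y ltr_pdivlMr// => h.
apply: le_lt_trans h; rewrite mulrA mulrC ler_wpM2l// /M lerDl//.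
Qed.

(** [T t] maps the difference quotients at [x] to those at [T t x], so the latter converge to
    [T t (A x)]; membership in [D] then follows from the converse half of the generator's
    characterisation. *)
Lemma T_D t x : 0 <= t -> D x -> D (T t x).
Proof.
move=> t0 dx; have hx := D_H dx; have hA := A_H dx.
have [C hC] := T_bound t0.
apply: (@diff_D _ (T t (A x))); [exact: T_H|exact: T_H|move=> e e0].
have M0 : 0 < `|C| + 1 by rewrite ltr_wpDl.
have [d d0 hd] := D_diff dx (divr_gt0 e0 M0).
exists d => // h /andP[h0 hlt].
have hTh : H (T h x) by apply: T_H => //; exact: ltW.
have hs := H_sub hTh hx; have hsc := H_scale h^-1 hs.
have -> : T h (T t x) = T t (T h x) by rewrite -!T_add ?(ltW h0)// addrC.
rewrite -T_sub// -T_scale// -T_sub//.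
apply: (le_lt_trans (hC _ (H_sub hsc hA))).
have := hd h; rewrite h0 hlt => /(_ isT); rewrite ltr_pdivlMr// => hh.
apply: le_lt_trans hh; rewrite mulrC ler_wpM2l ?sqrtr_ge0//.
by rewrite (le_trans (ler_norm C))// lerDl.
Qed.

Lemma sqrtW_le x : H x -> Num.sqrt (W x) <= Num.sqrt C2 * nrm x.
Proof.
by move=> hx; rewrite -sqrtrM ?(ltW C2_gt0)// ler_wsqrtr// W_le.
Qed.

(** [T h z] is [z + h A z + h r] with [r] small. Expanding [W] leaves, beyond the dissipative term,
    a polar term against [r] and terms in h^2, each at most (e / 3) h. *)
Lemma W_right z e : D z -> 0 < e -> exists2 d, 0 < d &
  forall h, 0 < h < d -> W (T h z) <= (1 - om * h) * W z + e * h.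
Proof.
move=> dz e0; have hz := D_H dz; have hA := A_H dz.
set y := A z in hA; set B := polar W z y.
(* Bounds the square root of [W (z + h *: y)] for all h < 1, so that [eta] can be chosen before
   [h]. *)
pose M := Num.sqrt (W z + `|B| + W y).
have Wz := W_ge0 hz; have Wy := W_ge0 hA.
pose eta := e / (3 * (2 * (M * Num.sqrt C2) + 1)).
have sC : 0 <= Num.sqrt C2 := sqrtr_ge0 _.
have M0 : 0 <= M := sqrtr_ge0 _.
have MC : 0 <= M * Num.sqrt C2 by rewrite mulr_ge0.
have eta0 : 0 < eta by rewrite divr_gt0// mulr_gt0// ltr_wpDl// mulr_ge0.
have [d d0 hd] := D_diff dz eta0.
pose K := W y + C2 * eta ^+ 2 + 1.
have K0 : 0 < K by rewrite ltr_wpDl// addr_ge0// mulr_ge0 ?sqr_ge0// ltW.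
pose d' := Num.min (Num.min d 1) (e / (3 * K)).
exists d'; first by rewrite !lt_min d0 ltr01/= divr_gt0// mulr_gt0.
move=> h /andP[h0]; rewrite !lt_min => /andP[/andP[hd1 h1] hK].
have hTh : H (T h z) by apply: T_H => //; exact: ltW.
pose r := h^-1 *: (T h z - z) - y.
have hr : H r by apply: H_sub => //; apply: H_scale; exact: H_sub.
have nr : nrm r < eta by apply: hd; rewrite h0.
have E : T h z = (z + h *: y) + h *: r.
  rewrite /r scalerBr scalerA divff ?gt_eqF// scale1r.
  by rewrite addrAC -addrA subrK addrC subrK.
have hzy : H (z + h *: y) by exact: H_lin.
rewrite E (W_quad h hzy hr).
have Ezy := W_quad h hz hA; rewrite -/B in Ezy.
have h2 : h ^+ 2 <= h by rewrite expr2 ger_pMl// ltW.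
have hz1 : W (z + h *: y) <= M ^+ 2.
  rewrite Ezy sqr_sqrtr ?addr_ge0//.
  apply: lerD; first (apply: lerD => //).
    apply: le_trans (ler_norm _) _; by rewrite normrM (gtr0_norm h0) ler_piMl// ltW.
  by rewrite ler_piMl//; exact: le_trans h2 (ltW h1).
have rB : polar W (z + h *: y) r <= e / 3.
  apply: (le_trans (ler_norm _)); apply: (le_trans (polar_le H_lin W_quad W_ge0 hzy hr)).
  have s1 : Num.sqrt (W (z + h *: y)) <= M by rewrite -[M]ger0_norm// -sqrtr_sqr ler_wsqrtr.
  have s2 : Num.sqrt (W r) <= Num.sqrt C2 * eta.
    by apply: (le_trans (sqrtW_le hr)); rewrite ler_wpM2l// ltW.
  have s3 := ler_pM (sqrtr_ge0 _) (sqrtr_ge0 _) s1 s2.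
  have s4 : 3 * (2 * (M * Num.sqrt C2) + 1) * eta = e.
    by rewrite /eta mulrC divfK// gt_eqF// mulr_gt0// ltr_wpDl// mulr_ge0.
  rewrite mulrA in s3; lra.
have h2K : h ^+ 2 * (W y + W r) <= h * (e / 3).
  rewrite expr2 -mulrA ler_wpM2l ?(ltW h0)//.
  apply: (@le_trans _ _ (h * K)); last by move: hK; rewrite ltr_pdivlMr ?mulr_gt0//; lra.
  rewrite ler_wpM2l ?(ltW h0)// /K.
  have : W r <= C2 * eta ^+ 2.
    apply: (le_trans (W_le hr)); rewrite ler_wpM2l ?(ltW C2_gt0)//.
    by rewrite -(sqr_sqrtr (N_ge0 hr)) lerXn2r ?nnegrE ?sqrtr_ge0// ltW.
  lra.
have := ler_wpM2l (ltW h0) rB; have := ler_wpM2l (ltW h0) (dissipative dz).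
have := mulr_ge0 (ltW e0) (ltW h0); rewrite -/y -/B Ezy; lra.
Qed.

(** Gronwall's argument in the form of [dini_le] for exp(om s) W(T s x): [W_right] supplies the
    increments to the right, [orbit_left] the condition from the left. *)
Lemma W_decay t x : 0 <= t -> D x -> W (T t x) <= expR (- (om * t)) * W x.
Proof.
move=> t0 dx; have hx := D_H dx.
suff main : expR (om * t) * W (T t x) <= W x.
  by rewrite expRN mulrC ler_pdivlMr ?expR_gt0// mulrC.
apply/ler_addgt0Pr => e1 e10.
pose e := e1 / (t + 1).
have t10 : 0 < t + 1 by rewrite ltr_wpDl.
have e0 : 0 < e by rewrite divr_gt0.
have := @dini_le R t e (fun s => expR (om * s) * W (T s x)) id t0 (ltW e0).
rewrite mulr0 expR0 mul1r T_id// subr0 => H1; apply: (le_trans (H1 _ _ _)).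
- by move=> s r /andP[].
- move=> s /andP[s0 st].
  have ds := T_D s0 dx; have hs := D_H ds.
  (* The factor compensates exp(om r) <= exp(om t), by which the error is multiplied later. *)
  have ee0 : 0 < e * expR (- (om * t)) by rewrite mulr_gt0 ?expR_gt0.
  have [d d0 hd] := W_right ds ee0.
  exists d => // r /andP[sr rd] rt.
  pose h := r - s; have h0 : 0 < h by rewrite subr_gt0.
  have := hd h; rewrite h0 ltrBlDl rd => /(_ isT).
  rewrite -T_add ?(ltW h0)// /h subrK -/h => hle.
  have W0 : 0 <= W (T s x) := W_ge0 hs.
  have er : expR (om * r) = expR (om * s) * expR (om * h).
    by rewrite -expRD; congr expR; rewrite /h; ring.
  have h1 : expR (om * h) * (1 - om * h) <= 1.
    have := expR_ge1Dx (- (om * h)) => i.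
    have := ler_wpM2l (ltW (expR_gt0 (om * h))) i.
    by rewrite -expRD subrr expR0.
  have := ler_wpM2l (ltW (expR_gt0 (om * r))) hle.
  have h2 : expR (om * r) * ((1 - om * h) * W (T s x)) <= expR (om * s) * W (T s x).
    rewrite er -mulrA ler_wpM2l ?(ltW (expR_gt0 _))// mulrA -[leRHS]mul1r.
    by rewrite ler_wpM2r.
  have h3 : expR (om * r) * (e * expR (- (om * t)) * h) <= e * h.
    have -> : expR (om * r) * (e * expR (- (om * t)) * h) = expR (om * r + - (om * t)) * (e * h).
      by rewrite expRD; ring.
    apply: ler_piMl; first by rewrite mulr_ge0// ltW.
    by rewrite -[leRHS]expR0 ler_expR subr_le0 ler_pM2l.
  rewrite mulrDr; lra.
- move=> s /andP[s0 st] r r0.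
  have hs := T_H (ltW s0) hx; set z := T s x in hs *.
  have Wz := W_ge0 hs; have sC : 0 <= Num.sqrt C2 := sqrtr_ge0 _.
  (* Going back from [s] to [u], time and state change by less than [r / q], and [q - 1] bounds the
     resulting drop per unit. The quadratic term [W (T u x - z)] has the favourable sign. *)
  pose q := expR (om * s) * (2 * (Num.sqrt (W z) * Num.sqrt C2) + om * W z) + 1.
  have E0 := ltW (expR_gt0 (om * s)).
  have q0 : 0 < q.
    by rewrite ltr_wpDl// mulr_ge0// addr_ge0 ?mulr_ge0 ?sqrtr_ge0// ltW.
  have [u /andP[u0 us] [eta_x nu]] := orbit_left s0 hx (divr_gt0 r0 q0).
  exists u; first by rewrite u0.
  have hu := T_H u0 hx; have hr : H (T u x - z) := H_sub hu hs.
  have Wr := W_ge0 hr.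
  have hle : W z - W (T u x) <= 2 * (Num.sqrt (W z) * Num.sqrt C2) * (r / q).
    have -> : T u x = z + 1 *: (T u x - z) by rewrite scale1r addrC subrK.
    rewrite (W_quad 1 hs hr).
    have := polar_le H_lin W_quad W_ge0 hs hr.
    have := ler_norm (- polar W z (T u x - z)); rewrite normrN.
    have nn : nrm (T u x - z) < r / q.
      by rewrite N_subC.
    have := sqrtW_le hr => i.
    have := ler_wpM2l sC (ltW nn) => j; have := ler_wpM2l (sqrtr_ge0 (W z)) (le_trans i j).
    rewrite expr1n !mul1r mulrA; lra.
  have expd : expR (om * s) - expR (om * u) <= expR (om * s) * (om * (r / q)).
    have := expR_ge1Dx (- (om * (s - u))) => i.
    have := ler_wpM2l E0 i; rewrite -expRD.
    have -> : om * s + - (om * (s - u)) = om * u by ring.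
    have := ler_wpM2l E0 (ler_wpM2l (ltW om_gt0) (ltW eta_x)); lra.
  have f1 := ler_wpM2r Wz expd.
  have f2 : expR (om * u) * (W z - W (T u x)) <= expR (om * s) * (2 * (Num.sqrt (W z) * Num.sqrt C2) * (r / q)).
    apply: (@le_trans _ _ (expR (om * u) * (2 * (Num.sqrt (W z) * Num.sqrt C2) * (r / q)))).
      by rewrite ler_wpM2l// ltW// expR_gt0.
    rewrite ler_wpM2r// ?ler_expR ?ler_pM2l// ?(ltW us)//.
    have rq := ltW (divr_gt0 r0 q0).
    by apply: mulr_ge0 => //; rewrite !mulr_ge0 ?sqrtr_ge0.
  have qr : q * (r / q) = r by rewrite mulrC divfK// gt_eqF.
  have rq0 : 0 < r / q by rewrite divr_gt0.
  have : (q - 1) * (r / q) <= r by rewrite mulrBl qr mul1r lerBlDr lerDl ltW.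
  rewrite /q addrK; lra.
- rewrite lerD2l /e mulrAC ler_pdivrMr// ler_wpM2l ?(ltW e10)// lerDl//.
Qed.

Lemma semigroup_decay : exists M omega : R, 1 <= M /\ 0 < omega /\
  forall t x, 0 <= t -> H x -> nrm (T t x) <= M * expR (- (omega * t)) * nrm x.
Proof.
pose M0 := Num.sqrt (C1 * C2); pose M := Num.max 1 M0.
(* [W] is comparable to the squared norm, so its rate is halved. *)
exists M, (om / 2); split; first by rewrite /M le_max lexx.
split; first by rewrite divr_gt0.
move=> t x t0 hx; set E := expR _.
have E0 : 0 < E := expR_gt0 _.
have M1 : 0 <= M by apply: le_trans (_ : 0 <= 1) _ => //; rewrite /M le_max lexx.
have onD y : D y -> nrm (T t y) <= M * E * nrm y.
  move=> dy; have hy := D_H dy; have hTy := T_H t0 hy.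
  apply: (@le_trans _ _ (Num.sqrt (C1 * C2 * E ^+ 2 * N y))).
    rewrite ler_wsqrtr//; apply: (le_trans (N_le hTy)).
    have d := W_decay t0 dy.
    have energy : expR (- (om * t)) = E ^+ 2 by rewrite /E expr2 -expRD; congr expR; field.
    rewrite energy in d.
    have := ler_wpM2l (ltW C1_gt0) (le_trans d (ler_wpM2l (sqr_ge0 E) (W_le hy))); lra.
  have C120 : 0 <= C1 * C2 by rewrite mulr_ge0// ltW.
  have CE0 := mulr_ge0 C120 (sqr_ge0 E).
  rewrite (sqrtrM _ CE0) (sqrtrM _ C120) sqrtr_sqr (ger0_norm (ltW E0)).
  rewrite ler_wpM2r ?sqrtr_ge0// ler_wpM2r ?(ltW E0)//.
  by rewrite /M le_max lexx orbT.
(* The bound may depend on [t]: the density error tends to 0 at fixed [t], and [C] leaves no trace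
   in the final constants. *)
have [C hC] := T_bound t0.
have ME : 0 <= M * E by rewrite mulr_ge0// ltW.
apply/ler_addgt0Pr => e e0.
pose q := M * E + `|C| + 1.
have q0 : 0 < q by rewrite ltr_wpDl// addr_ge0.
have [y dy hy] := D_dense hx (divr_gt0 e0 q0).
have Hy := D_H dy; have hxy := H_sub hx Hy.
have n1 : nrm (T t x) <= nrm (T t y) + nrm (T t (x - y)).
  have -> : T t x = T t y + T t (x - y) by rewrite T_sub// addrC subrK.
  by apply: nrm_triangle; apply: T_H.
have n2 : nrm y <= nrm x + nrm (x - y).
  rewrite N_subC//.
  have {1}-> : y = x + (y - x) by rewrite addrC subrK.
  by apply: nrm_triangle => //; apply: H_sub.
have n3 := onD y dy; have n4 := hC _ hxy.
have n5 := ler_wpM2l ME n2.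
have n6 : C * nrm (x - y) <= `|C| * nrm (x - y) by rewrite ler_wpM2r ?sqrtr_ge0// ler_norm.
have n7 : q * nrm (x - y) <= e by rewrite mulrC -ler_pdivlMr// ltW.
have n8 : 0 <= nrm (x - y) := sqrtr_ge0 _.
rewrite /q in n7; lra.
Qed.

End SemigroupDecay.

(** * Complex states as pairs of jets *)

Section States.
Variables (R : realType) (L : R).
Hypothesis L_gt0 : 0 < L.
Local Open Scope complex_scope.
Implicit Types (f g h F G : R -> R) (x y t s e : R) (p q : jet R).
Notation mu := (@lebesgue_measure R).

(** The carrier of [St] as a vector space over the reals, the field over which the Lyapunov form is
    quadratic. *)
Definition rstate : lmodType R :=
  ((R -> Rcomplex R) * (R -> Rcomplex R) * Rcomplex R * Rcomplex R)%type.

Lemma addSE (x y : St R) : addS x y = (x : rstate) + (y : rstate).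
Proof. by case: x => -[[w v] a] b; case: y => -[[w' v'] a'] b'. Qed.

Lemma scaleSE s (x : St R) : scaleS s%:C x = s *: (x : rstate).
Proof.
have E (z : R[i]) : s%:C * z = s *: (z : Rcomplex R).
  by case: z => z1 z2; rewrite /GRing.scale /=; simpc.
case: x => -[[w v] a] b; rewrite /scaleS.
by congr (_, _, _, _) => //; apply/funext => z; exact: E.
Qed.

Lemma subSE (x y : St R) : subS x y = (x : rstate) - (y : rstate).
Proof.
rewrite /subS addSE (_ : -1 = (-1)%:C) ?scaleSE ?scaleN1r//.
by apply/eqP; rewrite eq_complex /= oppr0 !eqxx.
Qed.

(** The zero extension is the normal form demanded by [H1c]; functions agreeing on [[0, L]] thereby
    become equal. *)
Definition cfun f g : R -> R[i] := fun x => if 0 <= x <= L then Complex (f x) (g x) else 0.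

Let r0L : 0 <= (0 : R) <= L. Proof. by rewrite lexx ltW. Qed.
Let rLL : 0 <= L <= L. Proof. by rewrite lexx ltW. Qed.

Lemma cfun_Re f g x : 0 <= x <= L -> complex.Re (cfun f g x) = f x.
Proof. by rewrite /cfun => ->. Qed.

Lemma cfun_Im f g x : 0 <= x <= L -> complex.Im (cfun f g x) = g x.
Proof. by rewrite /cfun => ->. Qed.

Lemma dI_out f x : ~ (0 <= x <= L) -> dI L f x = 0.
Proof.
move=> xL; rewrite /dI; case: ifP => [/andP[x0 xl]|_]; first by case: xL; rewrite !ltW.
case: eqP => [x0|_]; first by case: xL; rewrite x0.
by case: eqP => // xl; case: xL; rewrite xl.
Qed.

Lemma isH1_Re f g F : isH1 L f F -> isH1 L (fun x => complex.Re (cfun f g x)) F.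
Proof. by move=> /(isH1_ext L_gt0); apply => // x xL; rewrite cfun_Re. Qed.

Lemma isH1_Im f g G : isH1 L g G -> isH1 L (fun x => complex.Im (cfun f g x)) G.
Proof. by move=> /(isH1_ext L_gt0); apply => // x xL; rewrite cfun_Im. Qed.

Lemma H1c_cfun f F g G : isH1 L f F -> isH1 L g G -> H1c L (cfun f g).
Proof.
move=> Hf Hg; split; first by move=> x xL; rewrite /cfun; case: ifP.
by split; [have [] := isH1_Re g Hf; exists F|have [] := isH1_Im f Hg; exists G].
Qed.

Lemma H1cP (f : R -> R[i]) : H1c L f -> exists F G,
  [/\ isH1 L (fun x => complex.Re (f x)) F, isH1 L (fun x => complex.Im (f x)) G
    & f = cfun (fun x => complex.Re (f x)) (fun x => complex.Im (f x))].
Proof.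
move=> [f0 [[F [hF HF]] [G [hG HG]]]]; exists F, G; split; [by split|by split|].
apply/funext => x; rewrite /cfun; case: ifP => [_|/negP xL]; first by case: (f x).
exact: f0.
Qed.

Lemma cdI_cfun f F g G : isH1 L f F -> isH1 L g G ->
  {within `[0, L], continuous F} -> {within `[0, L], continuous G} ->
  cdI L (cfun f g) = cfun F G.
Proof.
move=> Hf Hg cF cG; apply/funext => x; rewrite /cdI /cfun; case: ifP => [xL|/negP xL].
  by rewrite (dI_cont L_gt0 (isH1_Re g Hf) cF)// (dI_cont L_gt0 (isH1_Im f Hg) cG).
by rewrite !dI_out.
Qed.

(** Once [dI L f] is square integrable it may replace the weak derivative, the two being equal
    almost everywhere. This turns the nested [dI] of the state space into the entries of a jet. *)
Lemma isH1_dI f F G : isH1 L f F -> isH1 L (dI L f) G -> isH1 L f (dI L f).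
Proof.
move=> Hf HG; have hd := isH1_L2f L_gt0 HG; split => // x xL.
rewrite (Hf.2 x xL); congr (_ + _); case/andP: xL => x0 xL.
have [->|xn0] := eqVneq x 0; first by rewrite !int0_0.
apply: ae_eq_int0; [exact: integrable0L_sub xL (isH1_L2 Hf).1|exact: integrable0L_sub xL hd.1|].
have := dI_ae Hf; apply: negligibleS => y /= hy hd'; apply: hy => /andP[y0 yx].
by rewrite hd'// y0 (le_trans yx).
Qed.

Definition state_of p q : St R := (cfun (pw p) (pw q), cfun (pv p) (pv q), cfun (pv p) (pv q) L, cfun (pv p) (pv q) 0).

Lemma inH_state_of p q : admissible L p -> admissible L q -> inH L (state_of p q).
Proof.
move=> [p1 p2 p3] [q1 q2 q3]; split; last by split => //; exact: H1c_cfun p3 q3.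
split; first exact: H1c_cfun p1 q1.
rewrite (cdI_cfun p1 q1); [exact: H1c_cfun p2 q2|exact: isH1_cont p2|exact: isH1_cont q2].
Qed.

Lemma inH_P (x : St R) : inH L x -> exists p q, [/\ admissible L p, admissible L q & x = state_of p q].
Proof.
case: x => -[[w v] a] b [[Hw Hw1] [Hv [-> ->]]].
have [F [G [hF hG ew]]] := H1cP Hw.
have [F1 [G1 [hF1 hG1 _]]] := H1cP Hw1.
have [Fv [Gv [hFv hGv ev]]] := H1cP Hv.
exists (Jet (fun x => complex.Re (w x)) (dI L (fun x => complex.Re (w x))) F1 (fun x => complex.Re (v x)) Fv).
exists (Jet (fun x => complex.Im (w x)) (dI L (fun x => complex.Im (w x))) G1 (fun x => complex.Im (v x)) Gv).
split; [split => //; exact: isH1_dI hF hF1|split => //; exact: isH1_dI hG hG1|].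
by rewrite /state_of /= -ew -ev.
Qed.

Lemma state_of_lin s p q p' q' : state_of (jet_lin s p p') (jet_lin s q q') = (state_of p q : rstate) + s *: (state_of p' q' : rstate).
Proof.
have E f g f' g' x : cfun (fun x => f x + s * f' x) (fun x => g x + s * g' x) x =
   (cfun f g x : Rcomplex R) + s *: (cfun f' g' x : Rcomplex R).
  by rewrite /cfun; case: ifP => _; rewrite /GRing.scale /=; simpc; rewrite ?mulr0 ?addr0.
by rewrite /state_of; congr (_, _, _, _); try exact: E; apply/funext => x; exact: E.
Qed.

Lemma l2sq_cfun f g : L2r L f -> L2r L g -> l2sq L (cfun f g) = ip L f f + ip L g g.
Proof.
move=> hf hg; rewrite /ip.
have := int0_lin 1 (L2_mul hf hf) (L2_mul hg hg); rewrite mul1r => <-.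
by apply: eq_int0 => x xL; rewrite /csq cfun_Re// cfun_Im// mul1r !expr2.
Qed.

(** Where the derivative fails to exist, [cdI] takes the default value of a limit, and its
    measurability is not at hand; hence the comparison of lower integrals. *)
Lemma l2sq_cdI_cfun f F g G : isH1 L f F -> isH1 L g G -> l2sq L (cdI L (cfun f g)) = ip L F F + ip L G G.
Proof.
move=> Hf Hg; have hF := isH1_L2 Hf; have hG := isH1_L2 Hg.
have := int0_lin 1 (L2_mul hF hF) (L2_mul hG hG); rewrite mul1r => <-.
rewrite /l2sq /int0 /Rintegral; congr fine.
apply: ge0_ae_integral_eq => //.
- apply/measurable_EFinP; apply: integrable0L_measurable.
  exact: integrable0L_lin 1 (L2_mul hF hF) (L2_mul hG hG).
- by move=> x; rewrite lee_fin addr_ge0 ?sqr_ge0.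
- by move=> x; rewrite lee_fin mul1r addr_ge0// -expr2 sqr_ge0.
have a1 := dI_ae (isH1_Re g Hf); have a2 := dI_ae (isH1_Im f Hg).
have := negligibleU a1 a2; apply: negligibleS => x /= hx; apply: contrapT => /not_orP[/contrapT h1 /contrapT h2].
apply: hx; rewrite in_itv/= => xL; congr EFin.
by rewrite /csq /cdI /= h1// h2// mul1r !expr2.
Qed.

Lemma normS_state_of p q : admissible L p -> admissible L q -> normS L (state_of p q) = Num.sqrt (norm2 L p + norm2 L q).
Proof.
move=> [p1 p2 p3] [q1 q2 q3].
have -> : norm2 L p + norm2 L q = (ip L (pw p) (pw p) + ip L (pw q) (pw q)) + (ip L (pw1 p) (pw1 p) + ip L (pw1 q) (pw1 q))
  + (ip L (pw2 p) (pw2 p) + ip L (pw2 q) (pw2 q)) + (ip L (pv p) (pv p) + ip L (pv q) (pv q))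
  + (ip L (pv1 p) (pv1 p) + ip L (pv1 q) (pv1 q)) + (pv p L ^+ 2 + pv q L ^+ 2) + (pv p 0 ^+ 2 + pv q 0 ^+ 2).
  by rewrite /norm2; ring.
have c1 := isH1_cont L_gt0 p2; have c2 := isH1_cont L_gt0 q2.
rewrite /normS /state_of; congr (Num.sqrt (_ + _ + _ + _ + _ + _ + _)).
- exact: l2sq_cfun (isH1_L2f L_gt0 p1) (isH1_L2f L_gt0 q1).
- exact: l2sq_cdI_cfun p1 q1.
- by rewrite (cdI_cfun p1 q1 c1 c2); exact: l2sq_cdI_cfun p2 q2.
- exact: l2sq_cfun (isH1_L2f L_gt0 p3) (isH1_L2f L_gt0 q3).
- exact: l2sq_cdI_cfun p3 q3.
- by rewrite /csq cfun_Re// cfun_Im.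
- by rewrite /csq cfun_Re// cfun_Im.
Qed.

End States.

(** * The operator and its domain in terms of jets *)

Section Generator.
Variables (R : realType) (L : R) (P P1 P2 : R -> R) (P0 PM a b th3 th4 : R).
Local Open Scope complex_scope.
Implicit Types (f g h F G : R -> R) (x y t s e : R) (p q : jet R).
Hypotheses (L_gt0 : 0 < L) (HP : isH1 L P P1) (HP1 : isH1 L P1 P2) (P0_gt0 : 0 < P0)
  (P_ge : forall x, 0 <= x <= L -> P0 <= P x) (P_le : forall x, 0 <= x <= L -> P x <= PM)
  (P1_le : forall x, 0 <= x <= L -> `|P1 x| <= PM)
  (b_gt0 : 0 < b) (hab : (a + b - 1) ^+ 2 < 4 * a * b) (th3_lt0 : th3 < 0) (th4_gt0 : 0 < th4).
Notation th1 := (th3 / b - a).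
Notation th2 := (th4 / b).
Notation smooth := (@smooth R L).
Notation compatible := (compatible L P P1 th1 th2 th3 th4).
Notation inDA := (inDA L P th1 th2 th3 th4).
Notation opA := (opA L P th1 th2 th3 th4).

Let r0L : 0 <= (0 : R) <= L. Proof. by rewrite lexx ltW. Qed.
Let rLL : 0 <= L <= L. Proof. by rewrite lexx ltW. Qed.

(** This is (P w')' by the product rule, the velocity component of the generator. *)
Definition stress p x := P x * pw2 p x + P1 x * pw1 p x.
(** The image jet must contain derivatives one order higher than [p] does, so weak derivatives [w3]
    of w'' and [v2] of v' are passed as data. *)
Definition generator w3 v2 p : jet R := Jet (pv p) (pv1 p) v2 (stress p)
  (fun x => P x * w3 x + pw2 p x * P1 x + 1 * (P1 x * pw2 p x + pw1 p x * P2 x)).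

Lemma isH1_stress p w3 : admissible L p -> isH1 L (pw2 p) w3 ->
  isH1 L (stress p) (fun x => P x * w3 x + pw2 p x * P1 x + 1 * (P1 x * pw2 p x + pw1 p x * P2 x)).
Proof.
move=> [p1 p2 p3] h3.
apply: (isH1_ext L_gt0 (isH1_lin 1 (isH1_mul L_gt0 HP h3) (isH1_mul L_gt0 HP1 p2))) => // x _.
by rewrite mul1r.
Qed.

Lemma admissible_generator p w3 v2 : admissible L p -> isH1 L (pw2 p) w3 -> isH1 L (pv1 p) v2 ->
  admissible L (generator w3 v2 p).
Proof. by move=> gp h3 hv; have [p1 p2 p3] := gp; split => //; exact: isH1_stress. Qed.

Lemma cdI_w p q : admissible L p -> admissible L q -> cdI L (cfun L (pw p) (pw q)) = cfun L (pw1 p) (pw1 q).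
Proof.
move=> [p1 p2 p3] [q1 q2 q3].
exact: cdI_cfun p1 q1 (isH1_cont L_gt0 p2) (isH1_cont L_gt0 q2).
Qed.

Lemma cdI_flux p q : smooth p -> smooth q ->
  cdI L (flux L P (cfun L (pw p) (pw q))) = cfun L (stress p) (stress q).
Proof.
move=> [gp [[w3 h3] _]] [gq [[z3 k3] _]].
have [p1 p2 p3] := gp; have [q1 q2 q3] := gq.
have -> : flux L P (cfun L (pw p) (pw q)) = cfun L (fun x => P x * pw1 p x) (fun x => P x * pw1 q x).
  apply/funext => x; rewrite /flux cdI_w// /cfun; case: ifP => _; last by rewrite mulr0.
  by simpc.
apply: cdI_cfun => //.
- by apply: (isH1_ext L_gt0 (isH1_mul L_gt0 HP p2)) => // x _; rewrite /stress; ring.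
- by apply: (isH1_ext L_gt0 (isH1_mul L_gt0 HP q2)) => // x _; rewrite /stress; ring.
- exact: isH1_cont (isH1_stress gp h3).
- exact: isH1_cont (isH1_stress gq k3).
Qed.

Lemma cdI_v p q : smooth p -> smooth q -> cdI L (cfun L (pv p) (pv q)) = cfun L (pv1 p) (pv1 q).
Proof.
move=> [[p1 p2 p3] [_ [v2 hv]]] [[q1 q2 q3] [_ [z2 hz]]].
exact: cdI_cfun p3 q3 (isH1_cont L_gt0 hv) (isH1_cont L_gt0 hz).
Qed.

Definition feedback p := th1 * pv p 0 + th2 * pv1 p 0 + th3 * pw p 0 + th4 * pw1 p 0.

Lemma Fbd_state_of p q : smooth p -> smooth q ->
  Fbd L th1 th2 th3 th4 (cfun L (pw p) (pw q)) (cfun L (pv p) (pv q)) = Complex (feedback p) (feedback q).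
Proof.
move=> sp sq; have [gp _] := sp; have [gq _] := sq.
rewrite /Fbd cdI_v// cdI_w// /cfun r0L /feedback.
by apply/eqP; rewrite eq_complex /=; apply/andP; split; apply/eqP; ring.
Qed.

Lemma inDA_state_of p q : smooth p -> smooth q -> compatible p -> compatible q -> inDA (state_of L p q).
Proof.
move=> sp sq [cp1 cp2] [cq1 cq2].
have [gp [[w3 h3] [v2 hv]]] := sp; have [gq [[z3 k3] [u2 hu]]] := sq.
have [p1 p2 p3] := gp; have [q1 q2 q3] := gq.
have e2 : cdI L (cfun L (pw1 p) (pw1 q)) = cfun L (pw2 p) (pw2 q).
  exact: cdI_cfun p2 q2 (isH1_cont L_gt0 h3) (isH1_cont L_gt0 k3).
rewrite /inDA /state_of (cdI_flux sp sq) (Fbd_state_of sp sq) cdI_w//.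
split.
  split; first exact: H1c_cfun p1 q1.
  rewrite cdI_w//; split; first exact: H1c_cfun p2 q2.
  by rewrite e2; exact: H1c_cfun h3 k3.
split.
  split; first exact: H1c_cfun p3 q3.
  by rewrite (cdI_v sp sq); exact: H1c_cfun hv hu.
split => //; split => //; split.
  by rewrite /cfun rLL /stress cp1 cq1.
by rewrite /cfun r0L /stress cp2 cq2.
Qed.

Lemma inDA_P (x : St R) : inDA x ->
  exists p q, [/\ smooth p, smooth q, compatible p, compatible q & x = state_of L p q].
Proof.
case: x => -[[w v] c] d [[Hw [Hw1 Hw2]] [[Hv Hv1] [-> [-> [B1 B2]]]]].
have [F [G [hF hG ew]]] := H1cP Hw.
have [F1 [G1 [hF1 hG1 _]]] := H1cP Hw1.
have [F2 [G2 [hF2 hG2 _]]] := H1cP Hw2.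
have [Fv [Gv [hFv hGv ev]]] := H1cP Hv.
have [Fv1 [Gv1 [hFv1 hGv1 _]]] := H1cP Hv1.
pose p := Jet (fun x => complex.Re (w x)) (dI L (fun x => complex.Re (w x)))
   (dI L (dI L (fun x => complex.Re (w x)))) (fun x => complex.Re (v x)) (dI L (fun x => complex.Re (v x))).
pose q := Jet (fun x => complex.Im (w x)) (dI L (fun x => complex.Im (w x)))
   (dI L (dI L (fun x => complex.Im (w x)))) (fun x => complex.Im (v x)) (dI L (fun x => complex.Im (v x))).
have sp : smooth p.
  split; first by split; [exact: isH1_dI hF hF1|exact: isH1_dI hF1 hF2|exact: isH1_dI hFv hFv1].
  by split; [exists F2|exists Fv1].
have sq : smooth q.
  split; first by split; [exact: isH1_dI hG hG1|exact: isH1_dI hG1 hG2|exact: isH1_dI hGv hGv1].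
  by split; [exists G2|exists Gv1].
have [gp _] := sp; have [gq _] := sq.
have Ew : w = cfun L (pw p) (pw q) by exact: ew.
have Ev : v = cfun L (pv p) (pv q) by exact: ev.
have Ex : (w, v, v L, v 0) = state_of L p q by rewrite /state_of -Ew -Ev.
have b1 : cdI L (flux L P (cfun L (pw p) (pw q))) L = - cdI L (cfun L (pw p) (pw q)) L by rewrite -Ew.
have b2 : cdI L (flux L P (cfun L (pw p) (pw q))) 0 =
   Fbd L th1 th2 th3 th4 (cfun L (pw p) (pw q)) (cfun L (pv p) (pv q)) by rewrite -Ew -Ev.
rewrite (cdI_flux sp sq) cdI_w// /cfun rLL in b1.
rewrite (cdI_flux sp sq) (Fbd_state_of sp sq) /cfun r0L in b2.
case: b1 => b1 b1'; case: b2 => b2 b2'.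
exists p, q; split; [exact: sp|exact: sq|exact: conj b1 b2|exact: conj b1' b2'|exact: Ex].
Qed.

Lemma opA_state_of p q w3 v2 z3 u2 : smooth p -> smooth q -> compatible p -> compatible q ->
  opA (state_of L p q) = state_of L (generator w3 v2 p) (generator z3 u2 q).
Proof.
move=> sp sq [cp1 cp2] [cq1 cq2]; have [gp _] := sp; have [gq _] := sq.
rewrite /opA /state_of (cdI_flux sp sq) (Fbd_state_of sp sq) cdI_w//=; congr (_, _, _, _).
  by rewrite /cfun rLL /stress cp1 cq1.
by rewrite /cfun r0L /stress cp2 cq2.
Qed.

(** The wave equation in jet form: [eta_x] of the image jet is the space derivative of [eta_t p],
    and [eta_t] of the image jet is that of P eta_x. Compatibility identifies the traces at 0 and
    [L], which reduces the claim to [multiplier_dissipation]. *)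
Lemma generator_dissipation : exists K N0 dl : R, [/\ 0 < K, 0 < N0, 0 < dl &
  forall N p w3 v2, N0 <= N -> admissible L p -> isH1 L (pw2 p) w3 -> isH1 L (pv1 p) v2 -> compatible p ->
  lyap_polar L P P1 P0 PM b th3 th4 N K p (generator w3 v2 p) <= - dl * energy L P P1 b p].
Proof.
have [K [N0 [dl [K0 N00 dl0 H]]]] := multiplier_dissipation L_gt0 HP HP1 P0_gt0 P_ge P_le P1_le b_gt0 hab th3_lt0 th4_gt0.
exists K, N0, dl; split => // N p w3 v2 hN gp h3 hv [cp1 cp2].
have [p1 p2 p3] := gp; set p' := generator w3 v2 p.
have Hu : isH1 L (eta_x b p) (fun x => v2 x + b * pw2 p x) := isH1_lin b hv p2.
have Hg : isH1 L (eta_t P P1 b p) (eta_x b p').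
  by apply: (isH1_ext L_gt0 (isH1_lin b (isH1_stress gp h3) p3)).
have bn0 : b != 0 by rewrite gt_eqF.
have e1 : eta_t P P1 b p 0 = feedback p + b * vel_0 p by rewrite /eta_t cp2.
have e2 : feedback p = (th3 / b - a) * vel_0 p + th3 * ((eta_0 b p - vel_0 p) / b) + th4 / b * eta_x b p 0.
  by rewrite /feedback /vel_0 /eta_0 /eta_x; field.
have := H N _ _ _ _ (eta_t P P1 b p') (eta_0 b p) (vel_0 p) (feedback p) hN Hu Hg e1 e2 _.
move=> /(_ (ltac:(by move=> x _; rewrite /eta_t /eta_x /p' /= /stress; ring))).
have gL : eta_tL L b p = eta_t P P1 b p L by rewrite /eta_tL /eta_t cp1.
have g'L : eta_tL L b p' = - eta_x b p L by rewrite /eta_tL /eta_x /p' /= /stress cp1; ring.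
have u0' : eta_0 b p' = eta_t P P1 b p 0 by rewrite /eta_0 /eta_t /p' /= /stress.
have v0' : vel_0 p' = feedback p by rewrite /vel_0 /p' /= /stress cp2.
rewrite /lyap_polar /energy gL g'L u0' v0'; lra.
Qed.

End Generator.

(** * Exponential stability *)

Section LyapunovFunction.
Variables (R : realType) (L : R) (P P1 P2 : R -> R) (P0 PM b th3 th4 N K C CE : R).
Implicit Types (p q : jet R).
Hypotheses (L_gt0 : 0 < L) (HP : isH1 L P P1) (HP1 : isH1 L P1 P2) (P0_gt0 : 0 < P0).
Notation lyap := (lyap L P P1 P0 PM b th3 th4 N K).
Notation energy := (energy L P P1 b).
Hypotheses (lyap_le : forall p, admissible L p -> energy p <= lyap p <= C * energy p)
  (C_ge0 : 0 <= C) (energy_le : forall p, admissible L p -> energy p <= CE * norm2 L p).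

(** Two jet pairs of one state may have different representatives of w'' and v'. The difference jets
    represent the zero state, just as [p - p] and [q - q] do, so their norm vanishes. *)
Lemma norm2_diff p q p' q' : admissible L p -> admissible L q -> admissible L p' -> admissible L q' ->
  state_of L p q = state_of L p' q' -> norm2 L (jet_lin (-1) p p') = 0 /\ norm2 L (jet_lin (-1) q q') = 0.
Proof.
move=> gp gq gp' gq' e.
have BNself r : admissible L r -> norm2 L (jet_lin (-1) r r) = 0.
  by move=> gr; rewrite norm2_lin// /norm2_polar /norm2; ring.
have E : state_of L (jet_lin (-1) p p') (jet_lin (-1) q q') = state_of L (jet_lin (-1) p p) (jet_lin (-1) q q).
  by rewrite !state_of_lin -e.
have := normS_state_of L_gt0 (admissible_lin (-1) gp gp') (admissible_lin (-1) gq gq').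
rewrite E (normS_state_of L_gt0 (admissible_lin (-1) gp gp) (admissible_lin (-1) gq gq)) !BNself// addr0 sqrtr0.
have n1 := norm2_ge0 L (jet_lin (-1) p p'); have n2 := norm2_ge0 L (jet_lin (-1) q q').
move=> /esym /eqP; rewrite sqrtr_eq0 => h.
by split; apply/eqP; rewrite eq_le; apply/andP; split; lra.
Qed.

(** The difference [d] has zero energy, hence [lyap d = 0]. Along p' + s d the form is then affine
    in s and nonnegative, so it is constant. *)
Lemma lyap_eq p p' : admissible L p -> admissible L p' -> norm2 L (jet_lin (-1) p p') = 0 -> lyap p = lyap p'.
Proof.
move=> gp gp' n0; set d := jet_lin (-1) p p'; have gd : admissible L d := admissible_lin (-1) gp gp'.
have W0 r : admissible L r -> 0 <= lyap r.
  by move=> gr; have /andP[h _] := lyap_le gr; apply: le_trans h; exact: energy_ge0.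
have Ed : energy d = 0.
  by apply/eqP; rewrite eq_le energy_ge0 andbT; have := energy_le gd; rewrite n0 mulr0.
have Wd : lyap d = 0.
  by apply/eqP; rewrite eq_le W0// andbT; have /andP[_] := lyap_le gd; rewrite Ed mulr0.
have lin s : lyap (jet_lin s p' d) = lyap p' + s * lyap_polar L P P1 P0 PM b th3 th4 N K p' d.
  by rewrite (lyap_lin _ _ _ _ _ L_gt0 HP HP1)// Wd mulr0 addr0.
set B := lyap_polar _ _ _ _ _ _ _ _ _ _ _ _ in lin.
have B0 : B = 0.
  apply: contrapT => /eqP Bn0.
  have := W0 _ (admissible_lin (- (lyap p' + 1) / B) gp' gd); rewrite lin divfK//; lra.
have {1}-> : p = jet_lin 1 p' d.
  by case: (p) (p') @d {gd n0 Ed Wd lin B B0} => w w1 w2 v v1 [w' w1' w2' v' v1'];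
    congr Jet; apply/funext => x /=; ring.
by rewrite lin B0 mulr0 addr0.
Qed.

(* A state determines its jets only almost everywhere, so the Lyapunov form is transported by choice. *)
Lemma Lyapunov_exists : exists W : St R -> R, forall p q, admissible L p -> admissible L q ->
  W (state_of L p q) = lyap p + lyap q.
Proof.
have /choice[W hW] : forall x : St R, exists r, forall p q, admissible L p -> admissible L q -> x = state_of L p q -> r = lyap p + lyap q.
  move=> x; have [[p [q [gp gq ->]]]|no] := pselect (exists p q, [/\ admissible L p, admissible L q & x = state_of L p q]).
    exists (lyap p + lyap q) => p' q' gp' gq' e.
    have [n1 n2] := norm2_diff gp gq gp' gq' e.
    by rewrite (lyap_eq gp gp' n1) (lyap_eq gq gq' n2).
  by exists 0 => p q gp gq e; case: no; exists p, q.
by exists W => p q gp gq; exact: hW.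
Qed.

End LyapunovFunction.

(** Used for the squared norm and for the Lyapunov function; in the second case the polar formula
    links [W] to [generator_dissipation]. *)
Lemma quadratic_state_of (R : realType) (L : R) (Q : rstate R -> R) (Q5 : jet R -> R)
    (B : jet R -> jet R -> R) : 0 < L ->
  (forall p q, admissible L p -> admissible L q -> Q (state_of L p q) = Q5 p + Q5 q) ->
  (forall s p q, admissible L p -> admissible L q -> Q5 (jet_lin s p q) = Q5 p + s * B p q + s ^+ 2 * Q5 q) ->
  quadratic (inH L : rstate R -> Prop) Q /\ forall p q p' q', admissible L p -> admissible L q -> admissible L p' -> admissible L q' ->
    polar Q (state_of L p q) (state_of L p' q') = B p p' + B q q'.
Proof.
move=> L_gt0 hQ hQ5.
have lin s p q p' q' : admissible L p -> admissible L q -> admissible L p' -> admissible L q' ->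
    Q ((state_of L p q : rstate R) + s *: (state_of L p' q' : rstate R)) =
    Q (state_of L p q) + s * (B p p' + B q q') + s ^+ 2 * Q (state_of L p' q').
  move=> gp gq gp' gq'; rewrite -state_of_lin !hQ ?hQ5//; try exact: admissible_lin.
  by ring.
have pol p q p' q' : admissible L p -> admissible L q -> admissible L p' -> admissible L q' ->
    polar Q (state_of L p q) (state_of L p' q') = B p p' + B q q'.
  by move=> gp gq gp' gq'; have := lin 1 p q p' q' gp gq gp' gq'; rewrite scale1r /polar => ->; ring.
split => // s x y /(inH_P L_gt0)[p [q [gp gq ->]]] /(inH_P L_gt0)[p' [q' [gp' gq' ->]]].
by rewrite pol// lin.
Qed.

Theorem theorem4p3 (R : realType) (L : R) (P : R -> R) (P0 : R)
    (th1 th2 th3 th4 a b : R)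
    (hL : 0 < L)
    (hP : H2r L P) (hP0 : 0 < P0) (hPge : forall x, 0 <= x <= L -> P0 <= P x)
    (ha : 0 < a) (hb : 0 < b) (hab : (a + b - 1) ^+ 2 < 4 * a * b)
    (h1 : th1 = th3 / b - a) (h2 : th2 = th4 / b)
    (h1n : th1 < 0) (h3n : th3 < 0) (h2p : 0 < th2) (h4p : 0 < th4)
    (T : R -> St R -> St R)
    (hT : C0_semigroup_generated_by L P th1 th2 th3 th4 T) :
  exists M omega : R, 1 <= M /\ 0 < omega /\
    forall t x, 0 <= t -> inH L x ->
      normS L (T t x) <= M * expR (- (omega * t)) * normS L x.
Proof.
rewrite {}h1 {}h2 {h1n h2p} in hT *.
have [[P1 HPa] [P2 HPb]] := hP.
have HP : isH1 L P (dI L P) := isH1_dI hL HPa HPb.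
have HP1 : isH1 L (dI L P) P2 := HPb.
have [M0 M00 hM0] := cont_bounded (isH1_cont hL HP).
have [M1 M10 hM1] := cont_bounded (isH1_cont hL HP1).
pose PM := M0 + M1.
have P_le x : 0 <= x <= L -> P x <= PM.
  by move=> xL; rewrite (le_trans (ler_norm _))// (le_trans (hM0 x xL))// lerDl ltW.
have P1_le x : 0 <= x <= L -> `|dI L P x| <= PM.
  by move=> xL; rewrite (le_trans (hM1 x xL))// lerDr ltW.
have [K [N0 [dl [K0 N00 dl0 Hdis]]]] := generator_dissipation hL HP HP1 hP0 hPge P_le P1_le hb hab h3n h4p.
have [N1 N10 HW] := lyap_bounds hL HP HP1 hP0 hPge P_le hb h3n h4p K0.
(* [N0] secures dissipation and [N1] the comparison with the energy; both are available because [K]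
   was fixed first. *)
pose N := Num.max N0 N1.
have [C C0 Hlyap] := HW N (ltac:(by rewrite /N le_max lexx orbT)).
have [CE CE0 Henergy] := energy_dominated b hL HP HP1 hP0 hPge P_le P1_le.
have [CN CN0 Hnorm2] := norm2_dominated hL HP HP1 hP0 hPge P_le P1_le hb.
have [W HWst] := Lyapunov_exists hL HP HP1 Hlyap Henergy.
have r0L : 0 <= (0 : R) <= L by rewrite lexx ltW.
have rLL : 0 <= L <= L by rewrite lexx ltW.
have PL0 : P L != 0 by rewrite gt_eqF// (P_gt0 hP0 hPge).
have P00 : P 0 != 0 by rewrite gt_eqF// (P_gt0 hP0 hPge).
have nE x : Num.sqrt (normS L x ^+ 2) = normS L x.
  by rewrite sqrtr_sqr ger0_norm//; case: x => -[[w v] c] d; exact: sqrtr_ge0.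
have NE p q : admissible L p -> admissible L q -> normS L (state_of L p q) ^+ 2 = norm2 L p + norm2 L q.
  by move=> gp gq; rewrite normS_state_of// sqr_sqrtr// addr_ge0// norm2_ge0.
have [T_H [T_lin [T_bound [T_id [T_add [T_cont T_gen]]]]]] := hT.
have D_H x : inDA L P (th3 / b - a) (th4 / b) th3 th4 x -> inH L x.
  by move=> /(inDA_P hL HP HP1)[p [q [[gp _] [gq _] _ _ ->]]]; exact: inH_state_of.
have [N_quad _] := quadratic_state_of (Q := fun x : rstate R => normS L x ^+ 2) hL NE (norm2_lin hL).
have [W_quad W_pol] := quadratic_state_of hL HWst (lyap_lin P0 PM b th3 th4 hL HP HP1 N K).
have CECE : 0 <= C * CE := mulr_ge0 (ltW C0) CE0.
(* The added 1 makes each comparison constant positive. The rate is [dl / C], because the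
   dissipation is [dl] times the energy and [lyap] is at most [C] times the energy. *)
have [] := @semigroup_decay R (rstate R) (inH L) (inDA L P (th3 / b - a) (th4 / b) th3 th4)
  (opA L P (th3 / b - a) (th4 / b) th3 th4) T (fun x => normS L x ^+ 2) W (CN + 1) (C * CE + 1) (dl / C).
all: cycle -1.
- by move=> M [om [M1' [om0 hM]]]; exists M, om; do 2!split => //; move=> t x t0 hx; have := hM t x t0 hx; rewrite !nE.
- have g0 : admissible L (Jet (fun=> 0) (fun=> 0) (fun=> 0) (fun=> 0) (fun=> 0)) by split; exact: isH1_cst.
  have := inH_state_of hL (admissible_lin (-1) g0 g0) (admissible_lin (-1) g0 g0).
  by rewrite state_of_lin scaleN1r subrr.
- move=> s x y /(inH_P hL)[p [q [gp gq ->]]] /(inH_P hL)[p' [q' [gp' gq' ->]]].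
  by rewrite -state_of_lin; apply: inH_state_of => //; exact: admissible_lin.
- exact: N_quad.
- by move=> x _; exact: sqr_ge0.
- exact: W_quad.
- by rewrite ltr_wpDl.
- by rewrite ltr_wpDl.
- move=> x /(inH_P hL)[p [q [gp gq ->]]]; rewrite NE// HWst//.
  have /andP[p1 p2] := Hlyap p gp; have /andP[q1 q2] := Hlyap q gq.
  have := Hnorm2 p gp; have := Hnorm2 q gq.
  have := ler_wpM2l CN0 p1; have := ler_wpM2l CN0 q1.
  have := energy_ge0 L P (dI L P) b p; have := energy_ge0 L P (dI L P) b q.
  lra.
- move=> x /(inH_P hL)[p [q [gp gq ->]]]; rewrite NE// HWst//.
  have /andP[p1 p2] := Hlyap p gp; have /andP[q1 q2] := Hlyap q gq.
  have := ler_wpM2l (ltW C0) (Henergy p gp); have := ler_wpM2l (ltW C0) (Henergy q gq).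
  have := norm2_ge0 L p; have := norm2_ge0 L q; lra.
- exact: T_H.
- by move=> t s x y t0 hx hy; have := T_lin t x y s%:C%C t0 hx hy; rewrite !addSE !scaleSE.
- by move=> t t0; have [c hc] := T_bound t t0; exists c => x hx; rewrite !nE; exact: hc.
- exact: T_id.
- exact: T_add.
- move=> x hx e e0; have [d [d0 hd]] := T_cont x hx e e0; exists d => // t td.
  by have := hd t td; rewrite nE subSE.
- exact: D_H.
- move=> x /(inDA_P hL HP HP1)[p [q [sp sq cp cq ->]]].
  have [gp [[w3 h3] [v2 hv]]] := sp; have [gq [[z3 k3] [u2 hu]]] := sq.
  rewrite (opA_state_of hL HP HP1 w3 v2 z3 u2 sp sq cp cq); apply: inH_state_of => //; exact: (admissible_generator hL HP HP1).
- move=> x Dx e e0; have [d [d0 hd]] := (T_gen x (D_H x Dx)).1 Dx e e0; exists d => // h hh.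
  by have := hd h hh; rewrite nE subSE scaleSE subSE.
- move=> x y hx hy hr; apply: ((T_gen x hx).2 y hy) => e e0.
  have [d d0 hd] := hr e e0; exists d; split => // h hh.
  by have := hd h hh; rewrite nE subSE scaleSE subSE.
- exact: divr_gt0.
- move=> x /(inDA_P hL HP HP1)[p [q [sp sq cp cq ->]]].
  have [gp [[w3 h3] [v2 hv]]] := sp; have [gq [[z3 k3] [u2 hu]]] := sq.
  rewrite (opA_state_of hL HP HP1 w3 v2 z3 u2 sp sq cp cq).
  rewrite W_pol//; try exact: (admissible_generator hL HP HP1).
  have N0N : N0 <= N by rewrite /N le_max lexx.
  have d1 := Hdis N p w3 v2 N0N gp h3 hv cp; have d2 := Hdis N q z3 u2 N0N gq k3 hu cq.
  have /andP[_ p2] := Hlyap p gp; have /andP[_ q2] := Hlyap q gq.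
  have dC : 0 <= dl / C by rewrite divr_ge0// ltW.
  have dCE (E : R) : dl / C * (C * E) = dl * E by rewrite mulrA divfK// gt_eqF.
  have := ler_wpM2l dC p2; have := ler_wpM2l dC q2; rewrite !dCE HWst//; lra.
- move=> x /(inH_P hL)[p [q [gp gq ->]]] e e0.
  have e20 : 0 < e ^+ 2 / 2 by rewrite divr_gt0// exprn_gt0.
  have [p' [sp cp np]] := compatible_dense (dI L P) (th3 / b - a) (th4 / b) th3 th4 hL PL0 P00 gp e20.
  have [q' [sq cq nq]] := compatible_dense (dI L P) (th3 / b - a) (th4 / b) th3 th4 hL PL0 P00 gq e20.
  have [gp' _] := sp; have [gq' _] := sq.
  exists (state_of L p' q'); first exact: (inDA_state_of hL HP HP1).
  rewrite -(scaleN1r (state_of L p' q' : rstate R)) -state_of_lin NE; try exact: admissible_lin.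
  rewrite -[e]ger0_norm ?ltW// -sqrtr_sqr ltr_sqrt ?exprn_gt0//; lra.
Qed.
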